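(* Let $\mathcal{HA}$ denote the Harmonic archipelago. Then its Čech cohomology groups with integer coefficients satisfy $$\check{H}^2(\mathcal{HA};\mathbb{Z})\cong \Big(\prod_{i\in\mathbb{N}}\mathbb{Z}\Big)\Big/\Big(\sum_{i\in\mathbb{N}}\mathbb{Z}\Big),$$ and $\check{H}^n(\mathcal{HA};\mathbb{Z})\cong 0$ for all $n\neq 0,2$.
   Context: Here $\mathbb{N}=\{1,2,3,\dots\}$, $\prod_{i\in\mathbb{N}}\mathbb{Z}$ is the group of all integer sequences and $\sum_{i\in\mathbb{N}}\mathbb{Z}$ is its subgroup of finitely supported sequences (the direct sum). $\check{H}^n(X;\mathbb{Z})$ denotes the $n$-th Čech cohomology group of the space $X$ with coefficients in $\mathbb{Z}$ (the direct limit, over open covers of $X$ ordered by refinement, of the cohomology of the nerves). The Hawaiian earring is $\mathbb{H}=\bigcup_{n\in\mathbb{N}}K_n\subset\mathbb{R}^2$, where $K_n=\{(x,y)\in\mathbb{R}^2 : x^2+(y-\frac1n)^2=(\frac1n)^2\}$. The Harmonic archipelago $\mathcal{HA}$ is the noncompact subspace of $\mathbb{R}^3$ obtained from $\mathbb{H}$ by adjoining, for each $n$, a ''tall'' disk (of height $1$) between the consecutive loops $K_n$ and $K_{n+1}$. Concretely: let $D\subset\mathbb{R}^2$ be the closed disk bounded by $K_1$. For $n\in\mathbb{N}$ let $p_n=(0,\frac1n+\frac1{n+1})$ and $r_n=\frac{1}{2n(n+1)}$, so that the closed disk $B_n$ of center $p_n$ and radius $r_n$ lies in the open crescent-shaped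 region inside $K_n$ and outside $K_{n+1}$. Define $f:D\to\mathbb{R}$ by $f(p)=1-|p-p_n|/r_n$ if $p\in B_n$ for some $n$, and $f(p)=0$ otherwise. Then $\mathcal{HA}=\{(x,y,f(x,y)) : (x,y)\in D\}\subset\mathbb{R}^3$ with the subspace topology (note that $f$ is discontinuous at the origin). *)

(* Defs.v *)
From HB Require Import structures.
From mathcomp Require Import all_boot all_order perm all_algebra.
From mathcomp Require Import all_classical all_reals topology normedtype.
Import Order.TTheory GRing.Theory Num.Theory.
Import numFieldNormedType.Exports.

Set Implicit Arguments.
Unset Strict Implicit.
Unset Printing Implicit Defensive.

Local Open Scope classical_set_scope.
Local Open Scope ring_scope.

Definition zmod_isomorphic (A B : zmodType) : Prop :=
  exists f : {additive A -> B}, bijective f.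

Definition direct_product (I : Type) (G : I -> zmodType) : Type :=
  forall i, G i.

Section DirectProduct.
Variables (I : Type) (G : I -> zmodType).

HB.instance Definition _ := gen_eqMixin (direct_product G).
HB.instance Definition _ := gen_choiceMixin (direct_product G).

Let add (f g : direct_product G) : direct_product G := fun i => f i + g i.
Let opp (f : direct_product G) : direct_product G := fun i => - f i.
Let zero : direct_product G := fun=> 0.

Let addA : associative add.
Proof.
by move=> f g h; apply: functional_extensionality_dep => i; exact: addrA.
Qed.
Let addC : commutative add.
Proof.
by move=> f g; apply: functional_extensionality_dep => i; exact: addrC.
Qed.
Let add0 : left_id zero add.
Proof.
by move=> f; apply: functional_extensionality_dep => i; exact: add0r.
Qed.
Let addN : left_inverse zero opp add.
Proof.
by move=> f; apply: functional_extensionality_dep => i; exact: addNr.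
Qed.

HB.instance Definition _ :=
  GRing.isZmodule.Build (direct_product G) addA addC add0 addN.

Definition finitely_supported : {pred direct_product G} :=
  fun f => `[< finite_set [set i | f i != 0] >].

Fact finitely_supported_zmod_closed : zmod_closed finitely_supported.
Proof.
split=> [|f g /asboolP fin_f /asboolP fin_g]; apply/asboolP.
  by apply: (sub_finite_set _ (finite_set0 I)) => i /=; rewrite eqxx.
apply: (sub_finite_set (B := [set i | f i != 0] `|` [set i | g i != 0])).
  move=> i /= fgi; apply/orP; apply: contraNT fgi.
  rewrite negb_or !negbK => /andP[/eqP fi /eqP gi]; apply/eqP.
  by rewrite -[LHS]/(f i - g i) fi gi subrr.
by rewrite finite_setU.
Qed.

HB.instance Definition _ :=
  GRing.isZmodClosed.Build (direct_product G) finitely_supported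
    finitely_supported_zmod_closed.

Record direct_sum : Type := DirectSum {
  direct_sum_val :> direct_product G;
  _ : direct_sum_val \in finitely_supported
}.

HB.instance Definition _ := [isSub for direct_sum_val].
HB.instance Definition _ := [Choice of direct_sum by <:].
HB.instance Definition _ := [SubChoice_isSubZmodule of direct_sum by <:].

End DirectProduct.

Section DirectLimit.
Variables (I : eqType) (G : I -> zmodType) (T : forall i j, set (G i -> G j)).

Fact direct_sum_inj_subproof i (x : G i) :
  (dfwith (fun j => 0 : G j) i x : direct_product G)
    \in @finitely_supported I G.
Proof.
apply/asboolP; apply: (sub_finite_set _ (finite_set1 i)) => j /=.
by case: (dfwithP (fun k => 0 : G k) x j) => //= k ik; rewrite eqxx.
Qed.

Definition direct_sum_inj i (x : G i) : direct_sum G :=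
  DirectSum (direct_sum_inj_subproof x).

Definition limit_relators : set (direct_sum G) :=
  [set r | exists i j (t : G i -> G j) (x : G i),
     T t /\ r = direct_sum_inj x - direct_sum_inj (t x)].

Definition limit_relations : {pred direct_sum G} :=
  fun r => `[< smallest
                 (fun S : set (direct_sum G) => zmod_closed (fun x => x \in S))
                 limit_relators r >].

Fact limit_relations_zmod_closed : zmod_closed limit_relations.
Proof.
split=> [|x y /asboolP Rx /asboolP Ry]; apply/asboolP => S [S_closed relS].
  by apply/set_mem; exact: S_closed.1.
by apply/set_mem/S_closed.2; apply/mem_set; [exact: Rx | exact: Ry].
Qed.

HB.instance Definition _ :=
  GRing.isZmodClosed.Build (direct_sum G) limit_relations
    limit_relations_zmod_closed.

(** [T i j] may contain several maps: this is the colimit of the diagram they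
    form, and the usual direct limit when each [T i j] has at most one element
    and the system is directed. *)
Definition direct_limit : zmodType :=
  @Quotient.quot (direct_sum G) limit_relations.

End DirectLimit.

Record simplicial_complex (V : Type) := SimplicialComplex {
  simplex : set (set V);
  simplex_finite : forall s, simplex s -> finite_set s;
  simplex_neq0 : forall s, simplex s -> s !=set0;
  simplex_sub : forall s t, simplex s -> t `<=` s -> t !=set0 -> simplex t
}.

Section SimplicialCohomology.
Variables (V : Type) (K : simplicial_complex V) (A : zmodType).

(** Repetitions of vertices are allowed. *)
Record ordered_simplex (n : nat) : Type := OrderedSimplex {
  vertices :> 'I_n.+1 -> V;
  range_vertices : simplex K (range vertices)
}.

Lemma ordered_simplex_eq n (v w : ordered_simplex n) :
  v = w :> ('I_n.+1 -> V) -> v = w.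
Proof.
case: v w => [v Kv] [w Kw] /= vw; rewrite -vw in Kw *.
by rewrite (Prop_irrelevance Kv Kw).
Qed.

Fact reindex_simplex_subproof m n (g : 'I_m.+1 -> 'I_n.+1)
    (v : ordered_simplex n) :
  simplex K (range (v \o g)).
Proof.
apply: (simplex_sub (range_vertices v)); last by exists (v (g ord0)), ord0.
by move=> _ [i _ <-]; exists (g i).
Qed.

Definition reindex_simplex m n (g : 'I_m.+1 -> 'I_n.+1)
    (v : ordered_simplex n) : ordered_simplex m :=
  OrderedSimplex (reindex_simplex_subproof g v).

Definition cochain (n : nat) : Type := ordered_simplex n -> A.

HB.instance Definition _ n := GRing.Zmodule.on (cochain n).

(** The homomorphisms to [A] from the group of oriented [n]-chains of [K]. *)
Definition alternating n (c : cochain n) : Prop :=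
  (forall (s : 'S_n.+1) (v : ordered_simplex n),
     c (reindex_simplex s v) = c v *~ ((-1) ^+ s)) /\
  (forall v : ordered_simplex n, ~ injective v -> c v = 0).

Definition coboundary n (c : cochain n) : cochain n.+1 :=
  fun v => \sum_(i < n.+2) c (reindex_simplex (lift i) v) *~ ((-1) ^+ i).

Lemma coboundaryB n : {morph @coboundary n : b c / b - c}.
Proof.
move=> b c; apply/funext => v; rewrite -[RHS]/(coboundary b v - coboundary c v).
by rewrite /coboundary -sumrB; apply: eq_bigr => i _; rewrite -mulrzBl.
Qed.

Lemma coboundary0 n : coboundary (0 : cochain n) = 0.
Proof. by rewrite -[0 in LHS](subrr 0) coboundaryB subrr. Qed.

Lemma alternating0 n : alternating (0 : cochain n).
Proof. by split=> // s v; rewrite -[RHS]/(0 *~ _) mul0rz. Qed.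

Lemma alternatingB n (b c : cochain n) :
  alternating b -> alternating c -> alternating (b - c).
Proof.
move=> [b_sgn b_deg] [c_sgn c_deg]; split=> [s v|v v_deg].
  rewrite -[LHS]/(b (reindex_simplex s v) - c (reindex_simplex s v)).
  by rewrite b_sgn c_sgn -mulrzBl.
by rewrite -[LHS]/(b v - c v) b_deg // c_deg // subrr.
Qed.

Definition is_cocycle n : {pred cochain n} :=
  fun c => `[< alternating c /\ coboundary c = 0 >].

Fact is_cocycle_zmod_closed n : zmod_closed (@is_cocycle n).
Proof.
split=> [|b c /asboolP[b_alt db] /asboolP[c_alt dc]]; apply/asboolP.
  by split; [exact: alternating0 | exact: coboundary0].
by split; [exact: alternatingB | rewrite coboundaryB db dc subrr].
Qed.

HB.instance Definition _ n :=
  GRing.isZmodClosed.Build (cochain n) (@is_cocycle n)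
    (@is_cocycle_zmod_closed n).

Record cocycle (n : nat) : Type :=
  Cocycle { cocycle_val :> cochain n;
            cocycleP : cocycle_val \in @is_cocycle n }.

HB.instance Definition _ n := [isSub for @cocycle_val n].
HB.instance Definition _ n := [Choice of cocycle n by <:].
HB.instance Definition _ n := [SubChoice_isSubZmodule of cocycle n by <:].

Definition is_coboundary n : {pred cocycle n} :=
  match n return {pred cocycle n} with
  | 0 => fun z => z == 0
  | m.+1 => fun z => `[< exists2 b : cochain m,
                           alternating b & coboundary b = cocycle_val z >]
  end.

Fact is_coboundary_zmod_closed n : zmod_closed (@is_coboundary n).
Proof.
case: n => [|m].
  split=> [|y z /eqP y0 /eqP z0]; first exact/eqP.
  by apply/eqP; rewrite y0 z0 subrr.
split=> [|y z /asboolP[b b_alt db] /asboolP[c c_alt dc]]; apply/asboolP.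
  by exists 0; [exact: alternating0 | rewrite coboundary0].
by exists (b - c); [exact: alternatingB | rewrite coboundaryB db dc].
Qed.

HB.instance Definition _ n :=
  GRing.isZmodClosed.Build (cocycle n) (@is_coboundary n)
    (@is_coboundary_zmod_closed n).

Definition cohomology (n : nat) : zmodType :=
  @Quotient.quot (cocycle n) (@is_coboundary n).

Definition cohomology_class n (z : cocycle n) : cohomology n :=
  (\pi_(@Quotient.quot (cocycle n) (@is_coboundary n)) z)%qT.

End SimplicialCohomology.

Definition simplicial_map (V W : Type) (K : simplicial_complex V)
    (L : simplicial_complex W) (f : V -> W) : Prop :=
  forall s, simplex K s -> simplex L (f @` s).

Section Functoriality.
Variables (V W : Type) (K : simplicial_complex V) (L : simplicial_complex W).
Variables (f : V -> W) (f_simpl : simplicial_map K L f) (A : zmodType).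

Fact pushforward_subproof n (v : ordered_simplex K n) :
  simplex L (range (f \o v)).
Proof. by have := f_simpl (range_vertices v); rewrite image_comp. Qed.

Definition pushforward n (v : ordered_simplex K n) : ordered_simplex L n :=
  OrderedSimplex (pushforward_subproof v).

Lemma pushforward_reindex m n (g : 'I_m.+1 -> 'I_n.+1)
    (v : ordered_simplex K n) :
  pushforward (reindex_simplex g v) = reindex_simplex g (pushforward v).
Proof. exact: ordered_simplex_eq. Qed.

Definition pullback n (c : cochain L A n) : cochain K A n :=
  c \o @pushforward n.

Lemma pullback_alternating n (c : cochain L A n) :
  alternating c -> alternating (pullback c).
Proof.
move=> [c_sgn c_deg]; split=> [s v|v v_deg].
  by rewrite /pullback /= pushforward_reindex c_sgn.
by apply: c_deg => fv_inj; apply: v_deg; exact: inj_compr fv_inj.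
Qed.

Lemma pullback_coboundary n (c : cochain L A n) :
  coboundary (pullback c) = pullback (coboundary c).
Proof.
apply/funext => v; apply: eq_bigr => i _.
by rewrite /pullback /= pushforward_reindex.
Qed.

Fact pullback_cocycle_subproof n (z : cocycle L A n) :
  pullback z \in @is_cocycle _ K A n.
Proof.
have /asboolP[z_alt dz] := cocycleP z; apply/asboolP.
by split; [exact: pullback_alternating | rewrite pullback_coboundary dz].
Qed.

Definition pullback_cocycle n (z : cocycle L A n) : cocycle K A n :=
  Cocycle (pullback_cocycle_subproof z).

Definition cohomology_map n (x : cohomology L A n) : cohomology K A n :=
  cohomology_class (pullback_cocycle (repr x)).

Lemma cohomology_mapE n (z : cocycle L A n) :
  cohomology_map (cohomology_class z) = cohomology_class (pullback_cocycle z).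
Proof.
rewrite /cohomology_map /cohomology_class; apply/eqP.
rewrite -Quotient.idealrBE.
set y := repr _.
have : y - z \in @is_coboundary _ L A n by rewrite Quotient.idealrBE reprK.
clearbody y; case: n z y => [|m] z y.
  move=> /eqP/subr0_eq ->; by rewrite subrr; exact: rpred0.
move=> /asboolP[b b_alt db]; apply/asboolP; exists (pullback b).
  exact: pullback_alternating.
by rewrite pullback_coboundary db.
Qed.

End Functoriality.

Section Nerve.
Variable X : Type.

Definition nerve_simplices (U : set (set X)) : set (set (set X)) :=
  [set s | [/\ s `<=` U, finite_set s, s !=set0 & \bigcap_(B in s) B !=set0]].

Program Definition nerve (U : set (set X)) : simplicial_complex (set X) :=
  @SimplicialComplex _ (nerve_simplices U) _ _ _.
Next Obligation. by move=> U s []. Qed.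
Next Obligation. by move=> U s []. Qed.
Next Obligation.
move=> U s t [sU s_fin _ [x sx]] ts t0; split=> //.
- exact: subset_trans sU.
- exact: sub_finite_set s_fin.
- by exists x => B /ts; exact: sx.
Qed.

(** Only the values of [r] on the members of [W] matter. *)
Definition refinement_map (U W : set (set X)) (r : set X -> set X) : Prop :=
  forall B, W B -> U (r B) /\ B `<=` r B.

Lemma refinement_map_simplicial U W r :
  refinement_map U W r -> simplicial_map (nerve W) (nerve U) r.
Proof.
move=> rP s [sW s_fin [B sB] [x sx]]; split.
- by move=> _ [C sC <-]; have [] := rP C (sW C sC).
- exact: finite_image.
- by exists (r B), B.
- by exists x => _ [C sC <-]; have [_] := rP C (sW C sC); apply; exact: sx.
Qed.

End Nerve.

Definition open_cover (X : topologicalType) : set (set (set X)) :=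
  [set U | (forall B, U B -> open B) /\ \bigcup_(B in U) B = setT].
Arguments open_cover X : clear implicits.

(** Different refinement maps between the same two covers induce contiguous
    maps of nerves, hence the same map in cohomology, so that admitting all of
    them as transition maps amounts to choosing one for each pair of covers. *)
Definition cech_transition (X : topologicalType) (A : zmodType) (n : nat)
    (U W : open_cover X) :
    set (cohomology (nerve (val U)) A n -> cohomology (nerve (val W)) A n) :=
  [set t | exists r (rP : refinement_map (val U) (val W) r),
     t = @cohomology_map _ _ _ _ r (refinement_map_simplicial rP) A n].

Definition cech_cohomology (n : nat) (X : topologicalType) (A : zmodType) :
    zmodType :=
  direct_limit (@cech_transition X A n).

Section HarmonicArchipelago.
Variable R : realType.

(** The product norm on [R * R] is the sup norm. *)
Definition euclidean_dist (p q : R * R) : R :=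
  Num.sqrt ((p.1 - q.1) ^+ 2 + (p.2 - q.2) ^+ 2).

Definition big_disk : set (R * R) := [set p | euclidean_dist p (0, 1) <= 1].

Definition bump_center (n : nat) : R * R := (0, n%:R^-1 + n.+1%:R^-1).

Definition bump_radius (n : nat) : R := (2 * n%:R * n.+1%:R)^-1.

(** Indices start at 1: for [n = 0] the formulas would describe the one-point
    disk at (0, 1). *)
Definition bump_disk (n : nat) : set (R * R) :=
  [set p | (0 < n)%N /\ euclidean_dist p (bump_center n) <= bump_radius n].

(** The disks [bump_disk n] are pairwise disjoint, so [n] below is unique. *)
Definition height (p : R * R) : R :=
  if pselect (exists n, bump_disk n p) is left ex
  then let n := sval (cid ex) in
       1 - euclidean_dist p (bump_center n) / bump_radius n
  else 0.

Definition harmonic_archipelago : set (R * R * R) :=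
  [set q | big_disk q.1 /\ q.2 = height q.1].

Definition HA : topologicalType := set_type harmonic_archipelago.

End HarmonicArchipelago.

Definition int_sequences_mod_finite : zmodType :=
  @Quotient.quot (direct_product (fun _ : nat => int))
    (@finitely_supported nat (fun=> int)).

(* Main.v *)
Require Import Defs.
From HB Require Import structures.
From mathcomp Require Import all_boot all_order perm all_algebra.
From mathcomp Require Import all_classical all_reals topology normedtype.
From mathcomp Require Import zify ring lra wochoice.
Import Order.TTheory GRing.Theory Num.Theory.
Import numFieldNormedType.Exports.

(** The archipelago is a metric space, hence fully normal, and its Cech
    cohomology is the Alexander-Spanier cohomology: functions on tuples of
    points modulo those which vanish near the diagonal.  Inversion at the
    origin turns the archipelago minus the origin into a half-plane
    [{(u, v) | 1 <= v}], with the bumps centred on the axis [u = 0], and the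
    origin into a point at infinity, whose neighbourhoods [N] leave out a
    compact set and the tops of the bumps.  The half-plane is contractible, and
    cochains near the origin are coned off from the origin, so a cocycle of
    positive degree [n] on the archipelago amounts to a cocycle of degree
    [n - 1] on a punctured neighbourhood [N], up to shrinking [N].  Now [N] is
    the union of a left and a right part which both contract by moving away from
    the axis, and whose intersection consists of horizontal strips, one for each
    gap between consecutive bumps.  The strips being convex, only degree [2]
    survives, where a class amounts to an integer for each gap, up to finitely
    many gaps and to a common constant; taking differences of consecutive
    integers gives the quotient of all sequences by the finitely supported
    ones. *)

(** Cochains are arbitrary functions on all lists of points, and conditions on them are imposed near
    the diagonal only. A cochain on a subset thus extends to the whole space by junk, and a
    Mayer-Vietoris argument becomes a definition by cases on lists. The price is paid in homotopy
    invariance: the prism between the two ends of a homotopy is useless unless the ends are close,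
    so a homotopy has to be cut into small steps, whose size varies with the point but must stay
    locally uniform. The integers attached to the gaps are independent because all bumps have the
    same height: every neighbourhood of the origin omits every top. Up to homotopy, its punctured
    part is a graph with two vertices, left and right, and one edge for each remaining gap.
    Nontriviality requires control of a direct limit that is given by generators and relations; the
    class of the germ serves as an invariant that is preserved by every relator. *)

Set Implicit Arguments.
Unset Strict Implicit.
Unset Printing Implicit Defensive.

Local Open Scope classical_set_scope.
Local Open Scope ring_scope.

(** * Cochains on lists, prism operators, alternation *)

Section ListCochains.
Variables P Q : Type.
Implicit Types (c b : seq P -> int) (s : seq P) (x : P).

(** A list of [n + 1] points stands for an [n]-simplex, so that [delta] is the
    coboundary of the augmented complex. *)
Fixpoint delta T (c : seq T -> int) (s : seq T) : int :=
  if s is x :: s' then c s' - delta (fun t => c (x :: t)) s' else 0.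

Lemma delta_ext c c' s : c =1 c' -> delta c s = delta c' s.
Proof.
elim: s c c' => //= x s IHs c c' cc'; rewrite cc'.
by rewrite (IHs _ (fun t => c' (x :: t))) // => t; exact: cc'.
Qed.

Lemma deltaD c b s : delta (fun t => c t + b t) s = delta c s + delta b s.
Proof. by elim: s c b => [|x s IHs] c b /=; rewrite ?addr0// IHs; ring. Qed.

Lemma deltaB c b s : delta (fun t => c t - b t) s = delta c s - delta b s.
Proof. by elim: s c b => [|x s IHs] c b /=; rewrite ?subr0// IHs; ring. Qed.

Lemma deltaN c s : delta (fun t => - c t) s = - delta c s.
Proof. by elim: s c => [|x s IHs] c /=; rewrite ?oppr0// IHs; ring. Qed.

Lemma delta_zero s : delta (fun=> 0) s = 0.
Proof. by elim: s => //= x s ->; rewrite subr0. Qed.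

Lemma delta_sum (F : nat -> seq P -> int) n s :
  delta (fun t => \sum_(i < n) F i t) s = \sum_(i < n) delta (F i) s.
Proof.
elim: n => [|n IHn].
  rewrite big_ord0 -[RHS](delta_zero s).
  by apply: delta_ext => t; rewrite big_ord0.
rewrite big_ord_recr /= -IHn -deltaD.
by apply: delta_ext => t; rewrite big_ord_recr.
Qed.

Lemma delta_delta c s : delta (delta c) s = 0.
Proof.
elim: s c => //= x s IHs c.
by rewrite (deltaB c (delta (fun u => c (x :: u)))) IHs subr0 subrr.
Qed.

(** This integrates a cocycle near a point [p] by coning: the primitive is explicit and needs no
    homotopy. *)
Lemma delta_cone p c s : delta c (p :: s) = 0 -> delta (fun t => c (p :: t)) s = c s.
Proof. by move=> /= /eqP; rewrite subr_eq0 eq_sym => /eqP. Qed.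

Lemma eq_delta_on (A : set P) m c c' s :
  (forall t, size t = m -> (forall x, List.In x t -> A x) -> c t = c' t) ->
  size s = m.+1 -> (forall x, List.In x s -> A x) -> delta c s = delta c' s.
Proof.
elim: m s c c' => [|m IHm] [|x s] c c' cc' //= [sm] sA.
  by move: sm => /size0nil -> /=; rewrite cc'.
rewrite cc' //; last by move=> y ys; apply: sA; right.
congr (_ - _); apply: IHm => //; last by move=> y ys; apply: sA; right.
move=> t tm tA; apply: cc'; first by rewrite /= tm.
by move=> y /= [<-|/tA//]; apply: sA; left.
Qed.

Lemma delta_map T (f : P -> T) (c : seq T -> int) s :
  delta (fun t => c (map f t)) s = delta c (map f s).
Proof.
by elim: s c => //= x s IHs c; rewrite (IHs (fun t => c (f x :: t))).
Qed.

Lemma delta_nseq c m p :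
  delta c (nseq m p) = if odd m then c (nseq m.-1 p) else 0.
Proof.
elim: m c => //= m IHm c; rewrite IHm.
case: (boolP (odd m)) => /= m_odd; last by rewrite subr0.
by case: m m_odd {IHm} => //= m _; rewrite subrr.
Qed.

Lemma delta_const (a : int) s :
  delta (fun=> a) s = if odd (size s) then a else 0.
Proof. by elim: s => //= x s ->; case: odd => //=; rewrite ?subr0 ?subrr. Qed.

End ListCochains.

Section Prism.
Variables (P Q : Type) (f g : P -> Q).

(** Unrolled, this is the alternating sum of [c] over the lists f x_0, ..., f x_i, g x_i, ..., g
    x_n, the usual chain homotopy between [f] and [g]. *)
Fixpoint prism (c : seq Q -> int) (s : seq P) : int :=
  if s is x :: s' then
    c [:: f x, g x & map g s'] - prism (fun t => c (f x :: t)) s'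
  else 0.

Lemma prism_ext c c' s : c =1 c' -> prism c s = prism c' s.
Proof.
elim: s c c' => //= x s IHs c c' cc'; rewrite cc'.
by rewrite (IHs _ (fun t => c' (f x :: t))) // => t; exact: cc'.
Qed.

Lemma prismB c c' s : prism (fun t => c t - c' t) s = prism c s - prism c' s.
Proof. by elim: s c c' => [|x s IHs] c c' /=; rewrite ?subr0// IHs; ring. Qed.

Lemma prism_delta c s :
  delta (prism c) s + prism (delta c) s = c (map g s) - c (map f s).
Proof.
elim: s c => [|x s IHs] c /=; first by rewrite addr0 subrr.
have -> : delta (fun t => prism c (x :: t)) s =
   delta (fun t => c [:: f x, g x & map g t]) s -
   delta (prism (fun t => c (f x :: t))) s.
  by rewrite -deltaB; apply: delta_ext.
have -> : prism (fun t => delta c (f x :: t)) s =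
   prism c s - prism (delta (fun t => c (f x :: t))) s.
  by rewrite -prismB; apply: prism_ext.
rewrite (delta_map g (fun t => c [:: f x, g x & t])).
have /= := IHs (fun t => c (f x :: t)).
set a := delta _ _; set b := prism _ _; set e := prism _ _.
set k := delta _ _; move=> h.
have -> : a = c (f x :: map g s) - c (f x :: map f s) - b by rewrite -h; ring.
ring.
Qed.

Lemma prism_eq0 c s :
  (forall t, size t = (size s).+1 ->
     (forall y, List.In y t -> exists2 x, List.In x s & y = f x \/ y = g x) ->
     c t = 0) ->
  prism c s = 0.
Proof.
elim: s c => //= x s IHs c c0; rewrite c0 /= ?size_map//; last first.
  move=> y [<-|[<-|]]; [by exists x; auto|by exists x; auto|].
  elim: {IHs c0} s => //= z s IHs [<-|/IHs[w [->|ws] yw]].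
  - by exists z; auto.
  - by exists w; auto.
  - by exists w; auto.
rewrite sub0r IHs ?oppr0// => t ts tin; apply: c0; first by rewrite /= ts.
move=> y /= [<-|/tin[w ws yw]]; first by exists x; auto.
by exists w; auto.
Qed.

End Prism.

Section Alternation.
Variables (V : Type) (K : simplicial_complex V).

Lemma reindex_simplex_comp m n p (g : 'I_m.+1 -> 'I_n.+1)
    (h : 'I_n.+1 -> 'I_p.+1) (v : ordered_simplex K p) :
  reindex_simplex g (reindex_simplex h v) = reindex_simplex (h \o g) v.
Proof. exact: ordered_simplex_eq. Qed.

(** Permuting the vertices permutes the faces. The degenerate case follows from the sign rule:
    transposing two equal vertices fixes the simplex and negates the value, and [int] has no
    2-torsion. *)
Lemma alternating_delta n (c : cochain K int n) :
  alternating c -> alternating (coboundary c).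
Proof.
move=> [c_sgn c_deg].
have sgn (s : 'S_n.+2) (v : ordered_simplex K n.+1) :
   coboundary c (reindex_simplex s v) = coboundary c v *~ ((-1) ^+ s).
  rewrite /coboundary [in RHS](reindex_inj (@perm_inj _ s)) /=.
  rewrite mulrz_suml; apply: eq_bigr => i _.
  (* [t] is induced by [s] from the face opposite to [i] to the face opposite to [s i]; the default
     [j] below is never reached because [s] is injective. *)
  have [t st] : exists t : 'S_n.+1, forall j, s (lift i j) = lift (s i) (t j).
    have f_inj : injective (fun j => odflt j (unlift (s i) (s (lift i j)))).
      move=> j k; case: unliftP => [j' jj'|/perm_inj/esym/eqP];
        last by rewrite eq_liftF.
      case: unliftP => [k' kk'|/perm_inj/esym/eqP]; last by rewrite eq_liftF.
      move=> /= jk; apply: (@lift_inj _ i); apply: (@perm_inj _ s).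
      by rewrite jj' kk' jk.
    exists (perm f_inj) => j; rewrite permE; case: unliftP => //=.
    by move=> /perm_inj/esym/eqP; rewrite eq_liftF.
  have -> : reindex_simplex (lift i) (reindex_simplex s v) =
            reindex_simplex t (reindex_simplex (lift (s i)) v).
    rewrite !reindex_simplex_comp; apply: ordered_simplex_eq.
    by apply/funext => j /=; rewrite st.
  rewrite c_sgn -!mulrzA; congr (_ *~ _).
  have -> : s = lift_perm i (s i) t.
    apply/permP => j; case: (unliftP i j) => [k ->|->].
      by rewrite lift_perm_lift st.
    by rewrite lift_perm_id.
  rewrite odd_lift_perm lift_perm_id.
  rewrite !signr_addb !signr_odd.
  have sign_id (a b e : int) : a ^+ 2 = 1 -> e * b = a * (b * a * e).
    move=> a1; have -> : a * (b * a * e) = a ^+ 2 * (e * b) by ring.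
    by rewrite a1 mul1r.
  exact/sign_id/sqrr_sign.
split=> // v v_deg.
have [i [j [ij vij]]] : exists i j, i != j /\ v i = v j.
  apply: contrapT => h; apply: v_deg => i j vij; apply/eqP.
  by apply: contrapT => /negP ij; apply: h; exists i, j.
have := sgn (tperm i j) v.
have -> : reindex_simplex (tperm i j) v = v.
  apply: ordered_simplex_eq; apply/funext => k /=.
  by case: tpermP => // ->.
by rewrite odd_tperm ij expr1 mulrN1z; lia.
Qed.


End Alternation.

(** * Making a primitive alternating *)

Section AlternatingPrimitive.
Variables (V : eqType) (K : simplicial_complex V) (R : rel V).
Hypothesis Rtot : total_order R.

Definition increasing n (w : 'I_n.+1 -> V) :=
  forall i j : 'I_n.+1, (i < j)%N -> R (w i) (w j).

Lemma increasing_sorted n (w : 'I_n.+1 -> V) :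
  increasing w -> sorted R [seq w i | i <- enum 'I_n.+1].
Proof.
have [[[_ Rtr] _] _] := Rtot.
move=> w_inc; rewrite (sorted_pairwise Rtr); apply/(pairwiseP (w ord0)) => i j.
rewrite !inE size_map size_enum_ord => i_n j_n ij.
rewrite !(nth_map ord0 _ w) ?size_enum_ord//.
by apply: w_inc; rewrite !nth_enum_ord.
Qed.

Lemma exists_sorting n (v : 'I_n.+1 -> V) :
  exists s : 'S_n.+1, increasing (v \o s).
Proof.
have [[[_ Rtr] _] Rt] := Rtot.
have : perm_eq (sort R [tuple v i | i < n.+1]) [tuple v i | i < n.+1].
  by rewrite perm_sort.
move=> /tuple_permP[s vs]; exists s => i j ij.
have := sort_sorted Rt [tuple v i | i < n.+1].
rewrite vs => /(sorted_ltn_nth Rtr (v ord0)) /(_ i j).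
rewrite !inE size_tuple => /(_ (ltn_ord i) (ltn_ord j) ij).
by rewrite -!(tnth_nth _ _) !tnth_mktuple.
Qed.

Lemma sorting_uniq n (v : 'I_n.+1 -> V) (p q : 'S_n.+1) :
  injective v -> increasing (v \o p) -> increasing (v \o q) -> p = q.
Proof.
have [[[_ Rtr] Ranti] Rt] := Rtot.
move=> v_inj /increasing_sorted vp /increasing_sorted vq.
have enumE (s : 'S_n.+1) : perm_eq [seq v (s i) | i <- enum 'I_n.+1]
    [seq v i | i <- enum 'I_n.+1].
  rewrite (map_comp v s); apply: perm_map; apply: uniq_perm.
  - by rewrite map_inj_uniq ?enum_uniq//; exact: perm_inj.
  - exact: enum_uniq.
  - move=> i; rewrite mem_enum; apply/mapP; exists (s^-1%g i).
      by rewrite mem_enum.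
    by rewrite permKV.
have /eq_in_map pq : [seq (v \o p) i | i <- enum 'I_n.+1] =
                     [seq (v \o q) i | i <- enum 'I_n.+1].
  apply: (sorted_eq Rtr Ranti vp vq).
  by rewrite (permPl (enumE p)) perm_sym (permPl (enumE q)).
by apply/permP => i; apply: v_inj; apply: pq; rewrite mem_enum.
Qed.

Definition sorting n (v : 'I_n.+1 -> V) : 'S_n.+1 := sval (cid (exists_sorting v)).

Lemma sortingP n (v : 'I_n.+1 -> V) : increasing (v \o sorting v).
Proof. exact: svalP (cid (exists_sorting v)). Qed.

(** Averaging over permutations would require division in [int]; a total order on the vertices
    selects one ordering of each simplex instead. *)
Definition alternate n (b : cochain K int n) : cochain K int n := fun v =>
  if `[< injective v >] then
    b (reindex_simplex (sorting v) v) *~ ((-1) ^+ sorting v)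
  else 0.

Lemma alternate_alternating n (b : cochain K int n) : alternating (alternate b).
Proof.
split=> [s v|v v_deg]; last by rewrite /alternate; case: asboolP.
rewrite /alternate; case: asboolP => [vs_inj|vs_deg]; last first.
  case: asboolP => [v_inj|]; last by rewrite mul0rz.
  by exfalso; apply: vs_deg => i j /v_inj; apply: perm_inj.
have v_inj : injective v.
  by move=> i j vij; apply: (perm_inj (s := s^-1%g)); apply: vs_inj; rewrite /= !permKV.
case: asboolP => // _.
have sE : (sorting (reindex_simplex s v) * s)%g = sorting v.
  apply: (@sorting_uniq _ v) => //; last exact: (@sortingP _ v).
  by move=> i j ij; rewrite /= !permM; have := @sortingP _ (reindex_simplex s v) i j ij.
rewrite -sE reindex_simplex_comp odd_permM.
have -> : reindex_simplex (s \o sorting (reindex_simplex s v)) v =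
          reindex_simplex (sorting (reindex_simplex s v) * s)%g v.
  by apply: ordered_simplex_eq; apply/funext => i /=; rewrite permM.
rewrite -mulrzA signr_addb -mulrA -expr2 sqrr_sign mulr1 //.
Qed.

Lemma alternateE n (b : cochain K int n) (v : ordered_simplex K n) :
  injective v -> increasing v -> alternate b v = b v.
Proof.
move=> v_inj v_inc; rewrite /alternate; case: asboolP => // _.
have -> : sorting v = 1%g.
  apply: (@sorting_uniq _ v) => //; first exact: (@sortingP _ v).
  by move=> i j ij; rewrite /= !perm1; exact: v_inc.
rewrite odd_perm1 expr0 mulr1z; congr b.
by apply: ordered_simplex_eq; apply/funext => i /=; rewrite perm1.
Qed.

(** Both sides alternate, so they can be compared on increasing injective simplices. The faces of
    these are increasing too, and there [alternate b] agrees with [b]. *)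
Lemma alternating_primitive_ordered n (z : cochain K int n.+1) (b : cochain K int n) :
  alternating z -> coboundary b = z ->
  exists2 b', alternating b' & coboundary b' = z.
Proof.
move=> z_alt bz; exists (alternate b); first exact: alternate_alternating.
have [db_sgn db_deg] := alternating_delta (alternate_alternating b).
have [z_sgn z_deg] := z_alt.
apply/funext => v; have [v_inj|v_deg] := pselect (injective v); last first.
  by rewrite db_deg// z_deg.
set w := reindex_simplex (sorting v) v.
have -> : v = reindex_simplex (sorting v)^-1%g w.
  apply: ordered_simplex_eq; apply/funext => i /=; by rewrite permKV.
rewrite db_sgn z_sgn; congr (_ *~ _).
have w_inj : injective w by move=> i j /v_inj; exact: perm_inj.
have w_inc : increasing w by exact: (@sortingP _ v).
rewrite -bz; apply: eq_bigr => i _; rewrite alternateE//.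
  by move=> j k /w_inj; exact: lift_inj.
move=> j k jk; apply: w_inc; rewrite /= /bump; lia.
Qed.

End AlternatingPrimitive.

Lemma well_order_total_order (T : eqType) (R : rel T) :
  well_order R -> total_order R.
Proof.
move=> Rwo.
have Rch : wo_chain R {: T} by move=> A _; exact: Rwo.
have Rrefl x : R x x by exact: (wo_chain_reflexive Rch).
have Ranti : antisymmetric R.
  by move=> x y; exact: (wo_chain_antisymmetric Rch).
split; last by move=> x y; exact: (wo_chainW Rch).
split=> //; split=> // y x z xy yz.
have [|m [[m_xyz m_min] _]] := Rwo (pred3 x y z).
  by exists x; rewrite inE eqxx.
have [mx my mz] : [/\ R m x, R m y & R m z].
  by split; apply: m_min; rewrite !inE eqxx ?orbT.
move: m_xyz; rewrite !inE => /or3P[] /eqP me; subst m => //.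
  - by rewrite (Ranti x y)// mx xy.
- by rewrite -(Ranti y z)// my yz.
Qed.

(** Cohomology of nerves is defined by alternating cochains, whereas germs only provide arbitrary
    primitives. *)
Lemma alternating_primitive (V : eqType) (K : simplicial_complex V) n
    (z : cochain K int n.+1) (b : cochain K int n) :
  alternating z -> coboundary b = z ->
  exists2 b', alternating b' & coboundary b' = z.
Proof.
have [R /well_order_total_order Rtot] := well_ordering_principle V.
exact: (alternating_primitive_ordered Rtot).
Qed.

(** * Germs of cochains *)

Definition inside T (B : set T) (s : seq T) := forall x, List.In x s -> B x.

Section Germs.
Variables (T : Type) (nbs : T -> set_system T).
Hypothesis nbs_filter : forall x, Filter (nbs x).
Hypothesis nbs_self : forall x B, nbs x B -> B x.
Implicit Types (O B : set T) (z b : seq T -> int).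

(** The number [m] is a length, one more than the degree. The lists range over [B], which may leave
    [O]: a cochain on [O] is given by a function on all lists, whose values far from [O] are
    junk. *)
Definition locally_zero O m z := forall x, O x ->
  exists2 B, nbs x B & forall s, size s = m -> inside B s -> z s = 0.

Definition locally_coboundary O m z :=
  exists b, locally_zero O m (fun s => z s - delta b s).

Lemma sub_inside B B' s : B `<=` B' -> inside B s -> inside B' s.
Proof. by move=> BB' sB x /sB/BB'. Qed.

Lemma inside_nseq B n x : B x -> inside B (nseq n x).
Proof. by move=> Bx y; elim: n => //= n IHn [<-|/IHn]. Qed.

Lemma inside_set1 (p : T) s : inside [set p] s -> s = nseq (size s) p.
Proof.
elim: s => //= x s IHs sp; rewrite -IHs => [|y ys]; last by apply: sp; right.
by rewrite (sp x)//=; left.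
Qed.

Lemma inside_map (A : Type) (f : A -> T) B (s : seq A) :
  (forall x, List.In x s -> B (f x)) -> inside B (map f s).
Proof.
elim: s => [_ y []|x s IHs sB y /= [<-|]]; first by apply: sB; left.
by apply: IHs => // w ws; apply: sB; right.
Qed.

Lemma locally_zero_sub O O' m z :
  O `<=` O' -> locally_zero O' m z -> locally_zero O m z.
Proof. by move=> OO' z0 x /OO'; exact: z0. Qed.

Lemma locally_zero_ext O m z z' :
  z =1 z' -> locally_zero O m z -> locally_zero O m z'.
Proof.
by move=> zz' z0 x /z0[B xB zB]; exists B => // s sm sB; rewrite -zz' zB.
Qed.

Lemma locally_zeroD O m z z' : locally_zero O m z -> locally_zero O m z' ->
  locally_zero O m (fun s => z s + z' s).
Proof.
move=> z0 z'0 x Ox; have [B xB zB] := z0 _ Ox; have [B' xB' zB'] := z'0 _ Ox.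
exists (B `&` B'); first exact: filterI.
by move=> s sm sB; rewrite zB ?zB' ?addr0//; apply: sub_inside sB => y [].
Qed.

Lemma locally_zeroN O m z : locally_zero O m z ->
  locally_zero O m (fun s => - z s).
Proof. by move=> z0 x /z0[B xB zB]; exists B => // s sm sB; rewrite zB ?oppr0. Qed.

Lemma locally_zeroB O m z z' : locally_zero O m z -> locally_zero O m z' ->
  locally_zero O m (fun s => z s - z' s).
Proof. by move=> z0 /locally_zeroN z'0; exact: locally_zeroD. Qed.

Lemma locally_zero_delta O m z :
  locally_zero O m z -> locally_zero O m.+1 (delta z).
Proof.
move=> z0 x /z0[B xB zB]; exists B => // s sm sB.
rewrite -[RHS](delta_zero s).
by apply: (eq_delta_on (A := B) (m := m)) => // t tm tB; exact: zB.
Qed.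

Lemma locally_coboundaryB O m z z' :
  locally_coboundary O m z -> locally_coboundary O m z' ->
  locally_coboundary O m (fun s => z s - z' s).
Proof.
move=> [b zb] [b' zb']; exists (fun s => b s - b' s).
apply: locally_zero_ext (locally_zeroB zb zb') => s; rewrite deltaB; ring.
Qed.

Lemma locally_coboundaryD O m z z' :
  locally_coboundary O m z -> locally_coboundary O m z' ->
  locally_coboundary O m (fun s => z s + z' s).
Proof.
move=> [b zb] [b' zb']; exists (fun s => b s + b' s).
apply: locally_zero_ext (locally_zeroD zb zb') => s; rewrite deltaD; ring.
Qed.

Lemma locally_coboundary0 O m : locally_coboundary O m (fun=> 0).
Proof.
exists (fun=> 0) => x _; exists setT; first exact: filterT.
by move=> s _ _; rewrite delta_zero subr0.
Qed.

Lemma locally_coboundary_zero O m z :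
  locally_zero O m z -> locally_coboundary O m z.
Proof.
move=> z0; exists (fun=> 0); apply: locally_zero_ext z0 => s.
by rewrite delta_zero subr0.
Qed.

Lemma locally_coboundary_ext O m z z' :
  z =1 z' -> locally_coboundary O m z -> locally_coboundary O m z'.
Proof.
by move=> zz' [b zb]; exists b; apply: locally_zero_ext zb => s; rewrite zz'.
Qed.

(** Discrete contractions: for every notion [G] of smallness, [O] contracts to
    [p] through a locally finite sequence of maps with [G]-small steps. *)
Definition contractible O p := forall G : set (set T),
  (forall A B, A `<=` B -> G B -> G A) ->
  (forall x, O x -> exists2 B, nbs x B & G B) ->
  exists2 phi : nat -> T -> T, forall x, O x -> phi 0 x = x &
  forall x, O x -> exists2 B, nbs x B & B `<=` O /\
    (exists K, forall k y, (K <= k)%N -> B y -> phi k y = p) /\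
    forall k, G (phi k @` B `|` phi k.+1 @` B).

(** The consecutive points [phi k x] and [phi k.+1 x] lie in a set where [delta z] vanishes, so [z]
    does not change along the path to [p]. *)
Lemma contractible_constant O p z :
  contractible O p -> locally_zero O 2 (delta z) ->
  forall x, O x -> z [:: x] = z [:: p].
Proof.
move=> O_contr dz0 x Ox.
have [|x' Ox'|phi phi0 phiP] := O_contr [set B | forall s, size s = 2 ->
    inside B s -> delta z s = 0].
- by move=> A B AB GB s s2 sA; apply: GB => //; exact: sub_inside sA.
- by have [B xB zB] := dz0 _ Ox'; exists B.
have [B xB [_ [[K phiK] GB]]] := phiP x Ox.
have Bx := nbs_self xB.
rewrite -(phiK K x (leqnn _) Bx) -[in LHS](phi0 x Ox).
elim: K {phiK} => // k ->; apply/eqP.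
have /= := GB k [:: phi k x; phi k.+1 x] erefl.
rewrite subr0 => dz; rewrite eq_sym -subr_eq0; apply/eqP/dz => y /=.
by case=> [<-|[<-|//]]; [left|right]; exists x.
Qed.

Lemma contractible_acyclic O p m z :
  contractible O p -> O p -> (1 < m)%N -> locally_zero O m.+1 (delta z) ->
  locally_coboundary O m z.
Proof.
move=> O_contr Op m1 dz0.
(* [z'] vanishes on constant tuples, so that the prisms between the maps [phi k]
   and [phi k.+1] vanish where both are constant, and their sum is finite. *)
pose a := z (nseq m p); pose z' s := z s - delta (fun=> a) s.
have dz'0 : locally_zero O m.+1 (delta z').
  by apply: locally_zero_ext dz0 => s; rewrite deltaB delta_delta subr0.
(* For odd [m] the constant cochain [a] removes the value at the constant list; for even [m] that
   value is already zero, by the cocycle condition on a constant list of length m + 1. *)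
have z'p : z' (nseq m p) = 0.
  rewrite /z' delta_const size_nseq -/a; case: ifPn => [_|m_even]; first exact: subrr.
  have [B pB zB] := dz0 p Op.
  have := zB (nseq m.+1 p); rewrite size_nseq delta_nseq /= m_even subr0; apply=> //.
  by apply: (@inside_nseq _ m.+1); exact: nbs_self pB.
have [|x' Ox'|phi phi0 phiP] := O_contr [set B | forall s, size s = m.+1 ->
    inside B s -> delta z' s = 0].
- by move=> A B AB GB s s2 sA; apply: GB => //; exact: sub_inside sA.
- by have [B xB zB] := dz'0 _ Ox'; exists B.
pose stop x := if pselect (O x) is left Ox
  then xget 0%N [set K | forall k, (K <= k)%N -> phi k x = p] else 0%N.
have stopP x k : O x -> (stop x <= k)%N -> phi k x = p.
  move=> Ox; rewrite /stop; case: pselect => // Ox'.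
  have [B xB [_ [[K phiK] _]]] := phiP x Ox.
  case: xgetP => [K' _ /=|/(_ K)[]]; first exact.
  by move=> k' Kk'; exact: phiK (nbs_self xB).
pose b s := \sum_(k < \max_(x <- s) stop x) prism (phi k) (phi k.+1) z' s.
have prism0 k s : size s = m.-1 -> (forall x, List.In x s -> phi k x = p) ->
    (forall x, List.In x s -> phi k.+1 x = p) ->
    prism (phi k) (phi k.+1) z' s = 0.
  move=> sm phip phip'; apply: prism_eq0 => t; rewrite sm prednK ?(ltnW m1)// => tm tp.
  rewrite -z'p -tm [in LHS](@inside_set1 p t)// => y /tp[w ws [->|->]].
    exact: phip.
  exact: phip'.
(* The range of the sum [b s] depends on [s]. Any [K] valid for all vertices of [s] gives the same
   sum, so near a point one [K] serves and [delta] can be taken termwise. *)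
have bE s K : size s = m.-1 -> (forall x, List.In x s -> O x) ->
    (forall x k, List.In x s -> (K <= k)%N -> phi k x = p) ->
    b s = \sum_(k < K) prism (phi k) (phi k.+1) z' s.
  move=> sm sO sK.
  have cut L L' : (L <= L')%N ->
      (forall x k, List.In x s -> (L <= k)%N -> phi k x = p) ->
      \sum_(k < L) prism (phi k) (phi k.+1) z' s =
      \sum_(k < L') prism (phi k) (phi k.+1) z' s.
    move=> LL' sL; rewrite -!(big_mkord predT (fun k => prism (phi k) (phi k.+1) z' s)).
    rewrite [RHS](big_cat_nat (leq0n _) LL')/= [X in _ = _ + X]big1_seq ?addr0// => k.
    rewrite mem_index_iota => /andP[_ /andP[Lk _]].
    by apply: prism0 => // x xs; apply: sL => //; exact: leqW.
  rewrite /b (cut _ (maxn K (\max_(x <- s) stop x))) ?leq_maxr//; last first.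
    move=> x k xs sk; apply: stopP; first exact: sO.
    apply: leq_trans sk; elim: s xs {sm sO sK cut} => //= y s IHs.
    by rewrite big_cons => -[->|/IHs]; [exact: leq_maxl|rewrite leq_max => ->; rewrite orbT].
  by rewrite -(cut K)// leq_maxl.
(* The prisms telescope from [s] to a constant list, where [z'] vanishes; this gives
   [delta b = - z'] locally, hence the sign. *)
exists (fun s => a - b s) => x Ox.
have [B xB [BO [[K phiK] GB]]] := phiP x Ox.
exists B => // s sm sB.
have -> : delta (fun t => a - b t) s = delta (fun=> a) s -
    delta (fun t => \sum_(k < K) prism (phi k) (phi k.+1) z' t) s.
  rewrite -deltaB; apply: (eq_delta_on (A := B) (m := m.-1)) => //; last first.
    by rewrite sm prednK// ltnW.
  move=> t tm tB; rewrite (bE _ K)//; first by move=> y /tB/BO.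
  by move=> y k /tB By Kk; exact: phiK.
rewrite (delta_sum (fun k => prism (phi k) (phi k.+1) z')).
rewrite (eq_bigr (fun k : 'I_K => z' (map (phi k.+1) s) - z' (map (phi k) s))).
  rewrite -(big_mkord predT (fun k => z' (map (phi k.+1) s) - z' (map (phi k) s))).
  rewrite (telescope_sumr (fun k => z' (map (phi k) s)) (leq0n K)).
  have -> : map (phi 0) s = s.
    elim: s sB {sm} => //= y s IHs sB; rewrite phi0 ?IHs//.
      by move=> w ws; apply: sB; right.
    by apply: BO; apply: sB; left.
  suff -> : z' (map (phi K) s) = 0 by rewrite sub0r /z'; ring.
  rewrite -z'p [map _ s](@inside_set1 p) ?size_map ?sm//.
  by apply: inside_map => y /sB; exact: phiK.
move=> k _; rewrite -prism_delta [X in _ + X]prism_eq0 ?addr0// => t.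
rewrite sm => tm tP; apply: GB => // y /tP[w /sB Bw [->|->]].
  by left; exists w.
by right; exists w.
Qed.

(** The primitives on the pieces need no compatibility: [idx] is locally constant, so near the
    diagonal all vertices of a list select the same [b]. *)
Lemma locally_coboundary_partition (idx : T -> nat) O m z :
  (forall x, O x -> nbs x [set y | idx y = idx x]) ->
  (forall i, locally_coboundary [set x | O x /\ idx x = i] m.+2 z) ->
  locally_coboundary O m.+2 z.
Proof.
move=> idx_loc /choice[b zb].
exists (fun s => if s is x :: _ then b (idx x) s else 0) => x Ox.
have [B xB zB] := zb (idx x) x (conj Ox erefl).
exists (B `&` [set y | idx y = idx x]); first by apply: filterI => //; exact: idx_loc.
move=> s sm sB; rewrite -[RHS](zB s sm) => [|y /sB[]//]; congr (_ - _).
apply: (eq_delta_on (A := [set y | idx y = idx x]) (m := m.+1)) => //.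
  by move=> [//|y t] _ tB; rewrite (tB y)//; left.
by move=> y /sB[].
Qed.

(** [A'] must be well inside [A] since [a] and [b] are only close to each other
    near the points of [A `&` B]. *)
Lemma locally_zero_glue O A A' B m z a b :
  (forall x, O x -> [\/ nbs x A' /\ A x, A x /\ B x | B x /\ nbs x (~` A')]) ->
  locally_zero A m.+2 (fun s => z s - delta a s) ->
  locally_zero B m.+2 (fun s => z s - delta b s) ->
  locally_zero (A `&` B) m.+1 (fun s => a s - b s) ->
  locally_coboundary O m.+2 z.
Proof.
move=> OAB za zb ab; exists (fun s => if `[< inside A' s >] then a s else b s).
move=> x /OAB[[xA' Ax]|[Ax Bx]|[Bx xA']].
- have [C xC zC] := za x Ax.
  exists (C `&` A'); first exact: filterI.
  move=> s sm sC; rewrite -[RHS](zC s sm) => [|y /sC[]//]; congr (_ - _).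
  apply: (eq_delta_on (A := A') (m := m.+1)) => //; last by move=> y /sC[].
  by move=> t _ tA'; case: asboolP.
- have [C xC zC] := zb x Bx; have [C' xC' abC] := ab x (conj Ax Bx).
  exists (C `&` C'); first exact: filterI.
  move=> s sm sC; rewrite -[RHS](zC s sm) => [|y /sC[]//]; congr (_ - _).
  apply: (eq_delta_on (A := C') (m := m.+1)) => //; last by move=> y /sC[].
  move=> t tm tC'; case: asboolP => // _.
  by apply/eqP; rewrite -subr_eq0 abC.
- have [C xC zC] := zb x Bx.
  exists (C `&` ~` A'); first exact: filterI.
  move=> s sm sC; rewrite -[RHS](zC s sm) => [|y /sC[]//]; congr (_ - _).
  apply: (eq_delta_on (A := ~` A') (m := m.+1)) => //; last by move=> y /sC[].
  move=> [//|y t] _ tA'; case: asboolP => // yA'.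
  by case: (tA' y); [left|apply: yA'; left].
Qed.

(** The Mayer-Vietoris step: the primitive [e] of the difference corrects [a] by a cocycle, after
    which [a] and [b] agree on the overlap. *)
Lemma locally_coboundary_glue O A A' B m z a b :
  (forall x, O x -> [\/ nbs x A' /\ A x, A x /\ B x | B x /\ nbs x (~` A')]) ->
  locally_zero A m.+2 (fun s => z s - delta a s) ->
  locally_zero B m.+2 (fun s => z s - delta b s) ->
  locally_coboundary (A `&` B) m.+1 (fun s => a s - b s) ->
  locally_coboundary O m.+2 z.
Proof.
move=> OAB za zb [e ab].
apply: (locally_zero_glue (a := fun s => a s - delta e s) OAB _ zb).
  by apply: locally_zero_ext za => s; rewrite deltaB delta_delta subr0.
by apply: locally_zero_ext ab => s; ring.
Qed.

End Germs.

(** * Homotopies in a half-plane *)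

Section HalfPlane.
Variable R : realType.
Notation P := (R * R)%type.
Implicit Types (p q y : P) (t : R).

Definition dist p q : R := `|p.1 - q.1| + `|p.2 - q.2|.

Lemma dist_ge0 p q : 0 <= dist p q.
Proof. exact: addr_ge0. Qed.

Lemma distpp p : dist p p = 0.
Proof. by rewrite /dist !subrr normr0 addr0. Qed.

Lemma distC p q : dist p q = dist q p.
Proof. by rewrite /dist distrC [X in _ + X]distrC. Qed.

Lemma dist_triangle q p y : dist p y <= dist p q + dist q y.
Proof.
rewrite /dist; have := ler_distD q.1 p.1 y.1; have := ler_distD q.2 p.2 y.2; lra.
Qed.

Definition half_plane : set P := [set q | 1 <= q.2].

Definition half_plane_nbs q : set_system P :=
  [set B | exists2 e, 0 < e & forall y, half_plane y -> dist q y < e -> B y].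

(** * Cutting a Lipschitz homotopy into small steps *)

Section Contraction.
Variables (O : set P) (p : P) (h : P -> R -> P).
Hypotheses (Op : O p) (O_half : O `<=` half_plane)
  (O_open : forall q, O q -> half_plane_nbs q O)
  (h0 : forall q, O q -> h q 0 = q) (h2 : forall q, O q -> h q 2 = p)
  (hO : forall q t, O q -> 0 <= t <= 2 -> O (h q t))
  (h_lip : forall q y t, O q -> O y -> 0 <= t <= 2 -> dist (h q t) (h y t) <= dist q y)
  (h_time : forall q t t', O q -> 0 <= t <= 2 -> 0 <= t' <= 2 ->
     dist (h q t) (h q t') <= dist q p * `|t - t'|).

Section Steps.
Variable G : set (set P).
Hypotheses (G_sub : forall A B : set P, A `<=` B -> G B -> G A)
  (G_loc : forall q, O q -> exists2 B, half_plane_nbs q B & G B).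

(* [lambda q] is a Lebesgue number for [G] along the path [h q], and is Lipschitz
   in [q] because the maps [h ^~ t] do not increase distances; this makes a motion
   along [h] by steps proportional to [lambda] continuous. *)
Let good q r := G [set y | half_plane y /\ dist q y < r].

Let radii q := [set r | 0 < r <= 1 /\ forall t, 0 <= t <= 2 -> good (h q t) r].

Let lambda q := sup (radii q).

(** By [h_time], near each time one radius works on a whole interval; compactness of [0, 2] makes
    the radius uniform. *)
Lemma radii_neq0 q : O q -> radii q !=set0.
Proof.
move=> Oq.
have /compact_near_coveringP /(_ R (0^'+)
  (fun r t => 0 <= t <= 2 -> good (h q t) r)) near_r :=
  @segment_compact R 0 2.
have : \forall r \near 0^'+, `[0, 2] `<=` (fun t => 0 <= t <= 2 -> good (h q t) r).
  apply: near_r => t; rewrite /= in_itv /= => t02.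
  have [B [e e0 eB] GB] := G_loc (hO Oq t02).
  (* A time difference below [d] moves the point by at most e / 2; adding 1 avoids dividing by zero
     at q = p. *)
  pose d := e / (2 * (dist q p + 1)).
  have D0 := dist_ge0 q p.
  have d0 : 0 < d by rewrite divr_gt0// mulr_gt0//; lra.
  exists ([set t' | `|t - t'| < d], [set r | r < e / 2]) => /=.
    split; first by exists d.
    apply: nbhs_right_lt; exact: divr_gt0.
  move=> [t' r] /= [tt' re] t'02; apply: G_sub GB => y /= [Hy yr]; apply: eB => //.
  apply: (le_lt_trans (dist_triangle (h q t') _ _)).
  have := h_time Oq t02 t'02.
  have : dist q p * `|t - t'| <= (dist q p + 1) * d.
    by apply: ler_pM => //; [lra|exact: ltW].
  have -> : (dist q p + 1) * d = e / 2 by rewrite /d; field; lra.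
  lra.
move=> near_good; near ((0 : R)^'+) => r; exists r; split.
  by apply/andP; split; [near: r; exact: nbhs_right_gt|near: r; exact: nbhs_right_le].
have rP : `[0, 2] `<=` (fun t => 0 <= t <= 2 -> good (h q t) r) by near: r.
by move=> t t02; apply: rP => //=; rewrite in_itv.
Unshelve. all: by end_near. Qed.

Lemma lambda_le1 q : O q -> lambda q <= 1.
Proof. by move=> /radii_neq0 r0; apply: ge_sup => // r [/andP[]]. Qed.

Lemma has_sup_radii q : O q -> has_sup (radii q).
Proof.
by move=> /radii_neq0 r0; split=> //; exists 1 => r [/andP[]].
Qed.

Lemma lambda_gt0 q : O q -> 0 < lambda q.
Proof.
move=> Oq; have [r rq] := radii_neq0 Oq; have [/andP[r0 _] _] := rq.
by apply: lt_le_trans r0 _; apply: ub_le_sup => //; have [] := has_sup_radii Oq.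
Qed.

Lemma lambda_good q r t : O q -> r < lambda q -> 0 <= t <= 2 -> good (h q t) r.
Proof.
move=> Oq r_lt t02; have [r' [_ /(_ t t02) Gr'] rr'] := sup_gt (radii_neq0 Oq) r_lt.
by apply: G_sub Gr' => y /= [Hy yr]; split=> //; exact: lt_trans rr'.
Qed.

(** The ball of radius [r - dist q y] around [h y t] lies in the ball of radius [r] around [h q t],
    because [h ^~ t] does not increase distances. *)
Lemma lambda_lip q y : O q -> O y -> `|lambda q - lambda y| <= dist q y.
Proof.
have half q' y' : O q' -> O y' -> lambda q' - dist q' y' <= lambda y'.
  move=> Oq Oy; rewrite lerBlDr; apply: ge_sup; first exact: radii_neq0.
  move=> r rq; have [/andP[r0 r1] rG] := rq.
  rewrite -lerBlDr; have [|rd] := leP (r - dist q' y') 0.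
    by move/le_trans; apply; exact/ltW/lambda_gt0.
  apply: ub_le_sup; first by have [] := has_sup_radii Oy.
  split; first by have := dist_ge0 q' y'; lra.
  move=> t t02; apply: G_sub (rG t t02) => w /= [Hw wr]; split=> //.
  apply: (le_lt_trans (dist_triangle (h y' t) _ _)).
  by have := h_lip Oq Oy t02; lra.
move=> Oq Oy; have := half _ _ Oq Oy; have := half _ _ Oy Oq.
by rewrite (distC y q) ler_norml; lra.
Qed.

(** The speed of the path of [q] is at most [dist q p], so one step moves by at most [lambda q / 4];
    the 1 keeps the denominator positive. *)
Let step q := lambda q / (4 * (dist q p + 1)).

Let phi k q := h q (Num.min 2 (k%:R * step q)).

Lemma step_gt0 q : O q -> 0 < step q.
Proof.
by move=> Oq; rewrite divr_gt0 ?lambda_gt0 ?mulr_gt0//; have := dist_ge0 q p; lra.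
Qed.

(** The constant 1/2 is what matters: within distance [step q] of [q], steps are at least half as
    long as at [q], so one number of steps serves a whole neighbourhood. *)
Lemma step_lip q y : O q -> O y -> `|step q - step y| <= dist q y / 2.
Proof.
move=> Oq Oy; rewrite /step.
set a := dist q p + 1; set b := dist y p + 1.
have a1 : 1 <= a by rewrite /a; have := dist_ge0 q p; lra.
have b1 : 1 <= b by rewrite /b; have := dist_ge0 y p; lra.
have ab : `|b - a| <= dist q y.
  rewrite ler_norml /a /b; have := dist_triangle q y p; rewrite (distC y q).
  by have := dist_triangle y q p; lra.
have -> : lambda q / (4 * a) - lambda y / (4 * b) =
    (lambda q - lambda y) / (4 * a) + lambda y * (b - a) / (4 * a * b).
  by field; lra.
apply: (le_trans (ler_normD _ _)).
have l1 := lambda_le1 Oy; have l0 := lambda_gt0 Oy.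
have a40 : 0 < 4 * a by lra.
have ab0 : 0 < 4 * a * b by rewrite mulr_gt0//; lra.
rewrite (normrM _ (4 * a)^-1) (normrM _ (4 * a * b)^-1) (normrM (lambda y)).
rewrite !normfV (gtr0_norm a40) (gtr0_norm ab0) (gtr0_norm l0).
have -> : dist q y / 2 = dist q y / 4 + dist q y / 4 by field.
have D0 := dist_ge0 q y.
apply: lerD.
  apply: ler_pM => //; first by rewrite invr_ge0 ltW.
    exact: lambda_lip.
  by rewrite lef_pV2 ?posrE//; lra.
apply: ler_pM => //; first by rewrite mulr_ge0// ltW.
- by rewrite invr_ge0 ltW.
- by rewrite -[leRHS]mul1r; apply: ler_pM => //; exact: ltW.
- rewrite lef_pV2 ?posrE//.
  by rewrite -[leLHS]mulr1; apply: ler_pM => //; lra.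
Qed.

Let time_ge0 k q : O q -> 0 <= Num.min 2 (k%:R * step q) <= 2.
Proof.
move=> Oq; rewrite ge_min lexx le_min/= ler0n mulr_ge0//.
exact/ltW/step_gt0.
Qed.

Lemma contraction_steps : exists2 phi : nat -> P -> P, forall x, O x -> phi 0 x = x &
  forall x, O x -> exists2 B, half_plane_nbs x B & B `<=` O /\
    (exists K, forall k y, (K <= k)%N -> B y -> phi k y = p) /\
    forall k, G (phi k @` B `|` phi k.+1 @` B).
Proof.
exists phi => [q Oq|q Oq].
  by rewrite /phi mul0r min_r// h0.
have s0 := step_gt0 Oq; have l0 := lambda_gt0 Oq; have D0 := dist_ge0 q p.
have [e0 e00 e0O] := O_open Oq.
(* The bound is 4 although time stops at 2, because the steps at nearby points may be half as long
   as at [q]. *)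
pose K := Num.bound (4 / step q).
have KP : 4 < K%:R * step q.
  by rewrite -ltr_pdivrMr// archi_boundP// divr_ge0// ltW.
(* The three bounds keep [y] in [O], keep its steps comparable to those at [q], and keep it within
   [lambda q / 4] of the path of [q] for [K] steps. *)
pose e := Num.min e0 (Num.min (step q) (lambda q / (4 * (2 + dist q p * K%:R)))).
have K0 : 0 <= dist q p * K%:R by rewrite mulr_ge0.
exists [set y | half_plane y /\ dist q y < e].
  exists e => //; rewrite /e !lt_min e00 s0 divr_gt0// mulr_gt0//; lra.
have eP y : half_plane y -> dist q y < e -> [/\ O y, dist q y < step q &
    dist q y * (2 + dist q p * K%:R) < lambda q / 4].
  rewrite /e !lt_min => Hy /and3P[qy0 qys qyl]; split=> //; first exact: e0O.
  move: qyl; rewrite invfM mulrA ltr_pdivlMr//; lra.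
have phi_end k y : half_plane y -> dist q y < e -> (K <= k)%N -> phi k y = p.
  move=> Hy /(eP _ Hy)[Oy qys _] Kk; rewrite /phi min_l ?h2//.
  have := step_lip Oq Oy; rewrite ler_norml => /andP[_ s_le].
  have : K%:R * step y <= k%:R * step y.
    by rewrite ler_wpM2r ?ler_nat// ltW// step_gt0.
  have : K%:R * (step q / 2) <= K%:R * step y by apply: ler_wpM2l => //; lra.
  lra.
split; first by move=> y [Hy /(eP _ Hy)[]].
split; first by exists K => k y Kk [Hy]; move/phi_end; exact.
have phi_lip k y : (k <= K)%N -> half_plane y -> dist q y < e ->
    dist (phi k q) (phi k y) < lambda q / 4.
  move=> kK Hy /(eP _ Hy)[Oy qys qyl].
  apply: (le_lt_trans (dist_triangle (h q (Num.min 2 (k%:R * step y))) _ _)).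
  have t1 := time_ge0 k Oq; have t2 := time_ge0 k Oy.
  have := h_time Oq t1 t2; have := h_lip Oq Oy t2.
  have : `|Num.min 2 (k%:R * step q) - Num.min 2 (k%:R * step y)| <= K%:R * (dist q y / 2).
    apply: (@le_trans _ _ `|k%:R * step q - k%:R * step y|).
      set a := k%:R * step q; set b := k%:R * step y.
      have [a2|a2] := leP 2 a; have [b2|b2] := leP 2 b; rewrite ?subrr ?normr0//.
      - by rewrite !ger0_norm; lra.
      - by rewrite !ler0_norm; lra.
    rewrite -mulrBr normrM normr_nat; apply: ler_pM => //; first by rewrite ler_nat.
    exact: step_lip.
  move=> /(ler_wpM2l D0).
  have D1 := dist_ge0 q y.
  have := mulr_ge0 K0 D1.
  rewrite /phi; lra.
have phi_step k : dist (phi k q) (phi k.+1 q) <= lambda q / 4.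
  apply: le_trans (h_time Oq (time_ge0 k Oq) (time_ge0 k.+1 Oq)) _.
  have : `|Num.min 2 (k%:R * step q) - Num.min 2 (k.+1%:R * step q)| <= step q.
    rewrite -[k.+1%:R]natr1 mulrDl mul1r; set a := k%:R * step q.
    have [a2|a2] := leP 2 a; have [b2|b2] := leP 2 (a + step q);
      rewrite ?subrr ?normr0; try lra.
    - by rewrite ler0_norm; lra.
    - by rewrite ler0_norm; lra.
  move=> /(ler_wpM2l D0) /le_trans; apply.
  by rewrite /step mulrA ler_pdivrMr ?mulr_gt0//; lra.
(* From [K] on both images are contained in {p}. Before, they lie in the ball of radius
   [lambda q * (3 / 4)] around [phi k q]: a step takes 1/4 and the spread another 1/4. *)
move=> k; have [kK|Kk] := ltnP k K; last first.
  have [B pB GB] := G_loc Op; apply: G_sub GB => y.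
  have Bp : B p by have [r r0 rB] := pB; apply: rB; [exact: O_half|rewrite distpp].
  by case=> -[w [Hw wq] <-]; rewrite phi_end// leqW.
have r_lt : lambda q * (3 / 4) < lambda q by lra.
apply: G_sub (lambda_good Oq r_lt (time_ge0 k Oq)) => y.
have Hh k' w : O w -> half_plane (phi k' w).
  by move=> Ow; apply: O_half; apply: hO => //; exact: time_ge0.
case=> -[w [Hw wq] <-]; have [Ow _ _] := eP w Hw wq; split; do ?exact: Hh.
  by have := phi_lip k w (ltnW kK) Hw wq; rewrite /phi; lra.
apply: le_lt_trans (dist_triangle (phi k.+1 q) _ _) _.
by have := phi_lip k.+1 w kK Hw wq; have := phi_step k; rewrite /phi; lra.
Qed.

End Steps.

Lemma homotopy_contractible (nbs : P -> set_system P) :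
  (forall q, O q -> nbs q = half_plane_nbs q) -> contractible nbs O p.
Proof.
move=> nbsE G G_sub G_loc.
have [q Oq|phi phi0 phiP] := contraction_steps G_sub.
  by have [B] := G_loc q Oq; rewrite nbsE// => qB GB; exists B.
exists phi => // q Oq; have [B qB BP] := phiP q Oq.
by exists B => //; rewrite nbsE.
Qed.

End Contraction.
End HalfPlane.

(** * Neighbourhoods and convex sets in the half-plane *)

Section HalfPlaneTopology.
Variable R : realType.
Notation P := (R * R)%type.
Implicit Types (p q y : P).

Lemma half_plane_nbs_self q B : half_plane q -> half_plane_nbs q B -> B q.
Proof. by move=> Hq [e e0]; apply=> //; rewrite distpp. Qed.

Lemma half_plane_nbs_half q : half_plane_nbs q (@half_plane R).
Proof. by exists 1. Qed.

Lemma half_plane_nbsS q B B' :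
  B `<=` B' -> half_plane_nbs q B -> half_plane_nbs q B'.
Proof. by move=> BB' [e e0 eB]; exists e => // y Hy /(eB _ Hy)/BB'. Qed.

Lemma half_plane_nbsI q B B' :
  half_plane_nbs q B -> half_plane_nbs q B' -> half_plane_nbs q (B `&` B').
Proof.
move=> [e e0 eB] [e' e'0 eB']; exists (Num.min e e').
  by rewrite lt_min e0 e'0.
by move=> y Hy; rewrite lt_min => /andP[/(eB _ Hy) ? /(eB' _ Hy)].
Qed.

Lemma half_plane_nbs_filter q : Filter (half_plane_nbs q).
Proof.
split; first by exists 1.
  exact: half_plane_nbsI.
by move=> B B'; exact: half_plane_nbsS.
Qed.

Lemma half_plane_nbs1 q e : 0 < e ->
  half_plane_nbs q [set y | `|q.1 - y.1| < e].
Proof.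
move=> e0; exists e => // y _; apply: le_lt_trans.
by rewrite /dist lerDl.
Qed.

Lemma half_plane_nbs2 q e : 0 < e ->
  half_plane_nbs q [set y | `|q.2 - y.2| < e].
Proof.
move=> e0; exists e => // y _; apply: le_lt_trans.
by rewrite /dist lerDr.
Qed.

Lemma half_plane_nbs1_lt q a : q.1 < a -> half_plane_nbs q [set y | y.1 < a].
Proof.
rewrite -subr_gt0 => /(half_plane_nbs1 q); apply: half_plane_nbsS => y /=.
by rewrite ltr_norml; lra.
Qed.

Lemma half_plane_nbs1_gt q a : a < q.1 -> half_plane_nbs q [set y | a < y.1].
Proof.
rewrite -subr_gt0 => /(half_plane_nbs1 q); apply: half_plane_nbsS => y /=.
by rewrite ltr_norml; lra.
Qed.

Lemma half_plane_nbs2_lt q a : q.2 < a -> half_plane_nbs q [set y | y.2 < a].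
Proof.
rewrite -subr_gt0 => /(half_plane_nbs2 q); apply: half_plane_nbsS => y /=.
by rewrite ltr_norml; lra.
Qed.

Lemma half_plane_nbs2_gt q a : a < q.2 -> half_plane_nbs q [set y | a < y.2].
Proof.
rewrite -subr_gt0 => /(half_plane_nbs2 q); apply: half_plane_nbsS => y /=.
by rewrite ltr_norml; lra.
Qed.

Definition clamp (t : R) : R := Num.max 0 (Num.min t 1).

Lemma clampP t : 0 <= clamp t <= 1.
Proof. by rewrite /clamp le_max lexx ge_max ler01 ge_min lexx orbT. Qed.

Lemma clamp_le0 t : t <= 0 -> clamp t = 0.
Proof. by move=> t0; rewrite /clamp min_l ?max_l//; lra. Qed.

Lemma clamp_ge1 t : 1 <= t -> clamp t = 1.
Proof. by move=> t1; rewrite /clamp min_r// max_r//; lra. Qed.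

Lemma clamp_lip t t' : `|clamp t - clamp t'| <= `|t - t'|.
Proof.
wlog tt' : t t' / t <= t'.
  move=> th; have [/th//|/ltW/th] := leP t t'.
  by rewrite distrC [leRHS]distrC.
rewrite ler_norml (ler0_norm (_ : t - t' <= 0)); last by lra.
rewrite /clamp.
have [a|a] := leP t 1; have [b|b] := leP t' 1.
- by have [c|c] := leP 0 t; have [d|d] := leP 0 t'; lra.
- by have [c|c] := leP 0 t; have [d|d] := leP 0 1; lra.
- lra.
- lra.
Qed.

Lemma affine_dist (u v a b s t s' t' : R) :
  dist (u + s * (a - u), v + t * (b - v)) (u + s' * (a - u), v + t' * (b - v)) =
  `|s - s'| * `|u - a| + `|t - t'| * `|v - b|.
Proof.
rewrite /dist /= -!normrM; congr (_ + _).
  by rewrite -normrN; congr `|_|; ring.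
by rewrite -normrN; congr `|_|; ring.
Qed.

Lemma affine_lip (x y a s : R) : 0 <= s <= 1 ->
  `|(x + s * (a - x)) - (y + s * (a - y))| <= `|x - y|.
Proof.
move=> s01; have -> : (x + s * (a - x)) - (y + s * (a - y)) = (1 - s) * (x - y) by ring.
by rewrite normrM ger0_norm; [rewrite ler_piMl//; lra|lra].
Qed.

Lemma convex_contractible (nbs : P -> set_system P) (O : set P) p : O p ->
  O `<=` @half_plane R -> (forall q, O q -> nbs q = half_plane_nbs q) ->
  (forall q, O q -> half_plane_nbs q O) ->
  (forall q t, O q -> 0 <= t <= 1 ->
     O (q.1 + t * (p.1 - q.1), q.2 + t * (p.2 - q.2))) ->
  contractible nbs O p.
Proof.
move=> Op OH nbsE Oo Oconv.
apply: (@homotopy_contractible _ O p (fun q t =>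
  (q.1 + clamp t * (p.1 - q.1), q.2 + clamp t * (p.2 - q.2)))) => //.
- by case=> u v _; rewrite clamp_le0// !mul0r !addr0.
- by case=> u v _; rewrite clamp_ge1; [rewrite !mul1r !subrKC; case: p {Op Oconv}|lra].
- by move=> q t Oq _; apply: Oconv => //; exact: clampP.
- by move=> q y t _ _ _; rewrite /dist /= lerD// affine_lip// clampP.
- move=> q t t' _ _ _; rewrite affine_dist -mulrDr mulrC.
  by rewrite ler_wpM2l ?dist_ge0// clamp_lip.
Qed.

End HalfPlaneTopology.

(** * A half-plane with bumps and a point at infinity *)

Section Model.
Variable R : realType.
Notation P := (R * R)%type.
Notation H := (@half_plane R).
Notation o := ((0, 0) : P).
Variables (F : P -> R) (gamma : nat -> R).

(** These properties are all that the computation uses of the bumps. [gamma n] is the position of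
    the [n]-th top on the axis; [gamma 0] lies below the half-plane and bounds the first gap. All
    tops have height 1, so they never belong to a neighbourhood of infinity. *)
Record bump_profile : Prop := BumpProfile {
  F_cont : forall q e, H q -> 0 < e -> half_plane_nbs q [set y | `|F y - F q| < e];
  F_mono : forall u u' v, 1 <= v -> `|u| <= `|u'| -> F (u', v) <= F (u, v);
  F_far : forall u v, 1 <= v -> 1 <= `|u| -> F (u, v) <= 0;
  F_nat : forall n, (0 < n)%N -> F (0, n%:R) <= 0;
  gammaP : forall n, n%:R <= gamma n < n.+1%:R;
  F_gamma : forall n, (0 < n)%N -> F (0, gamma n) = 1;
  F_incr : forall n v v', (0 < n)%N ->
    n%:R <= v -> v <= v' -> v' <= gamma n -> F (0, v) <= F (0, v');
  F_decr : forall n v v', (0 < n)%N ->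
    gamma n <= v -> v <= v' -> v' <= n.+1%:R -> F (0, v') <= F (0, v)
}.
Hypothesis FP : bump_profile.

Lemma gamma0 : gamma 0 < 1.
Proof. by have /andP[] := gammaP FP 0. Qed.

Lemma F_nbs_lt q a : H q -> F q < a -> half_plane_nbs q [set y | F y < a].
Proof.
move=> Hq; rewrite -subr_gt0 => /(F_cont FP Hq); apply: half_plane_nbsS => y /=.
by rewrite ltr_norml; lra.
Qed.

Lemma F_nbs_gt q a : H q -> a < F q -> half_plane_nbs q [set y | a < F y].
Proof.
move=> Hq; rewrite -subr_gt0 => /(F_cont FP Hq); apply: half_plane_nbsS => y /=.
by rewrite ltr_norml; lra.
Qed.

Lemma axis_nbs q B : H q -> half_plane_nbs (0, q.2) B ->
  half_plane_nbs q [set y | B (0, y.2)].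
Proof.
move=> Hq [e e0 eB]; exists e => // y Hy yq; apply: eB => //.
apply: le_lt_trans yq; rewrite /dist/= subrr normr0 add0r.
by rewrite lerDr.
Qed.

Lemma F_le_axis q : H q -> F q <= F (0, q.2).
Proof. by case: q => u v Hq; apply: (F_mono FP) => //; rewrite normr0. Qed.

(** [gap_index v] is the index of the gap between consecutive bump centres which
    contains [v]. *)
Definition gap_index (v : R) : nat :=
  if v < gamma (Num.truncn v) then Num.truncn v else (Num.truncn v).+1.

Lemma gamma_homo m n : (m <= n)%N -> gamma m <= gamma n.
Proof.
move=> mn; have /andP[m1 m2] := gammaP FP m; have /andP[n1 n2] := gammaP FP n.
move: mn; rewrite leq_eqVlt => /predU1P[->//|mn].
by apply: (le_trans (ltW m2)); apply: le_trans n1; rewrite ler_nat.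
Qed.

Lemma gap_index_bounds v : 1 <= v ->
  [/\ (0 < gap_index v)%N, gamma (gap_index v).-1 <= v & v < gamma (gap_index v)].
Proof.
move=> v1; have v0 : 0 <= v by lra.
have /andP[n1 n2] := truncn_itv v0.
have n0 : (0 < Num.truncn v)%N.
  by rewrite lt0n; apply: contraTneq n2 => ->; rewrite -leNgt.
rewrite /gap_index; have [vn|nv] := ltP v (gamma (Num.truncn v)); split=> //.
  apply: (le_trans _ n1); have /andP[_ /ltW] := gammaP FP (Num.truncn v).-1.
  by rewrite prednK.
by apply: (lt_le_trans n2); have /andP[] := gammaP FP (Num.truncn v).+1.
Qed.

Lemma gap_index_eq v n : 1 <= v -> gamma n.-1 <= v -> v < gamma n -> gap_index v = n.
Proof.
move=> v1 nv vn; have [i0 iv vi] := gap_index_bounds v1.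
apply/eqP; rewrite eqn_leq; apply/andP; split; rewrite leqNgt; apply/negP => ni.
  have : gamma n <= gamma (gap_index v).-1 by apply: gamma_homo; lia.
  by lra.
have : gamma (gap_index v) <= gamma n.-1 by apply: gamma_homo; lia.
by lra.
Qed.

Lemma gap_index_nat n : (0 < n)%N -> gap_index n%:R = n.
Proof.
case: n => // n _; have /andP[_ n1] := gammaP FP n; have /andP[n2 n3] := gammaP FP n.+1.
apply: gap_index_eq; rewrite ?ler1n//=; first exact: ltW.
rewrite lt_neqAle n2 andbT; apply/eqP => e.
have := F_gamma FP (ltn0Sn n); have := F_nat FP (ltn0Sn n); rewrite -e; lra.
Qed.

(** The index only jumps at the tops, where the height is 1; [gamma 0] is excluded because it lies
    below the half-plane. *)
Lemma gap_index_loc q : H q -> F (0, q.2) < 1 ->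
  half_plane_nbs q [set y | gap_index y.2 = gap_index q.2].
Proof.
move=> Hq Fq; have [i0 iq qi] := gap_index_bounds Hq.
have iq' : gamma (gap_index q.2).-1 < q.2.
  rewrite lt_neqAle iq andbT; apply/eqP => e; move: Fq; rewrite -e.
  case: (gap_index q.2).-1 e => [|n] e; last by rewrite (F_gamma FP)// ltxx.
  by have := gamma0; rewrite e => ?; move: Hq; rewrite /half_plane/=; lra.
have := half_plane_nbsI (half_plane_nbs2_gt iq') (half_plane_nbs2_lt qi).
move=> /half_plane_nbsI /(_ (half_plane_nbs_half q)).
by apply: half_plane_nbsS => y [[/ltW y1 y2] Hy]; exact: gap_index_eq.
Qed.

(** Along the axis, in the gap of index [n], the height falls from [gamma n.-1] to [n] and rises
    from [n] to [gamma n], so a sublevel set meets each gap in an interval. *)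
Lemma gap_index_convex v v' w a : 1 <= v -> v <= w -> w <= v' -> gap_index v = gap_index v' ->
  F (0, v) < a -> F (0, v') < a -> gap_index w = gap_index v /\ F (0, w) < a.
Proof.
move=> v1 vw wv' ivv' Fv Fv'.
have [i0 iv vi] := gap_index_bounds v1.
have [_ iv' vi'] := gap_index_bounds (le_trans v1 (le_trans vw wv')).
have iw : gap_index w = gap_index v.
  by apply: gap_index_eq; [lra|lra|rewrite ivv'; lra].
split=> //; have [wn|nw] := leP w (gap_index v)%:R; last first.
  apply: (le_lt_trans _ Fv'); apply: (F_incr FP i0) => //; first exact: ltW.
  by rewrite ivv'; exact: ltW.
(* In the first gap there is no falling part: the half-plane starts at 1. *)
have [i1|i1] := eqVneq (gap_index v) 1%N.
  by have -> : w = v by move: wn; rewrite i1; lra.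
apply: (le_lt_trans _ Fv); apply: (@F_decr FP (gap_index v).-1) => //; first by lia.
by rewrite prednK.
Qed.

Definition level (k : nat) : R := k.+1%:R^-1.

Lemma level_gt0 k : 0 < level k. Proof. by rewrite invr_gt0. Qed.

Lemma level_le1 k : level k <= 1.
Proof. by rewrite /level invf_le1// ler1n. Qed.

Lemma level_lt k l : (k < l)%N -> level l < level k.
Proof. by move=> kl; rewrite /level ltf_pV2 ?posrE// ltr_nat. Qed.

Definition end_punctured (k : nat) : set P :=
  [set y | [/\ H y, k%:R < y.2 \/ k%:R < `|y.1| & F y < level k]].

Definition end_nbhd (k : nat) : set P := o |` end_punctured k.

(** The point [o], which is outside of the half-plane, stands for the point at
    infinity. *)
Definition model_space : set P := o |` H.

(** The neighbourhoods of the points outside of [model_space] are junk. *)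
Definition model_nbs (q : P) : set_system P :=
  [set B | if `[< H q >] then half_plane_nbs q B
           else B q /\ exists k, end_nbhd k `<=` B].

Lemma oNH : ~ H o.
Proof. by rewrite /half_plane /=; lra. Qed.

Lemma model_nbsH q : H q -> model_nbs q = half_plane_nbs q.
Proof. by move=> Hq; apply/seteqP; split=> B; rewrite /model_nbs /=; case: asboolP. Qed.

Lemma model_nbso B : model_nbs o B <-> exists k, end_nbhd k `<=` B.
Proof.
rewrite /model_nbs /=; case: asboolP => [/oNH//|_]; split=> [[]//|[k kB]].
by split; [apply: kB; left|exists k].
Qed.

Lemma end_punctured_homo k l : (k <= l)%N -> end_punctured l `<=` end_punctured k.
Proof.
move=> kl y [Hy y_far Fy]; have kl' : k%:R <= l%:R :> R by rewrite ler_nat.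
split=> //; first by case: y_far => ?; [left|right]; lra.
by move: kl; rewrite leq_eqVlt => /predU1P[->//|/level_lt]; exact: lt_trans.
Qed.

Lemma end_nbhd_homo k l : (k <= l)%N -> end_nbhd l `<=` end_nbhd k.
Proof. by move=> kl y [|/(end_punctured_homo kl)]; [left|right]. Qed.

Lemma model_nbs_self q B : model_nbs q B -> B q.
Proof.
rewrite /model_nbs /=; case: asboolP => [Hq /half_plane_nbs_self|_ []//]; exact.
Qed.

Lemma model_nbs_filter q : Filter (model_nbs q).
Proof.
have [Hq|nHq] := pselect (H q).
  by rewrite model_nbsH//; exact: half_plane_nbs_filter.
split; rewrite /model_nbs /=; case: asboolP => // _.
- by split=> //; exists 0%N.
- move=> A B [Aq [k kA]] [Bq [l lB]]; split=> //; exists (maxn k l) => y yk; split.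
    by apply: kA; apply: end_nbhd_homo yk; exact: leq_maxl.
  by apply: lB; apply: end_nbhd_homo yk; exact: leq_maxr.
- by move=> A B AB [/AB Bq [k kA]]; split=> //; exists k => y /kA/AB.
Qed.

Lemma end_punctured_open k q : end_punctured k q -> half_plane_nbs q (end_punctured k).
Proof.
move=> [Hq q_far Fq].
have far_loc : half_plane_nbs q [set y | k%:R < y.2 \/ k%:R < `|y.1|].
  case: q_far => [/half_plane_nbs2_gt|kq].
    by apply: half_plane_nbsS => y; left.
  move: kq; rewrite -subr_gt0 => /(half_plane_nbs1 q).
  apply: half_plane_nbsS => y /= qy; right.
  by have := lerB_dist q.1 y.1; lra.
have := half_plane_nbsI far_loc (F_nbs_lt Hq Fq).
move=> /half_plane_nbsI /(_ (half_plane_nbs_half q)).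
by apply: half_plane_nbsS => y [[]].
Qed.

Lemma end_nbhd_open k q : end_nbhd k q -> model_nbs q (end_nbhd k).
Proof.
case=> [->|qk]; first by apply/model_nbso; exists k.
have [Hq _ _] := qk; rewrite model_nbsH//.
by apply: half_plane_nbsS (end_punctured_open qk) => y; right.
Qed.

(** This is the margin that gluing requires: bounds and levels shrink strictly with [k], so the
    closure of one neighbourhood of infinity lies in the previous one. *)
Lemma end_nbhd_away k q : H q -> ~ end_punctured k q ->
  half_plane_nbs q (~` end_nbhd k.+1).
Proof.
move=> Hq nq.
have: half_plane_nbs q (~` end_punctured k.+1).
  have [Fq|Fq] := ltP (F q) (level k); last first.
    have := F_nbs_gt Hq (lt_le_trans (level_lt (ltnSn k)) Fq).
    by apply: half_plane_nbsS => y /= Fy [_ _ Fy']; lra.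
  have [q2 q1] : q.2 < k.+1%:R /\ `|q.1| < k.+1%:R.
    rewrite -natr1; split; rewrite ltNge; apply/negP => kq; apply: nq; split=> //.
      by left; lra.
    by right; lra.
  have := half_plane_nbs2_lt q2.
  move: q1; rewrite -subr_gt0 => /(half_plane_nbs1 q) /half_plane_nbsI.
  move=> /[apply]; apply: half_plane_nbsS => y /= [qy y2] [_ [y1|y1] _]; first lra.
  by have := lerB_dist y.1 q.1; rewrite distrC; lra.
move=> /half_plane_nbsI /(_ (half_plane_nbs_half q)).
by apply: half_plane_nbsS => y [ny Hy] [yo|//]; apply: oNH; rewrite -yo.
Qed.

(** The half [0 <= s * u] (for [s = 1] or [s = -1]) of [end_punctured k],
    enlarged by the horizontal strips which avoid the bumps of height [level k]. *)
Definition side (s : R) (k : nat) : set P :=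
  [set y | [/\ H y, k%:R < y.2 \/ k%:R < s * y.1 &
    (0 < s * y.1 /\ F y < level k) \/ F (0, y.2) < level k]].

Lemma sideE (s : R) k y : s = 1 \/ s = -1 -> side s k y -> end_punctured k y.
Proof.
move=> s1 [Hy y_far Fy]; split=> //.
  case: y_far => [|ky]; [by left|right; apply: (lt_le_trans ky)].
  by case: s1 => ->; rewrite ?mul1r ?mulN1r; [exact: ler_norm|rewrite -normrN ler_norm].
by case: Fy => [[]//|]; apply: le_lt_trans; exact: F_le_axis.
Qed.

Lemma end_puncturedE k y : end_punctured k y -> side 1 k y \/ side (-1) k y.
Proof.
case: y => u v [/= Hy y_far Fy]; have [u0|u0|u0] := ltgtP u 0.
- right; split=> //=; last by left; split=> //; lra.
  by case: y_far => [|]; [left|right; move: b; rewrite ltr0_norm//; lra].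
- left; split=> //=; last by left; split=> //; lra.
  by case: y_far => [|]; [left|right; move: b; rewrite gtr0_norm//; lra].
- left; split=> //=; last by right; rewrite -u0.
  case: y_far => [|]; [by left|rewrite u0 normr0].
  by have := ler0n R k; lra.
Qed.

Lemma side_homo (s : R) k l : (k <= l)%N -> side s l `<=` side s k.
Proof.
move=> kl y [Hy y_far Fy]; have kl' : k%:R <= l%:R :> R by rewrite ler_nat.
have : level l <= level k.
  by move: kl; rewrite leq_eqVlt => /predU1P[->//|/level_lt/ltW].
split=> //; first by case: y_far => ?; [left|right]; lra.
by case: Fy => [[]|]; [left|right]; try split=> //; lra.
Qed.

Lemma mul_nbs_gt (s : R) q a : s = 1 \/ s = -1 -> a < s * q.1 ->
  half_plane_nbs q [set y | a < s * y.1].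
Proof.
case=> ->; rewrite ?mul1r ?mulN1r.
  by move/half_plane_nbs1_gt; apply: half_plane_nbsS => y /=; rewrite mul1r.
move=> aq; have : q.1 < - a by lra.
by move/half_plane_nbs1_lt; apply: half_plane_nbsS => y /=; lra.
Qed.

Lemma side_open (s : R) k q : s = 1 \/ s = -1 -> side s k q -> half_plane_nbs q (side s k).
Proof.
move=> s1 [Hq q_far Fq].
have far_loc : half_plane_nbs q [set y | k%:R < y.2 \/ k%:R < s * y.1].
  case: q_far => [/half_plane_nbs2_gt|/(mul_nbs_gt s1)].
    by apply: half_plane_nbsS => y; left.
  by apply: half_plane_nbsS => y; right.
have F_loc : half_plane_nbs q
    [set y | (0 < s * y.1 /\ F y < level k) \/ F (0, y.2) < level k].
  case: Fq => [[/(mul_nbs_gt s1) sq /(F_nbs_lt Hq) Fq]|Fq].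
    by apply: half_plane_nbsS (half_plane_nbsI sq Fq) => y; left.
  have Hq0 : H (0, q.2) by [].
  by apply: half_plane_nbsS (axis_nbs Hq (F_nbs_lt Hq0 Fq)) => y; right.
have := half_plane_nbsI far_loc F_loc.
move=> /half_plane_nbsI /(_ (half_plane_nbs_half q)).
by apply: half_plane_nbsS => y [[]].
Qed.

(** A horizontal motion away from the bumps, followed by a straight line. *)
Lemma side_contractible (s : R) k : s = 1 \/ s = -1 ->
  contractible model_nbs (side s k) (s * k.+1%:R, 1).
Proof.
move=> s1; pose c : R := k.+1%:R.
have ss : s * s = 1 by case: s1 => ->; lra.
have ns : `|s| = 1 by case: s1 => ->; rewrite ?normrN normr1.
have c1 : 1 <= c by rewrite ler1n.
have kc : k%:R < c by rewrite ltr_nat.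
(* During [0, 1] the points with [s * u < c] slide horizontally to abscissa [s * c], beyond all
   bumps, while the others wait; during [1, 2] all go straight to the base point, and [c > k] keeps
   them far. *)
pose tau (q : P) (t : R) : R := if c <= s * q.1 then clamp (t - 1) else clamp t.
have tauP q t : 0 <= tau q t <= 1 by rewrite /tau; case: ifP => _; exact: clampP.
have H1 : H (s * c, 1) by rewrite /half_plane /=.
apply: (@homotopy_contractible _ (side s k) (s * c, 1) (fun q t =>
  (q.1 + tau q t * (s * c - q.1), q.2 + clamp (t - 1) * (1 - q.2)))).
- split; [exact: H1|by right; rewrite /= mulrA ss mul1r|].
  left; rewrite /= mulrA ss mul1r; split; first by lra.
  apply: le_lt_trans (level_gt0 k); apply: (F_far FP) => //.
  by rewrite normrM ns mul1r ger0_norm//; lra.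
- by move=> q [].
- by move=> q /(side_open s1).
- have e1 : clamp (0 - 1 : R) = 0 by apply: clamp_le0; lra.
  have e2 : clamp (0 : R) = 0 by exact: clamp_le0.
  by case=> u v _; rewrite /tau /= e1 e2; case: ifP => _; rewrite !mul0r !addr0.
- have e1 : clamp (2 - 1 : R) = 1 by apply: clamp_ge1; lra.
  have e2 : clamp (2 : R) = 1 by apply: clamp_ge1; lra.
  by case=> u v _; rewrite /tau /= e1 e2; case: ifP => _; rewrite !mul1r !subrKC.
- move=> [u v] t [/= Hq q_far Fq] /andP[t0 t2].
  have v1 : 1 <= v by exact: Hq.
  have sU : s * (u + tau (u, v) t * (s * c - u)) = s * u + tau (u, v) t * (c - s * u).
    by rewrite -[in RHS](mul1r c) -ss; ring.
  have taut := tauP (u, v) t; have clt := clampP (t - 1).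
  have [t1|t1] := leP t 1.
    rewrite (clamp_le0 (_ : t - 1 <= 0)) ?mul0r ?addr0; last by lra.
    have Us : s * u <= s * (u + tau (u, v) t * (s * c - u)).
      rewrite sU lerDl /tau /=; case: (leP c (s * u)) => cu.
        by rewrite clamp_le0 ?mul0r//; lra.
      by rewrite mulr_ge0//; [have := clampP t; lra|lra].
    split=> //=; first by case: q_far => ?; [left|right; lra].
    (* Either the point moves away from the axis, which lowers [F], or its whole horizontal line is
       low. *)
    case: Fq => [[u0 Fq]|]; [left|by right].
    split; first by lra.
    apply: le_lt_trans Fq; apply: (F_mono FP) => //.
    have n_s x : `|x| = `|s * x| by rewrite normrM ns mul1r.
    by rewrite n_s [leRHS]n_s !gtr0_norm//; lra.
  have cU : c <= s * (u + tau (u, v) t * (s * c - u)).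
    rewrite sU /tau /=; case: (leP c (s * u)) => cu.
      have -> : s * u + clamp (t - 1) * (c - s * u) = c + (1 - clamp (t - 1)) * (s * u - c) by ring.
      by rewrite lerDl mulr_ge0//; lra.
    by rewrite clamp_ge1; lra.
  have V1 : 1 <= v + clamp (t - 1) * (1 - v).
    have -> : v + clamp (t - 1) * (1 - v) = 1 + (1 - clamp (t - 1)) * (v - 1) by ring.
    by rewrite lerDl mulr_ge0//; lra.
  split=> //=; first by right; lra.
  left; split; first by lra.
  apply: le_lt_trans (level_gt0 k); apply: (F_far FP) => //.
  rewrite -[leRHS]mul1r -ns -normrM; apply: le_trans (ler_norm _); lra.
- move=> q y t _ _ _; rewrite /dist /=; apply: lerD; last by apply: affine_lip; exact: clampP.
  have n_s x : `|x| = `|s * x| by rewrite normrM ns mul1r.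
  have sU x y' a b : s * ((x + a * (s * c - x)) - (y' + b * (s * c - y'))) =
      (s * x + a * (c - s * x)) - (s * y' + b * (c - s * y')).
    by rewrite -[in RHS](mul1r c) -ss; ring.
  rewrite n_s [leRHS]n_s sU [s * (_ - _)]mulrBr /tau; move: (s * q.1) (s * y.1) => {}u {}w.
  wlog uw : u w / u <= w.
    move=> th; have [/th//|/ltW/th] := leP u w.
    by rewrite distrC [leRHS]distrC.
  have := clampP t; have := clampP (t - 1).
  (* Only one of the two phases is under way at a time, so a point that has to slide and one that
     waits do not drift apart. *)
  have : clamp (t - 1) = 0 \/ clamp t = 1.
    have [?|?] := leP t 1; first by left; rewrite clamp_le0//; lra.
    by right; rewrite clamp_ge1//; lra.
  move: (clamp (t - 1)) (clamp t) => a b ab a01 b01.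
  rewrite (ler0_norm (_ : u - w <= 0)); last by lra.
  case: (leP c u) => cu; case: (leP c w) => cw.
  + by rewrite ler_norml; nra.
  + lra.
  + by case: ab => ->; rewrite ler_norml; nra.
  + by rewrite ler_norml; nra.
- move=> q t t' _ _ _; rewrite affine_dist /dist mulrDl !(mulrC `|_ - _| `|t - t'|).
  have tauL : `|tau q t - tau q t'| <= `|t - t'|.
    rewrite /tau; case: ifP => _; last exact: clamp_lip.
    apply: le_trans (clamp_lip _ _) _.
    by rewrite (_ : t - 1 - (t' - 1) = t - t'); [|ring].
  apply: lerD; apply: ler_wpM2r => //.
  apply: le_trans (clamp_lip _ _) _.
  by rewrite (_ : t - 1 - (t' - 1) = t - t'); [|ring].
- by move=> q [Hq _ _]; rewrite model_nbsH.
Qed.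

End Model.

(** * Cohomology of the model *)

Section ModelCohomology.
Variable R : realType.
Notation P := (R * R)%type.
Notation H := (@half_plane R).
Notation o := ((0, 0) : P).
Variables (F : P -> R) (gamma : nat -> R).
Hypothesis FP : bump_profile F gamma.
Implicit Types (s : nat -> int) (l : seq P) (z b : seq P -> int) (k m n : nat).

Notation X := (@model_space R).
Notation nbs := (model_nbs F).
Notation locz := (locally_zero nbs).
Notation loccob := (locally_coboundary nbs).
Let nbsF := @model_nbs_filter R F.
Let nbsS := @model_nbs_self R F.

Definition gap_cochain s l : int :=
  if l is [:: x] then s (gap_index gamma x.2) else 0.

(** The coboundary of [gap_cochain s], cut along the vertical axis. *)
Definition cut_cochain s l : int :=
  if l is [:: x; y] then
    if (x.1 < 0) && (y.1 < 0) then
      s (gap_index gamma y.2) - s (gap_index gamma x.2)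
    else 0
  else 0.

(** Off the tops the cut cochain is locally a coboundary or zero, so its coboundary lives near the
    tops. Setting it to zero on low lists keeps its germ in the half-plane and makes it vanish near
    infinity. The premise [H y] counts [o] as low; the threshold 1/2 lies strictly between 0 and the
    height of the tops. *)
Definition bump_cocycle s l : int :=
  if `[< inside [set y | H y -> F y < 2^-1] l >] then 0
  else delta (cut_cochain s) l.

Lemma cut_left q : H q -> q.1 < 0 -> exists2 B, half_plane_nbs q B &
  forall s l, size l = 2 -> inside B l -> cut_cochain s l = delta (gap_cochain s) l.
Proof.
move=> Hq q0; exists [set y | y.1 < 0]; first exact: half_plane_nbs1_lt.
move=> s [|x [|y []]] //= _ lB; rewrite subr0 !lB//; [by right; left|by left].
Qed.

Lemma cut_right q : H q -> 0 < q.1 -> exists2 B, half_plane_nbs q B &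
  forall s l, size l = 2 -> inside B l -> cut_cochain s l = 0.
Proof.
move=> Hq q0; exists [set y | 0 < y.1]; first exact: half_plane_nbs1_gt.
move=> s [|x [|y []]] //= _ lB.
by rewrite ltNge ltW ?lB//; left.
Qed.

Lemma cut_gap q : H q -> F (0, q.2) < 1 -> exists2 B, half_plane_nbs q B &
  forall s l, size l = 2 -> inside B l ->
    cut_cochain s l = 0 /\ delta (gap_cochain s) l = 0.
Proof.
move=> Hq q0; exists [set y | gap_index gamma y.2 = gap_index gamma q.2].
  exact: (gap_index_loc FP).
move=> s [|x [|y []]] //= _ lB; rewrite !lB; [|by left|by right; left].
by rewrite subr0 subrr if_same.
Qed.

Lemma delta_locally_zero q B z m : half_plane_nbs q B ->
  (forall l, size l = m -> inside B l -> z l = 0) ->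
  forall l, size l = m.+1 -> inside B l -> delta z l = 0.
Proof.
move=> qB zB l lm lB; rewrite -[RHS](delta_zero l).
by apply: (eq_delta_on (A := B) (m := m)) => // t tm tB; exact: zB.
Qed.

Lemma delta_cut q : H q -> F (0, q.2) < 1 \/ q.1 != 0 ->
  exists2 B, half_plane_nbs q B &
  forall s l, size l = 3 -> inside B l -> delta (cut_cochain s) l = 0.
Proof.
move=> Hq; have [q0|q0|q0] := ltgtP q.1 0 => q1.
- have [B qB cB] := cut_left Hq q0; exists B => // s l l3 lB.
  rewrite -[RHS](delta_delta (gap_cochain s) l).
  by apply: (eq_delta_on (A := B) (m := 2)) => // t t2 tB; exact: cB.
- have [B qB cB] := cut_right Hq q0; exists B => // s l l3 lB.
  by apply: (delta_locally_zero qB (m := 2)) => //; exact: cB.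
- case: q1 => // q1; have [B qB cB] := cut_gap Hq q1; exists B => // s l l3 lB.
  by apply: (delta_locally_zero qB (m := 2)) => // t t2 tB; exact: (cB s t t2 tB).1.
Qed.

Lemma bump_cocycleH q : H q -> exists2 B, half_plane_nbs q B &
  forall s l, size l = 3 -> inside B l -> bump_cocycle s l = delta (cut_cochain s) l.
Proof.
move=> Hq; have [Fq|Fq] := ltP 2^-1 (F q).
  exists [set y | H y /\ 2^-1 < F y].
    exact: half_plane_nbsI (half_plane_nbs_half q) (F_nbs_gt FP Hq Fq).
  move=> s [//|x l] _ lB; rewrite /bump_cocycle; case: asboolP => // lF.
  have [Hx Fx] := lB x (or_introl erefl).
  by exfalso; have /= := lF x (or_introl erefl) Hx; lra.
have [|B qB cB] := delta_cut Hq; last first.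
  exists B => // s l l3 lB; rewrite /bump_cocycle; case: asboolP => // _.
  by rewrite cB.
have [q1|q1] := eqVneq q.1 0; [left|by right].
by rewrite -q1 -surjective_pairing; lra.
Qed.

Lemma bump_cocycle_end k s l : (0 < k)%N -> inside (end_nbhd F k) l ->
  bump_cocycle s l = 0.
Proof.
move=> k0 lk; rewrite /bump_cocycle; case: asboolP => // lF; case: lF.
move=> y /lk[->/oNH//|[Hy _ Fy] _]; apply: lt_le_trans Fy _.
by rewrite /level lef_pV2 ?posrE// ler_nat.
Qed.

(** [B] is chosen before [s]: one open cover will carry the cocycles of all sequences at once. *)
Lemma bump_cocycleP q : X q -> exists2 B, nbs q B &
  forall s l, size l = 4 -> inside B l -> delta (bump_cocycle s) l = 0.
Proof.
case=> [->|Hq].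
  exists (end_nbhd F 1); first by apply/model_nbso; exists 1%N.
  move=> s l l4 lB; rewrite -[RHS](delta_zero l).
  apply: (eq_delta_on (A := end_nbhd F 1) (m := 3)) => // t t3 tB.
  exact: bump_cocycle_end tB.
have [B qB cB] := bump_cocycleH Hq; exists B; first by rewrite model_nbsH.
move=> s l l4 lB; rewrite -[RHS](delta_delta (cut_cochain s) l).
by apply: (eq_delta_on (A := B) (m := 3)) => // t t3 tB; exact: cB.
Qed.

Lemma locally_zero_end z m k :
  (forall l, size l = m -> inside (end_nbhd F k) l -> z l = 0) ->
  locz (end_nbhd F k) m z.
Proof.
by move=> zk q qk; exists (end_nbhd F k) => //; exact: (end_nbhd_open FP).
Qed.

Lemma half_plane_contractible : contractible nbs H (0, 1).
Proof.
apply: convex_contractible => //; first by rewrite /half_plane /=.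
- exact: model_nbsH.
- by move=> q _; exact: half_plane_nbs_half.
- by move=> [u v] t; rewrite /half_plane/= => v1 t01; nra.
Qed.

Lemma glue_end z m a b k :
  locz (end_nbhd F k) m.+2 (fun l => z l - delta a l) ->
  locz H m.+2 (fun l => z l - delta b l) ->
  loccob (end_punctured F k) m.+1 (fun l => a l - b l) ->
  loccob X m.+2 z.
Proof.
move=> za zb ab.
apply: (locally_coboundary_glue nbsF (A' := end_nbhd F k.+1) _ za zb); last first.
  case: ab => e ab; exists e; apply: locally_zero_sub ab.
  by move=> q [[->/oNH|]].
move=> q [->|Hq]; [constructor 1|].
  by split; [exact/(end_nbhd_open FP)/or_introl|left].
have [qk|qk] := pselect (end_punctured F k q); [constructor 2|constructor 3].
  by split=> //; right.
by split=> //; rewrite model_nbsH//; exact: (end_nbhd_away FP).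
Qed.

(** The overlap is taken at level [k] and the conclusion holds at level [k.+1], which leaves the
    margin for gluing. *)
Lemma glue_sides z m a b k :
  locz (side F 1 k) m.+2 (fun l => z l - delta a l) ->
  locz (side F (-1) k) m.+2 (fun l => z l - delta b l) ->
  loccob (side F 1 k `&` side F (-1) k) m.+1 (fun l => a l - b l) ->
  loccob (end_punctured F k.+1) m.+2 z.
Proof.
move=> za zb ab.
apply: (locally_coboundary_glue nbsF (A' := side F 1 k.+1) _ za zb ab).
move=> q qk; have [Hq _ Fq] := qk; rewrite !model_nbsH//.
have [q1|nq1] := pselect (side F 1 k.+1 q); [constructor 1|].
  split; last exact: side_homo q1.
  by apply: (side_open FP) => //; left.
have [//|/(side_homo (leqnSn k)) qN] := end_puncturedE qk.
have [q1|{}nq1] := pselect (side F 1 k q); [by constructor 2|constructor 3].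
split=> //.
(* Near [q], points of [side 1 k.+1] are excluded by position when [q.1] and [q.2] are both below k
   + 1; otherwise by the sign of the abscissa together with [F (0, q.2) >= level k > level k.+1]. *)
have [q2|q2] := ltP q.2 k.+1%:R; have [q1|q1] := ltP q.1 k.+1%:R.
- apply: half_plane_nbsS (half_plane_nbsI (half_plane_nbs2_lt q2) (half_plane_nbs1_lt q1)).
  by move=> y /= [y2 y1] [_ + _]; rewrite mul1r => -[]; lra.
all: have q_far : k%:R < q.2 \/ k%:R < 1 * q.1 by
  rewrite mul1r; move: q1 q2; rewrite -!natr1 => *; (left + right); lra.
all: have [F0|F0] := ltP (F (0, q.2)) (level R k);
  first by exfalso; apply: nq1; split=> //; right.
all: have Fk : level R k.+1 < level R k by exact: level_lt.
all: have q1N : q.1 < 0 by rewrite ltNge le_eqVlt; apply/negP => /predU1P[q10|q10];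
  [move: Fq F0; rewrite q10 -surjective_pairing; lra|
   apply: nq1; split=> //; left; rewrite mul1r; split=> //; lra].
all: have Hq0 : H (0, q.2) by [].
all: have := F_nbs_gt FP Hq0 (lt_le_trans Fk F0).
all: move=> /(axis_nbs Hq) /(half_plane_nbsI (half_plane_nbs1_lt q1N)).
all: apply: half_plane_nbsS => y /= [y1 yF] [_ _]; rewrite mul1r; lra.
Qed.

(** Prepending [o] keeps a list inside a neighbourhood of [o], so the cocycle condition there is
    available on [o :: l]. *)
Lemma cone_end z m : locz X m.+3 (delta z) -> exists k, [/\ (0 < k)%N,
  forall l, size l = m.+2 -> inside (end_nbhd F k) l ->
    z l = delta (fun t => z (o :: t)) l &
  locz (end_nbhd F k) m.+2 (fun l => z l - delta (fun t => z (o :: t)) l)].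
Proof.
move=> dz0; have [B /model_nbso[k kB] zB] := dz0 o (or_introl erefl).
exists k.+1; have zE l : size l = m.+2 -> inside (end_nbhd F k.+1) l ->
    z l = delta (fun t => z (o :: t)) l.
  move=> lm lk; rewrite delta_cone//; apply: zB; first by rewrite /= lm.
  by move=> y [<-|/lk /(end_nbhd_homo (leqnSn k)) /kB//]; apply: kB; left.
split=> //; apply: locally_zero_end => l lm lk; rewrite -zE//; exact: subrr.
Qed.

Lemma half_plane_primitive z m : locz X m.+3 (delta z) ->
  exists b, locz H m.+2 (fun l => z l - delta b l).
Proof.
move=> dz0; apply: (contractible_acyclic nbsS (@half_plane_contractible)) => //.
  by rewrite /half_plane /=.
by apply: locally_zero_sub dz0 => q; right.
Qed.

Lemma end_punctured_sub k : end_punctured F k `<=` end_nbhd F k `&` H.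
Proof. by move=> q qk; split; [right|have [] := qk]. Qed.

Lemma locally_zero_cocycle_diff z a b m k :
  locz (end_nbhd F k) m (fun l => z l - delta a l) ->
  locz H m (fun l => z l - delta b l) ->
  locz (end_punctured F k) m (delta (fun l => a l - b l)).
Proof.
move=> za zb.
have := locally_zeroB nbsF
  (locally_zero_sub (fun q (qk : end_punctured F k q) => (end_punctured_sub qk).2) zb)
  (locally_zero_sub (fun q (qk : end_punctured F k q) => (end_punctured_sub qk).1) za).
by apply: locally_zero_ext => l; rewrite deltaB; ring.
Qed.

Lemma sides_sign : (1 = 1 :> R \/ 1 = -1 :> R) /\ (-1 = 1 :> R \/ -1 = -1 :> R).
Proof. by split; [left|right]. Qed.

Lemma side_base (s : R) k : s = 1 \/ s = -1 -> side F s k (s * k.+1%:R, 1).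
Proof.
move=> s1; have ss : s * s = 1 by case: s1 => ->; lra.
have ns : `|s| = 1 by case: s1 => ->; rewrite ?normrN normr1.
have k1 : 1 <= k.+1%:R :> R by rewrite ler1n.
split; [by rewrite /half_plane /=|right|left].
  by rewrite /= mulrA ss mul1r ltr_nat.
rewrite /= mulrA ss mul1r; split; first by lra.
apply: le_lt_trans (level_gt0 R k); apply: (F_far FP) => //.
by rewrite normrM ns mul1r ger0_norm//; lra.
Qed.

Lemma side_primitive (s : R) k z m : s = 1 \/ s = -1 ->
  locz (end_punctured F k) m.+3 (delta z) ->
  exists e, locz (side F s k) m.+2 (fun l => z l - delta e l).
Proof.
move=> s1 dz0.
apply: (contractible_acyclic nbsS (@side_contractible _ _ _ FP s k s1)) => //.
  exact: side_base.
by apply: locally_zero_sub dz0 => q; exact: (sideE FP).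
Qed.

Lemma side_constant (s : R) k z : s = 1 \/ s = -1 ->
  locz (side F s k) 2 (delta z) ->
  forall x, side F s k x -> z [:: x] = z [:: (s * k.+1%:R, 1)].
Proof.
move=> s1; exact: (contractible_constant nbsS (@side_contractible _ _ _ FP s k s1)).
Qed.

Definition strip k n : set P := [set y | (side F 1 k `&` side F (-1) k) y /\
  gap_index gamma y.2 = n].

(** The sides meet in whole horizontal lines: 0 < u and 0 < - u exclude each other, so the
    conditions must hold through the ordinate. *)
Lemma sidesIE k y : (side F 1 k `&` side F (-1) k) y <->
  [/\ H y, k%:R < y.2 & F (0, y.2) < level R k].
Proof.
have k0 : 0 <= k%:R :> R by [].
split=> [[[Hy y1 F1] [_ y2 F2]]|[Hy y2 Fy]]; last by split; split=> //; [left|right|left|right].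
move: y1 y2 F1 F2; rewrite mul1r mulN1r => y1 y2 F1 F2; split=> //.
  by case: y1 => // y1; case: y2 => // y2; lra.
by case: F1 => [[y1' _]|//]; case: F2 => [[y2' _]|//]; lra.
Qed.

Lemma sidesI_nbs k q : (side F 1 k `&` side F (-1) k) q ->
  half_plane_nbs q [set y | gap_index gamma y.2 = gap_index gamma q.2].
Proof.
move=> /sidesIE[Hq _ Fq]; apply: (gap_index_loc FP) => //.
exact: lt_le_trans (level_le1 R k).
Qed.

Lemma interpolation (a b t : R) : 0 <= t -> t <= 1 -> a <= b ->
  a <= a + t * (b - a) <= b.
Proof.
move=> t0 t1 ab; rewrite lerDl mulr_ge0 ?subr_ge0//= -lerBrDl ler_piMl//.
by rewrite subr_ge0.
Qed.

Lemma strip_contractible k n p : strip k n p -> contractible nbs (strip k n) p.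
Proof.
move=> kp; have [/sidesIE[Hp p2 Fp] pn] := kp.
apply: convex_contractible => //.
- by move=> q [/sidesIE[]].
- by move=> q [/sidesIE[Hq _ _] _]; exact: model_nbsH.
- move=> q [q12 <-]; have [q1 q2] := q12.
  have [sg1 sgN1] := sides_sign.
  have := half_plane_nbsI (side_open FP sg1 q1) (side_open FP sgN1 q2).
  by move=> /half_plane_nbsI /(_ (sidesI_nbs q12)).
- move=> q t [/sidesIE[Hq q2 Fq] qn] /andP[t0 t1].
  set w := q.2 + t * (p.2 - q.2).
  have Hq1 : 1 <= q.2 by [].
  have Hp1 : 1 <= p.2 by [].
  have [ww Fw] : gap_index gamma w = n /\ F (0, w) < level R k.
    have [qp|/ltW pq] := leP q.2 p.2.
      have /andP[qw wp] := interpolation t0 t1 qp.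
      by rewrite -qn; apply: (gap_index_convex FP (v' := p.2)) => //; rewrite ?qn.
    have /andP[pw wq] : p.2 <= w <= q.2.
      have := @interpolation p.2 q.2 (1 - t); rewrite /w => /(_ _ _ pq) ip.
      have -> : q.2 + t * (p.2 - q.2) = p.2 + (1 - t) * (q.2 - p.2) by ring.
      by apply: ip; lra.
    rewrite -pn; apply: (gap_index_convex FP (v' := q.2)) => //; rewrite ?qn//; lra.
  have [w1 kw] : 1 <= w /\ k%:R < w.
    have [qp|/ltW pq] := leP q.2 p.2.
      by have /andP[qw wp] := interpolation t0 t1 qp; rewrite /w; split; lra.
    have -> : w = p.2 + (1 - t) * (q.2 - p.2) by rewrite /w; ring.
    have /andP[pw wq] := @interpolation p.2 q.2 (1 - t) ltac:(lra) ltac:(lra) pq.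
    by split; lra.
  by split; [exact/sidesIE|exact: ww].
Qed.

Lemma strips_coboundary k z m : locz (side F 1 k `&` side F (-1) k) m.+3 (delta z) ->
  loccob (side F 1 k `&` side F (-1) k) m.+2 z.
Proof.
move=> dz0.
apply: (locally_coboundary_partition nbsF (idx := fun q => gap_index gamma q.2)).
  by move=> q q12; have [[Hq _ _] _] := q12; rewrite model_nbsH//; exact: sidesI_nbs q12.
move=> n; have [[p kp]|no] := pselect (exists p, strip k n p).
  apply: (contractible_acyclic nbsS (@strip_contractible _ _ _ kp)) => //.
  by apply: locally_zero_sub dz0 => q [].
exists (fun=> 0) => q kq; exfalso; apply: no; by exists q.
Qed.

Lemma strips_constant k z : locz (side F 1 k `&` side F (-1) k) 2 (delta z) ->
  exists s : nat -> int, forall y, (side F 1 k `&` side F (-1) k) y ->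
    z [:: y] = s (gap_index gamma y.2).
Proof.
move=> dz0; exists (fun n => z [:: xget o (strip k n)]) => y y12.
set n := gap_index _ _; have ky : strip k n y by [].
have kp : strip k n (xget o (strip k n)) by case: xgetP => // /(_ y).
apply: (contractible_constant nbsS (@strip_contractible _ _ _ kp)) => //.
by apply: locally_zero_sub dz0 => q [].
Qed.

(** On the line [v = n], which corresponds to the loop K_n, nothing rises above 0, so the gap [n]
    contributes a strip at every level [k < n]. *)
Lemma strip_nat k n : (k < n)%N ->
  (side F 1 k `&` side F (-1) k) (0, n%:R) /\ gap_index gamma n%:R = n.
Proof.
move=> kn; split; last by rewrite (gap_index_nat FP)//; lia.
apply/sidesIE; split; rewrite /half_plane /= ?ler1n ?ltr_nat//; first by lia.
by apply: le_lt_trans (level_gt0 R k); apply: (F_nat FP); lia.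
Qed.

(** The sides overlap, so the difference of the two primitives, constant on each side, is one
    constant [c0] on the punctured neighbourhood. Subtracting it from [a] does not change [delta a]
    on lists of even length. *)
Lemma model_degree1 z : locz X 3 (delta z) -> loccob X 2 z.
Proof.
move=> dz0; have [k [k0 _ za]] := cone_end dz0; have [b zb] := half_plane_primitive dz0.
set a := fun t => z (o :: t) in za.
have dab := locally_zero_cocycle_diff za zb.
have [sg1 sgN1] := sides_sign.
pose c l := a l - b l.
have cE (s : R) : s = 1 \/ s = -1 ->
    forall x, side F s k x -> c [:: x] = c [:: (s * k.+1%:R, 1)].
  move=> s1; apply: side_constant => //.
  by apply: locally_zero_sub dab => q; exact: (sideE FP).
have [[x1 x2] _] := strip_nat (ltnSn k).
have cc : forall x, end_punctured F k x -> c [:: x] = c [:: (0, k.+1%:R)].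
  move=> x /end_puncturedE[x12|x12].
    by rewrite (cE _ sg1)// [RHS](cE _ sg1).
  by rewrite (cE _ sgN1)// [RHS](cE _ sgN1).
pose c0 := c [:: (0, k.+1%:R)].
apply: (glue_end (a := fun l => a l - c0) _ zb (k := k)).
  move=> q /za[B qB zB]; exists B => // l l2 lB.
  by rewrite deltaB delta_const l2 subr0 zB.
apply: locally_coboundary_zero => q qk.
exists (end_punctured F k).
  by have [Hq _ _] := qk; rewrite model_nbsH//; exact: (end_punctured_open FP).
move=> [|x []]// _ lk.
have := cc x (lk x (or_introl erefl)); rewrite -/c0 /c => <-; ring.
Qed.

(** Each of the two gluings shortens the lists by one; from length m + 4 they leave positive degree
    on the strips, where convexity kills it. *)
Lemma model_high_degree z m : locz X m.+4.+1 (delta z) -> loccob X m.+4 z.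
Proof.
move=> dz0; have [k [k0 _ za]] := cone_end dz0; have [b zb] := half_plane_primitive dz0.
set a := fun t => z (o :: t) in za.
have dab := locally_zero_cocycle_diff za zb.
have [sg1 sgN1] := sides_sign.
have [e1 c1] := side_primitive sg1 dab.
have [e2 c2] := side_primitive sgN1 dab.
apply: (@glue_end _ _ _ _ k.+1 _ zb).
  by apply: locally_zero_sub za => q; exact: end_nbhd_homo.
apply: (glue_sides c1 c2); apply: strips_coboundary.
have := locally_zeroB nbsF (locally_zero_sub (@subIsetr _ _ _) c2)
                           (locally_zero_sub (@subIsetl _ _ _) c1).
by apply: locally_zero_ext => l; rewrite deltaB; ring.
Qed.

Lemma cut_cochain_side1 s k :
  locz (side F 1 k) 2 (cut_cochain s).
Proof.
move=> q [Hq _ Fq]; rewrite model_nbsH//; case: Fq => [[]|Fq].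
  by rewrite mul1r => q1 _; have [B qB cB] := cut_right Hq q1; exists B => //; exact: cB.
have [B qB cB] := cut_gap Hq (lt_le_trans Fq (level_le1 R k)).
by exists B => // l l2 lB; have [] := cB s l l2 lB.
Qed.

(** On the right the cut has primitive 0 and on the left [gap_cochain s]: the two differ by [s] on
    the strips. *)
Lemma cut_cochain_sideN1 s k :
  locz (side F (-1) k) 2 (fun l => cut_cochain s l - delta (gap_cochain s) l).
Proof.
move=> q [Hq _ Fq]; rewrite model_nbsH//; case: Fq => [[]|Fq].
  rewrite mulN1r oppr_gt0 => q1 _; have [B qB cB] := cut_left Hq q1; exists B => //.
  by move=> l l2 lB; rewrite cB// subrr.
have [B qB cB] := cut_gap Hq (lt_le_trans Fq (level_le1 R k)).
by exists B => // l l2 lB; have [-> ->] := cB s l l2 lB; rewrite subrr.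
Qed.

Lemma bump_cocycle_cut s : locz H 3 (fun l => bump_cocycle s l - delta (cut_cochain s) l).
Proof.
move=> q Hq; have [B qB cB] := bump_cocycleH Hq; exists B; first by rewrite model_nbsH.
by move=> l l3 lB; rewrite cB// subrr.
Qed.

Lemma model_degree2 z : locz X 4 (delta z) ->
  exists s, loccob X 3 (fun l => z l - bump_cocycle s l).
Proof.
move=> dz0; have [k [k0 _ za]] := cone_end dz0; have [b zb] := half_plane_primitive dz0.
set a := fun t => z (o :: t) in za.
have dab := locally_zero_cocycle_diff za zb.
have [sg1 sgN1] := sides_sign.
have [e1 c1] := side_primitive sg1 dab.
have [e2 c2] := side_primitive sgN1 dab.
have de : locz (side F 1 k `&` side F (-1) k) 2 (delta (fun l => e1 l - e2 l)).
  have := locally_zeroB nbsF (locally_zero_sub (@subIsetr _ _ _) c2)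
                             (locally_zero_sub (@subIsetl _ _ _) c1).
  by apply: locally_zero_ext => l; rewrite deltaB; ring.
(* [s n] is the value of [e1 - e2] on the strip [n]. Subtracting the bump cocycle changes the
   primitive on the left by [gap_cochain s], so that both primitives agree on the strips. *)
have [s es] := strips_constant de; exists s.
apply: (@glue_end _ _ a (fun l => b l - cut_cochain s l) k.+1).
- move=> q qk; have [B qB zB] := za q (end_nbhd_homo (leqnSn k) qk).
  exists (B `&` end_nbhd F k.+1).
    by apply: filterI => //; exact: (end_nbhd_open FP).
  move=> l l3 lB; rewrite (@bump_cocycle_end k.+1)// => [|y /lB[]//].
  by rewrite subr0 zB// => y /lB[].
- have := locally_zeroB nbsF zb (@bump_cocycle_cut s).
  by apply: locally_zero_ext => l; rewrite deltaB; ring.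
apply: (@glue_sides _ _ e1 (fun l => e2 l + gap_cochain s l)).
- have := locally_zeroD nbsF c1 (@cut_cochain_side1 s k).
  by apply: locally_zero_ext => l; ring.
- have := locally_zeroD nbsF c2 (@cut_cochain_sideN1 s k).
  by apply: locally_zero_ext => l; rewrite deltaD; ring.
apply: locally_coboundary_zero => q q12; have [q1 q2] := q12.
exists (side F 1 k `&` side F (-1) k).
  have [Hq _ _] := q1; rewrite model_nbsH//.
  by apply: half_plane_nbsI; exact: (side_open FP).
move=> [|x []]// _ lk; have /es /= <- := lk x (or_introl erefl); ring.
Qed.

(** The primitive [eta] of the cut is [s - c] on the left and 0 on the right; far out on the axis,
    [s] equals [c] and the two definitions match. *)
Lemma bump_cocycle_trivial s k c : (forall n, (k <= n)%N -> s n = c) ->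
  loccob X 3 (bump_cocycle s).
Proof.
move=> sc; pose eta l : int :=
  if l is [:: x] then if x.1 < 0 then s (gap_index gamma x.2) - c else 0 else 0.
apply: (@glue_end _ _ (fun=> 0) (cut_cochain s) k.+1).
- apply: locally_zero_end => l l3 lk.
  by rewrite delta_zero subr0; exact: bump_cocycle_end lk.
- exact: bump_cocycle_cut.
exists (fun l => - eta l) => q qk; have [Hq q_far Fq] := qk; rewrite model_nbsH//.
have [q0|q0|q0] := ltgtP q.1 0.
- exists [set y | y.1 < 0]; first exact: half_plane_nbs1_lt.
  move=> [|x [|y []]] //= _ lB.
  have -> : x.1 < 0 by apply: lB; left.
  have -> : y.1 < 0 by apply: lB; right; left.
  rewrite /=; ring.
- exists [set y | 0 < y.1]; first exact: half_plane_nbs1_gt.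
  move=> [|x [|y []]] //= _ lB.
  have x0 : 0 < x.1 by apply: lB; left.
  have y0 : 0 < y.1 by apply: lB; right; left.
  by rewrite !ltNge !ltW//= subrr.
have kq : k%:R + 1 < q.2.
  rewrite natr1; case: q_far => //; rewrite q0 normr0; have := ler0n R k.+1; lra.
have Fq0 : F (0, q.2) < 1.
  by rewrite -q0 -surjective_pairing; exact: lt_le_trans Fq (level_le1 R _).
exists [set y | gap_index gamma y.2 = gap_index gamma q.2]; first exact: (gap_index_loc FP).
have iq : s (gap_index gamma q.2) = c.
  apply: sc; have [_ _ qi] := gap_index_bounds FP Hq.
  have /andP[_ i1] := gammaP FP (gap_index gamma q.2).
  rewrite -ltnS -(ltr_nat R); apply: lt_trans (lt_trans qi i1); lra.
move=> [|x [|y []]] //= _ lB.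
have -> : gap_index gamma x.2 = gap_index gamma q.2 by apply: lB; left.
have -> : gap_index gamma y.2 = gap_index gamma q.2 by apply: lB; right; left.
by rewrite iq !subrr !if_same; ring.
Qed.

(** Let [b] be a primitive. Near infinity [- b] and the coboundary of the cone cancel: [b] is the
    coboundary of [beta], while on the half-plane the cut minus [b] is that of [eta]. So the cut is
    the coboundary of [theta = eta + beta] on a punctured neighbourhood. Then [theta] is constant on
    the right and [theta - s] on the left, hence [s] is constant on the strips. *)
Lemma bump_cocycle_nontrivial s : loccob X 3 (bump_cocycle s) ->
  exists k c, forall n, (k < n)%N -> s n = c.
Proof.
move=> [b gb].
have db : locz X 4 (delta (fun l => bump_cocycle s l - delta b l)).
  exact: locally_zero_delta gb.
have [B /model_nbso[k kB] gB] := gb o (or_introl erefl).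
have bE l : size l = 2 -> inside (end_nbhd F k.+1) l ->
    b l = delta (fun t => b (o :: t)) l.
  move=> l2 lk; rewrite delta_cone//.
  have lk' : inside (end_nbhd F k.+1) (o :: l) by move=> y [<-|/lk//]; left.
  have := gB (o :: l); rewrite (@bump_cocycle_end k.+1)//= l2 sub0r => /(_ erefl).
  move=> gB'; apply/eqP; rewrite -oppr_eq0; apply/eqP/gB'.
  by move=> y /lk' /(end_nbhd_homo (leqnSn k)) /kB.
set beta := fun t => b (o :: t) in bE.
have dcb : locz H 3 (delta (fun l => cut_cochain s l - b l)).
  have := locally_zeroB nbsF (locally_zero_sub (@subsetUr _ _ _) gb) (@bump_cocycle_cut s).
  by apply: locally_zero_ext => l; rewrite deltaB; ring.
have [eta ceta] : loccob H 2 (fun l => cut_cochain s l - b l).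
  apply: (contractible_acyclic nbsS (@half_plane_contractible)) => //.
  by rewrite /half_plane /=.
pose theta l := eta l + beta l.
have ctheta : locz (end_punctured F k.+1) 2 (fun l => cut_cochain s l - delta theta l).
  move=> q qk; have [Hq _ _] := qk; have [B' qB' cB'] := ceta q Hq.
  exists (B' `&` end_nbhd F k.+1).
    by apply: filterI => //; apply: (end_nbhd_open FP); right.
  move=> l l2 lB; rewrite deltaD -bE// => [|y /lB[]//].
  by rewrite -[RHS](cB' l)// => [|y /lB[]//]; ring.
have [sg1 sgN1] := sides_sign.
have r : forall x, side F 1 k.+1 x -> theta [:: x] = theta [:: (1 * k.+2%:R, 1)].
  apply: side_constant => //.
  have := locally_zeroB nbsF (@cut_cochain_side1 s k.+1)
    (locally_zero_sub (fun q => sideE FP sg1) ctheta).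
  by apply: locally_zero_ext => l; ring.
pose theta' l := theta l - gap_cochain s l.
have r' : forall x, side F (-1) k.+1 x -> theta' [:: x] = theta' [:: (-1 * k.+2%:R, 1)].
  apply: side_constant => //.
  have := locally_zeroB nbsF (@cut_cochain_sideN1 s k.+1)
    (locally_zero_sub (fun q => sideE FP sgN1) ctheta).
  by apply: locally_zero_ext => l; rewrite deltaB; ring.
exists k.+1, (theta [:: (1 * k.+2%:R, 1)] - theta' [:: (-1 * k.+2%:R, 1)]) => n kn.
have [[n1 n2] ni] := strip_nat kn.
by rewrite -(r _ n1) -(r' _ n2) /theta' /= ni; ring.
Qed.

End ModelCohomology.

(** * Inversion of the plane *)

Section Inversion.
Variable R : realType.
Notation P := (R * R)%type.
Notation H := (@half_plane R).
Notation o := ((0, 0) : P).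
Implicit Types (p q c : P).

Definition sqnorm p : R := p.1 ^+ 2 + p.2 ^+ 2.

(** The factor 2 sends the circle K_n, given by x^2 + y^2 = 2 y / n, to the line v = n, hence
    [big_disk] without the origin to [half_plane]. Division by zero makes the origin a fixed point,
    which explains the choice of [o] for infinity. *)
Definition inversion p : P := (2 * p.1 / sqnorm p, 2 * p.2 / sqnorm p).

Lemma sqnorm_ge0 p : 0 <= sqnorm p.
Proof. by rewrite addr_ge0 ?sqr_ge0. Qed.

Lemma sqnorm_eq0 p : (sqnorm p == 0) = (p == o).
Proof.
case: p => x y; rewrite /sqnorm paddr_eq0 ?sqr_ge0//= !sqrf_eq0.
by rewrite xpair_eqE.
Qed.

Lemma sqnorm_gt0 p : p != o -> 0 < sqnorm p.
Proof. by rewrite lt0r sqnorm_ge0 sqnorm_eq0 andbT. Qed.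

Lemma inversion0 : inversion o = o.
Proof. by rewrite /inversion /= mulr0 !mul0r. Qed.

Lemma sqnorm_inversion p : sqnorm (inversion p) = 4 / sqnorm p.
Proof.
have [->|/sqnorm_gt0 p0] := eqVneq p o.
  rewrite inversion0; have /eqP -> : sqnorm o == 0 by rewrite sqnorm_eq0.
  by rewrite invr0 mulr0.
rewrite /inversion {1}/sqnorm /=.
have -> : (2 * p.1 / sqnorm p) ^+ 2 + (2 * p.2 / sqnorm p) ^+ 2 =
  4 * (p.1 ^+ 2 + p.2 ^+ 2) / sqnorm p ^+ 2 by field; lra.
by rewrite -/(sqnorm p); field; lra.
Qed.

Lemma inversionK : involutive inversion.
Proof.
move=> p; have [->|p0] := eqVneq p o; first by rewrite !inversion0.
have p0' := sqnorm_gt0 p0.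
rewrite {1}/inversion sqnorm_inversion /inversion [RHS]surjective_pairing /=.
by congr (_, _); field; lra.
Qed.

Lemma inversion_continuous q e : q != o -> 0 < e ->
  exists2 d, 0 < d & forall q', dist q q' < d -> dist (inversion q) (inversion q') < e.
Proof.
move=> q0 e0; have s0 := sqnorm_gt0 q0.
have c1 : (fun p : P => p.1) @ q --> q.1 by exact: cvg_fst.
have c2 : (fun p : P => p.2) @ q --> q.2 by exact: cvg_snd.
have cs : (fun p : P => (p.1 * p.1 + p.2 * p.2)^-1) @ q --> (q.1 * q.1 + q.2 * q.2)^-1.
  apply: cvgV; first by move: s0; rewrite /sqnorm !expr2 => /lt0r_neq0.
  by apply: cvgD; exact: cvgM.
have i1 : (fun p : P => (2 * p.1) * (p.1 * p.1 + p.2 * p.2)^-1) @ q -->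
    (2 * q.1) * (q.1 * q.1 + q.2 * q.2)^-1.
  by apply: cvgM => //; apply: cvgM => //; exact: cvg_cst.
have i2 : (fun p : P => (2 * p.2) * (p.1 * p.1 + p.2 * p.2)^-1) @ q -->
    (2 * q.2) * (q.1 * q.1 + q.2 * q.2)^-1.
  by apply: cvgM => //; apply: cvgM => //; exact: cvg_cst.
have e2 : 0 < e / 2 by rewrite divr_gt0.
move/cvgrPdist_lt: i1 => /(_ _ e2) i1; move/cvgrPdist_lt: i2 => /(_ _ e2) i2.
have [d /= d0 dP] := (nbhs_ballP q _).1 (filterI i1 i2).
exists d => // q' qq'; have [] : ((fun p : P => `|2 * q.1 * (q.1 * q.1 + q.2 * q.2)^-1 -
   2 * p.1 * (p.1 * p.1 + p.2 * p.2)^-1| < e / 2) `&`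
   (fun p : P => `|2 * q.2 * (q.1 * q.1 + q.2 * q.2)^-1 -
   2 * p.2 * (p.1 * p.1 + p.2 * p.2)^-1| < e / 2)) q'.
  apply: dP; split; rewrite /= -ball_normE /= (le_lt_trans _ qq')// /dist.
    by rewrite lerDl.
  by rewrite lerDr.
by rewrite /= /dist /inversion /sqnorm /= !expr2; lra.
Qed.

Lemma euclidean_dist_ge0 p q : 0 <= euclidean_dist p q.
Proof. exact: sqrtr_ge0. Qed.

Lemma sqr_euclidean_dist p q :
  euclidean_dist p q ^+ 2 = (p.1 - q.1) ^+ 2 + (p.2 - q.2) ^+ 2.
Proof. by rewrite sqr_sqrtr// addr_ge0 ?sqr_ge0. Qed.

Lemma euclidean_dist_le p q r : 0 <= r ->
  (euclidean_dist p q <= r) = ((p.1 - q.1) ^+ 2 + (p.2 - q.2) ^+ 2 <= r ^+ 2).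
Proof.
by move=> r0; rewrite -sqr_euclidean_dist ler_pXn2r ?nnegrE ?euclidean_dist_ge0.
Qed.

Lemma euclidean_dist_lip p q c :
  `|euclidean_dist p c - euclidean_dist q c| <= dist p q.
Proof.
have half p' q' : euclidean_dist p' c <= euclidean_dist q' c + dist p' q'.
  have D0 := dist_ge0 p' q'; have s0 := euclidean_dist_ge0 q' c.
  rewrite euclidean_dist_le ?addr_ge0//.
  have := sqr_euclidean_dist q' c; move: s0; set s := euclidean_dist _ _ => s0 ss.
  have x1 : `|q'.1 - c.1| <= s.
    rewrite -(@ler_pXn2r _ 2) ?nnegrE// real_normK ?num_real// ss lerDl; exact: sqr_ge0.
  have x2 : `|q'.2 - c.2| <= s.
    rewrite -(@ler_pXn2r _ 2) ?nnegrE// real_normK ?num_real// ss lerDr; exact: sqr_ge0.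
  have y1 : `|p'.1 - c.1| <= `|q'.1 - c.1| + `|p'.1 - q'.1|.
    by have := ler_distD q'.1 p'.1 c.1; lra.
  have y2 : `|p'.2 - c.2| <= `|q'.2 - c.2| + `|p'.2 - q'.2|.
    by have := ler_distD q'.2 p'.2 c.2; lra.
  rewrite /dist in D0 *.
  move: ss x1 x2 y1 y2 (normr_ge0 (q'.1 - c.1)) (normr_ge0 (q'.2 - c.2))
     (normr_ge0 (p'.1 - c.1)) (normr_ge0 (p'.2 - c.2)).
  rewrite -[(p'.1 - c.1) ^+ 2]real_normK ?num_real// -[(p'.2 - c.2) ^+ 2]real_normK ?num_real//.
  rewrite -[(q'.1 - c.1) ^+ 2]real_normK ?num_real// -[(q'.2 - c.2) ^+ 2]real_normK ?num_real//.
  move: (normr_ge0 (p'.1 - q'.1)) (normr_ge0 (p'.2 - q'.2)).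
  move: `|p'.1 - q'.1| `|p'.2 - q'.2| `|p'.1 - c.1| `|p'.2 - c.2| `|q'.1 - c.1| `|q'.2 - c.2|.
  move=> d1 d2 a1 a2 b1 b2 d10 d20 ss b1s b2s a1d a2d b10 b20 a10 a20.
  apply: (@le_trans _ _ ((b1 + d1) ^+ 2 + (b2 + d2) ^+ 2)).
    by apply: lerD; rewrite ler_pXn2r ?nnegrE ?addr_ge0.
  have -> : (s + (d1 + d2)) ^+ 2 = s ^+ 2 + 2 * s * d1 + 2 * s * d2 + (d1 + d2) ^+ 2 by ring.
  rewrite ss.
  have := ler_wpM2r d10 b1s; have := ler_wpM2r d20 b2s; have := mulr_ge0 d10 d20.
  by rewrite !sqrrD; lra.
have := half p q; have := half q p; rewrite ler_norml (distC q p); lra.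
Qed.

End Inversion.

(** * The bumps of the archipelago in inverted coordinates *)

Section Bumps.
Variable R : realType.
Notation P := (R * R)%type.
Notation H := (@half_plane R).
Notation o := ((0, 0) : P).
Implicit Types (p q : P) (m n : nat).

Lemma half_plane_neq0 q : H q -> q != o.
Proof.
by move=> Hq; apply: contraPneq Hq => ->; rewrite /half_plane /=; lra.
Qed.

Lemma bump_radius_gt0 n : (0 < n)%N -> 0 < bump_radius R n.
Proof. by move=> n0; rewrite invr_gt0 !mulr_gt0// ltr0n. Qed.

Lemma bump_centerE n : (0 < n)%N ->
  (bump_center R n).2 = (2 * n%:R + 1) * (2 * bump_radius R n).
Proof.
move=> n0; rewrite /bump_center /bump_radius /= -natr1.
by have : 1 <= n%:R :> R; [rewrite ler1n|move=> ?; field; lra].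
Qed.

Lemma bump_radiusE n : (0 < n)%N ->
  2 * n%:R * (n%:R + 1) * bump_radius R n = 1.
Proof.
move=> n0; rewrite /bump_radius -natr1.
by have : 1 <= n%:R :> R; [rewrite ler1n|move=> ?; field; lra].
Qed.

(** After division by [sqnorm p] this places the inverted disc in n < v < n + 1, |u| < 1, between
    the lines that correspond to K_n and K_{n+1}. *)
Lemma bump_disk_bounds n p : bump_disk n p ->
  [/\ n%:R * sqnorm p < 2 * p.2, 2 * p.2 < (n%:R + 1) * sqnorm p &
      2 * `|p.1| < sqnorm p].
Proof.
move=> [n0]; have r0 := bump_radius_gt0 n0.
rewrite euclidean_dist_le ?(ltW r0)// bump_centerE// subr0 => pr.
have := bump_radiusE n0; have a1 : 1 <= n%:R :> R by rewrite ler1n.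
move: r0 pr a1; rewrite /sqnorm; move: (bump_radius R n) (n%:R : R) => r a r0 pr a1 ar.
case: p pr => x y /=; set c := (2 * a + 1) * (2 * r).
have -> : y = (y - c) + c by ring.
rewrite addrK; move: (y - c) => t tr.
have x2 : `|x| <= r.
  rewrite -(@ler_pXn2r _ 2) ?nnegrE ?(ltW r0)// real_normK ?num_real//.
  by apply: le_trans tr; rewrite lerDl sqr_ge0.
have : `|t| <= r.
  rewrite -(@ler_pXn2r _ 2) ?nnegrE ?(ltW r0)// real_normK ?num_real//.
  by apply: le_trans tr; rewrite lerDr sqr_ge0.
rewrite ler_norml => /andP[t1 t2].
have c_r : c = 4 * (a * r) + 2 * r by rewrite /c; ring.
have h1 : a * (a + 1) * r = 2^-1 by lra.
have h2 : a * (a + 1) * c = 2 * a + 1.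
  have -> : a * (a + 1) * c = (2 * a + 1) * (2 * a * (a + 1) * r) by rewrite /c; ring.
  by rewrite ar mulr1.
have t1' : 0 <= a * (t + r) by rewrite mulr_ge0//; lra.
have t2' : 0 <= a * (r - t) by rewrite mulr_ge0//; lra.
have ar0 : 0 < a * r by rewrite mulr_gt0//; lra.
clearbody c; split.
(* Multiplying by [a + 1] and using [h1] and [h2] leaves an expression linear in [t]; [x] is
   eliminated by x^2 + t^2 <= r^2. *)
- have key : (a + 1) * (2 * (t + c) - a * (r ^+ 2 + 2 * t * c + c ^+ 2)) =
      - 2 * (a * t) + c - r / 2.
    transitivity (2 * (a + 1) * (t + c) - r * (a * (a + 1) * r) -
        2 * t * (a * (a + 1) * c) - c * (a * (a + 1) * c)); first by ring.
    by rewrite h1 h2; field.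
  have : 0 < 2 * (t + c) - a * (r ^+ 2 + 2 * t * c + c ^+ 2).
    by rewrite -(@pmulr_rgt0 _ (a + 1)) ?key; lra.
  have : a * (x ^+ 2 + (t + c) ^+ 2) <= a * (r ^+ 2 + 2 * t * c + c ^+ 2).
    apply: ler_wpM2l; first by lra.
    have -> : (t + c) ^+ 2 = t ^+ 2 + 2 * t * c + c ^+ 2 by ring.
    lra.
  lra.
- have key : a * ((a + 1) * (2 * t * c + c ^+ 2) - 2 * (t + c)) =
      2 * (a * t) + 2 * t + c.
    transitivity (2 * t * (a * (a + 1) * c) + c * (a * (a + 1) * c) - 2 * a * (t + c));
      first by ring.
    by rewrite h2; ring.
  have : 0 < (a + 1) * (2 * t * c + c ^+ 2) - 2 * (t + c).
    by rewrite -(@pmulr_rgt0 _ a) ?key; lra.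
  have : (a + 1) * (2 * t * c + c ^+ 2) <= (a + 1) * (x ^+ 2 + (t + c) ^+ 2).
    apply: ler_wpM2l; first by lra.
    have := sqr_ge0 x; have := sqr_ge0 t; rewrite sqrrD; lra.
  lra.
(* Here |x| <= r and y >= c - r = 4 a r + r, while [rE] writes [r] in terms quadratic in [a * r] and
   [r]. *)
have : (4 * (a * r) + r) ^+ 2 <= (t + c) ^+ 2.
  by rewrite ler_pXn2r ?nnegrE//; lra.
have -> : (4 * (a * r) + r) ^+ 2 = 16 * (a * r) ^+ 2 + 8 * (a * r * r) + r * r by ring.
have rE : r = 2 * (a * r) ^+ 2 + 2 * (a * r * r).
  transitivity (2 * r * (a * (a + 1) * r)); first by rewrite h1; field.
  ring.
have := sqr_ge0 x; have : 0 < a * r * r by rewrite mulr_gt0.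
have : 0 < r * r by rewrite mulr_gt0.
by have := sqr_ge0 (a * r); lra.
Qed.

(** Discs of different indices lie in disjoint strips, so the index picked by [height] is [n]. *)
Lemma height_bump n p : bump_disk n p ->
  height p = 1 - euclidean_dist p (bump_center R n) / bump_radius R n.
Proof.
move=> pn; rewrite /height; case: pselect => [ex|]; last by case; exists n.
case: (cid ex) => m pm /=; suff -> : m = n by [].
have [] := bump_disk_bounds pm; have [] := bump_disk_bounds pn.
have := sqnorm_ge0 p; move: (sqnorm p) => S S0 n1 n2 _ m1 m2 _.
have S1 : 0 < S by rewrite lt0r S0 andbT; apply: contraTneq n1 => S0'; rewrite S0' in n2 *; lra.
have lt a b : a%:R * S < (b%:R + 1) * S -> (a <= b)%N.
  by rewrite ltr_pM2r// natr1 ltr_nat ltnS.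
by apply/eqP; rewrite eqn_leq !lt//; [exact: lt_trans n1 m2|exact: lt_trans m1 n2].
Qed.

Lemma height_out p : ~ (exists n, bump_disk n p) -> height p = 0.
Proof. by rewrite /height; case: pselect. Qed.

Lemma height_ge0 p : 0 <= height p.
Proof.
have [[n pn]|/height_out->//] := pselect (exists n, bump_disk n p).
have [n0 pr] := pn; rewrite (height_bump pn) subr_ge0.
by rewrite ler_pdivrMr ?mul1r// bump_radius_gt0.
Qed.

Definition profile q : R := height (inversion q).

(** For [n > 0], the second coordinate of [inversion (bump_center R n)]. *)
Definition profile_center n : R := 2 * n%:R * (n%:R + 1) / (2 * n%:R + 1).

Lemma bump_disk_strip n q : H q -> bump_disk n (inversion q) ->
  [/\ n%:R < q.2, q.2 < n%:R + 1 & `|q.1| < 1].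
Proof.
move=> Hq /bump_disk_bounds; rewrite sqnorm_inversion /inversion /=.
have := sqnorm_gt0 (half_plane_neq0 Hq); move: (sqnorm q) => S S0.
have -> : 2 * (2 * q.2 / S) = q.2 * (4 / S) by ring.
rewrite normrM normfV (gtr0_norm S0) normrM normr_nat.
have -> : 2 * (2 * `|q.1| / S) = `|q.1| * (4 / S) by ring.
have S4 : 0 < 4 / S by rewrite divr_gt0.
move=> [h1 h2 h3]; split; rewrite -(ltr_pM2r S4)//.
by rewrite mul1r.
Qed.

Lemma profile_zero q : ~ (exists n, bump_disk n (inversion q)) -> profile q = 0.
Proof. exact: height_out. Qed.

(** At fixed ordinate [v] the squared distance is affine in 1 / sqnorm q, with slope of the sign of
    1 - c v, where [c] is the ordinate of the centre. *)
Lemma sqr_dist_inversion q n : q != o ->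
  euclidean_dist (inversion q) (bump_center R n) ^+ 2 =
  (bump_center R n).2 ^+ 2 + 4 * (1 - (bump_center R n).2 * q.2) / sqnorm q.
Proof.
move=> /sqnorm_gt0 q0; rewrite sqr_euclidean_dist subr0.
move: (bump_center R n).2 => c; move: q0; rewrite /inversion /sqnorm /=.
set S := (X in _ < X) => S0.
have -> : (2 * q.1 / S) ^+ 2 + (2 * q.2 / S - c) ^+ 2 =
  4 * (q.1 ^+ 2 + q.2 ^+ 2) / S ^+ 2 - 4 * c * q.2 / S + c ^+ 2 by field; lra.
by rewrite -/S; field; lra.
Qed.

(** If the farther point lies in the disc, then, the disc missing the origin, the slope above is
    negative; the point nearer to the axis has smaller norm and is thus closer to the centre. *)
Lemma profile_mono u u' v : 1 <= v -> `|u| <= `|u'| -> profile (u', v) <= profile (u, v).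
Proof.
move=> v1 uu'; have [[n pn]|/profile_zero->] := pselect (exists n, bump_disk n (inversion (u', v)));
  last exact: height_ge0.
have Hq : H (u, v) by [].
have Hq' : H (u', v) by [].
have [n0 pr] := pn; have r0 := bump_radius_gt0 n0.
suff le_d : euclidean_dist (inversion (u, v)) (bump_center R n) <=
            euclidean_dist (inversion (u', v)) (bump_center R n).
  have pn' : bump_disk n (inversion (u, v)) by split=> //; exact: le_trans pr.
  rewrite /profile (height_bump pn) (height_bump pn') lerD2l lerN2.
  by rewrite ler_pM2r// invr_gt0.
have pr2 : euclidean_dist (inversion (u', v)) (bump_center R n) ^+ 2 <= bump_radius R n ^+ 2.
  by rewrite ler_pXn2r ?nnegrE ?euclidean_dist_ge0 ?(ltW r0).
rewrite -(@ler_pXn2r _ 2) ?nnegrE ?euclidean_dist_ge0//; move: pr2.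
rewrite !sqr_dist_inversion ?half_plane_neq0//.
have := sqnorm_gt0 (half_plane_neq0 Hq); have := sqnorm_gt0 (half_plane_neq0 Hq').
have : sqnorm (u, v) <= sqnorm (u', v).
  by rewrite /sqnorm lerD2r/= -[u ^+ 2]real_normK ?num_real// -[u' ^+ 2]real_normK ?num_real//
     ler_pXn2r ?nnegrE.
move: (sqnorm (u, v)) (sqnorm (u', v)) => S S' SS S'0 S0 pr2.
have rc : bump_radius R n ^+ 2 < (bump_center R n).2 ^+ 2.
  have n1 : 0 <= n%:R * (bump_radius R n) by rewrite mulr_ge0// ltW.
  rewrite bump_centerE// (_ : _ * (2 * _) =
    4 * (n%:R * bump_radius R n) + 2 * bump_radius R n); last by ring.
  by rewrite ltr_pXn2r ?nnegrE//; lra.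
move: rc pr2; move: ((bump_center R n).2) => c rc pr2.
have neg : 4 * (1 - c * v) / S' < 0 by move: pr2 => /=; lra.
move: neg; rewrite pmulr_llt0 ?invr_gt0//= => neg.
rewrite lerD2l ler_nM2l//.
by rewrite lef_pV2 ?posrE.
Qed.

Lemma profile_axis n v : (0 < n)%N -> 0 < v ->
  euclidean_dist (inversion (0, v)) (bump_center R n) = `|2 / v - (bump_center R n).2|.
Proof.
move=> n0 v0; rewrite /euclidean_dist /inversion /sqnorm /= mulr0 mul0r subr0.
rewrite expr0n add0r add0r sqrtr_sqr.
by congr (`|_ - _|); field; lra.
Qed.

Lemma profile_centerE n : (0 < n)%N -> profile_center n = 2 / (bump_center R n).2.
Proof.
move=> n0; rewrite /profile_center /bump_center /= -[n.+1%:R]natr1.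
have : 1 <= n%:R :> R by rewrite ler1n.
by move: (n%:R : R) => a a1; field; lra.
Qed.

Lemma profile_center_itv n : n%:R <= profile_center n < n.+1%:R.
Proof.
have a0 : 0 <= n%:R :> R by [].
rewrite /profile_center -[n.+1%:R]natr1; move: (n%:R : R) a0 => a a0.
by rewrite ler_pdivlMr ?ltr_pdivrMr; [nra|lra|lra].
Qed.

Lemma bump_center_gt0 n : (0 < n)%N -> 0 < (bump_center R n).2.
Proof. by move=> n0; rewrite /bump_center /= addr_gt0// invr_gt0// ltr0n. Qed.

Lemma profile_nat n : (0 < n)%N -> profile (0, n%:R) <= 0.
Proof.
move=> n0; rewrite profile_zero// => -[m pm].
have Hn : H (0, n%:R) by rewrite /half_plane /= ler1n.
have [/= mn nm _] := bump_disk_strip Hn pm.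
by move: mn nm; rewrite natr1 !ltr_nat => mn nm; lia.
Qed.

Lemma profile_far u v : 1 <= v -> 1 <= `|u| -> profile (u, v) <= 0.
Proof.
move=> v1 u1; rewrite profile_zero// => -[m pm].
have [_ _ /=] := bump_disk_strip (v1 : H (u, v)) pm; lra.
Qed.

Lemma profile_at_center n : (0 < n)%N -> profile (0, profile_center n) = 1.
Proof.
move=> n0; have c0 := bump_center_gt0 n0; have r0 := bump_radius_gt0 n0.
have d0 : euclidean_dist (inversion (0, profile_center n)) (bump_center R n) = 0.
  rewrite profile_axis// profile_centerE ?divr_gt0//.
  move: c0; move: ((bump_center R n).2) => c c0.
  by rewrite (_ : 2 / (2 / c) - c = 0) ?normr0//; field; lra.
have pn : bump_disk n (inversion (0, profile_center n)) by split=> //; rewrite d0 ltW.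
by rewrite /profile (height_bump pn) d0 mul0r subr0.
Qed.

Lemma profile_axis_le n v v' : (0 < n)%N -> n%:R <= v <= n.+1%:R ->
  n%:R <= v' <= n.+1%:R ->
  `|2 / v' - (bump_center R n).2| <= `|2 / v - (bump_center R n).2| ->
  profile (0, v) <= profile (0, v').
Proof.
move=> n0 vn v'n d_le.
have [[m pm]|/profile_zero->] := pselect (exists m, bump_disk m (inversion (0, v)));
  last exact: height_ge0.
have n1 : 1 <= n%:R :> R by rewrite ler1n.
have Hv : H (0, v) by rewrite /half_plane /=; lra.
have mn : m = n.
  have [/= m1 m2 _] := bump_disk_strip Hv pm.
  move: vn; rewrite -natr1 => /andP[vn1 vn2].
  have : (m < n.+1)%N by rewrite -(ltr_nat R) -natr1; lra.
  have : (n < m.+1)%N by rewrite -(ltr_nat R) -natr1; lra.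
  lia.
move: pm; rewrite mn => pn; have [_ pr] := pn.
have dE w : n%:R <= w <= n.+1%:R ->
    euclidean_dist (inversion (0, w)) (bump_center R n) = `|2 / w - (bump_center R n).2|.
  by move=> wn; apply: profile_axis => //; lra.
have pn' : bump_disk n (inversion (0, v')).
  by split=> //; apply: le_trans pr; rewrite !dE.
rewrite /profile (height_bump pn) (height_bump pn') lerD2l lerN2 !dE//.
by rewrite ler_pM2r// invr_gt0 bump_radius_gt0.
Qed.

Lemma profile_incr n v v' : (0 < n)%N -> n%:R <= v -> v <= v' ->
  v' <= profile_center n -> profile (0, v) <= profile (0, v').
Proof.
move=> n0 nv vv' v'c; have /andP[c1 c2] := profile_center_itv n.
apply: (profile_axis_le n0); [lra|lra|].
have n1 : 1 <= n%:R :> R by rewrite ler1n.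
move: v'c; rewrite profile_centerE//; have := bump_center_gt0 n0.
move: ((bump_center R n).2) => c c0 v'c.
have cv' : c <= 2 / v'.
  by rewrite ler_pdivlMr; [move: v'c; rewrite ler_pdivlMr//; lra|lra].
have : 2 / v' <= 2 / v by rewrite ler_pM2l// lef_pV2 ?posrE//; lra.
by move=> ?; rewrite !ger0_norm; lra.
Qed.

Lemma profile_decr n v v' : (0 < n)%N -> profile_center n <= v -> v <= v' ->
  v' <= n.+1%:R -> profile (0, v') <= profile (0, v).
Proof.
move=> n0 cv vv' v'n; have /andP[c1 c2] := profile_center_itv n.
apply: (profile_axis_le n0); [lra|lra|].
have n1 : 1 <= n%:R :> R by rewrite ler1n.
have v0 : 0 < v by lra.
move: cv; rewrite profile_centerE//; have := bump_center_gt0 n0.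
move: ((bump_center R n).2) => c c0 cv.
have cv' : 2 / v <= c.
  by rewrite ler_pdivrMr; [move: cv; rewrite ler_pdivrMr//; lra|lra].
have : 2 / v' <= 2 / v by rewrite ler_pM2l// lef_pV2 ?posrE//; lra.
by move=> ?; rewrite !ler0_norm; lra.
Qed.

(** The bump [n] extended by zero, whose continuity is immediate; the profile is locally a maximum
    of two of these. Index 0 has no bump. *)
Definition cone n q : R := if n is 0 then 0 else
  Num.max 0 (1 - euclidean_dist (inversion q) (bump_center R n) / bump_radius R n).

(** The window (n - 1, n + 1) is a neighbourhood of every ordinate with integer part [n], including
    the border [n] between two strips. *)
Lemma profile_cone n q : (0 < n)%N -> H q -> n.-1%:R < q.2 -> q.2 < n.+1%:R ->
  profile q = Num.max (cone n.-1 q) (cone n q).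
Proof.
move=> n0 Hq nq qn.
have coneE m : (0 < m)%N -> bump_disk m (inversion q) -> cone m q = profile q.
  case: m => // m _ pm; rewrite /profile (height_bump pm) /cone max_r// subr_ge0.
  by rewrite ler_pdivrMr ?mul1r ?bump_radius_gt0//; have [] := pm.
have cone0 m : ~ bump_disk m (inversion q) -> cone m q = 0.
  case: m => // m pm; rewrite /cone max_l// subr_le0.
  rewrite ler_pdivlMr ?mul1r ?bump_radius_gt0// leNgt; apply/negP => /ltW pr.
  by apply: pm.
have cone_ge0 m : 0 <= cone m q by case: m => // m; rewrite /cone le_max lexx.
have [pn|pn] := pselect (bump_disk n (inversion q)).
  rewrite (coneE n)// max_r//.
  have [pn'|pn'] := pselect (bump_disk n.-1 (inversion q)); last by rewrite cone0// height_ge0.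
  by rewrite (coneE n.-1)//; case: pn'.
rewrite (cone0 n)// max_l//.
have [pn'|pn'] := pselect (bump_disk n.-1 (inversion q)).
  by rewrite coneE//; case: pn'.
rewrite cone0// profile_zero// => -[m pm].
have [m1 m2 _] := bump_disk_strip Hq pm.
have : (m < n.+1)%N by rewrite -(ltr_nat R) -natr1; move: qn; rewrite -natr1; lra.
have : (n.-1 < m.+1)%N by rewrite -(ltr_nat R) -natr1; lra.
move=> m3 m4; have [mn|mn] : m = n \/ m = n.-1 by lia.
  by apply: pn; rewrite -mn.
by apply: pn'; rewrite -mn.
Qed.

Lemma cone_cont n q e : H q -> 0 < e ->
  half_plane_nbs q [set y | `|cone n y - cone n q| < e].
Proof.
move=> Hq e0; case: n => [|n]; first by exists 1 => // y _ _; rewrite /= subrr normr0.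
have r0 := bump_radius_gt0 (ltn0Sn n); set r := bump_radius R n.+1 in r0 *.
have [d d0 dP] := inversion_continuous (half_plane_neq0 Hq) (mulr_gt0 e0 r0).
exists d => // y _ /dP yq; rewrite /= /cone -/r.
have := euclidean_dist_lip (inversion q) (inversion y) (bump_center R n.+1).
move: (euclidean_dist (inversion q) _) (euclidean_dist (inversion y) _) => a b ab.
have : `|a / r - b / r| < e.
  rewrite -mulrBl normrM normfV (gtr0_norm r0) ltr_pdivrMr//; lra.
move: (a / r) (b / r) => a' b'; rewrite !ltr_norml => /andP[h1 h2].
by have [k1|k1] := leP 0 (1 - b'); have [k2|k2] := leP 0 (1 - a'); lra.
Qed.

Lemma profile_cont q e : H q -> 0 < e ->
  half_plane_nbs q [set y | `|profile y - profile q| < e].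
Proof.
move=> Hq e0; have q0 : 0 <= q.2 by move: Hq; rewrite /half_plane /=; lra.
have /andP[n1 n2] := truncn_itv q0; set n := Num.truncn q.2 in n1 n2.
have n0 : (0 < n)%N.
  by rewrite lt0n; apply: contraTneq n2 => ->; rewrite -leNgt.
have n1' : n.-1%:R < q.2 by apply: lt_le_trans n1; rewrite ltr_nat; lia.
have := half_plane_nbsI (half_plane_nbs2_gt n1') (half_plane_nbs2_lt n2).
move=> /half_plane_nbsI /(_ (half_plane_nbsI (cone_cont n Hq e0) (cone_cont n.-1 Hq e0))).
move=> /half_plane_nbsI /(_ (half_plane_nbs_half q)).
apply: half_plane_nbsS => y [[[y1 y2] [c1 c2]] Hy]; rewrite /=.
rewrite (profile_cone n0 Hy)// (profile_cone n0 Hq)//.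
move: c1 c2; rewrite /= !ltr_norml => /andP[h1 h2] /andP[h3 h4].
have [k1|k1] := leP (cone n.-1 y) (cone n y);
have [k2|k2] := leP (cone n.-1 q) (cone n q); lra.
Qed.

Lemma profileP : bump_profile profile profile_center.
Proof.
split.
- exact: profile_cont.
- exact: profile_mono.
- exact: profile_far.
- exact: profile_nat.
- exact: profile_center_itv.
- exact: profile_at_center.
- exact: profile_incr.
- exact: profile_decr.
Qed.

End Bumps.

(** * The harmonic archipelago and its model *)

Section Transfer.
Variables (S T : Type) (nbsS : S -> set_system S) (nbsT : T -> set_system T).
Variables (O : set T) (f : S -> T) (g : T -> S).
Hypotheses (nbsT_filter : forall q, Filter (nbsT q))
  (fO : forall x, O (f x)) (gK : forall q, O q -> f (g q) = q) (fK : cancel f g)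
  (f_cont : forall x C, nbsT (f x) C -> nbsS x [set y | C (f y)])
  (f_open : forall x B, nbsS x B -> exists2 C, nbsT (f x) C & forall y, C (f y) -> B y)
  (nbsT_O : forall q, O q -> nbsT q O).

Lemma locally_zero_pull m z : locally_zero nbsT O m z ->
  locally_zero nbsS setT m (fun s => z (map f s)).
Proof.
move=> z0 x _; have [C xC zC] := z0 _ (fO x).
exists [set y | C (f y)]; first exact: f_cont.
by move=> s sm sC; apply: zC; rewrite ?size_map//; exact: inside_map.
Qed.

Lemma locally_zero_push m z : locally_zero nbsS setT m z ->
  locally_zero nbsT O m (fun s => z (map g s)).
Proof.
move=> z0 q Oq; have [B qB zB] := z0 (g q) I; have [C qC CB] := f_open qB.
exists (C `&` O); first by rewrite gK// in qC; apply: filterI => //; exact: nbsT_O.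
move=> s sm sC; apply: zB; rewrite ?size_map//; apply: inside_map => y /sC[Cy Oy].
by apply: CB; rewrite gK.
Qed.

Lemma locally_coboundary_pull m z : locally_coboundary nbsT O m z ->
  locally_coboundary nbsS setT m (fun s => z (map f s)).
Proof.
move=> [b zb]; exists (fun s => b (map f s)).
by apply: locally_zero_ext (locally_zero_pull zb) => s; rewrite delta_map.
Qed.

Lemma push_pull (z : seq S -> int) s : z (map g (map f s)) = z s.
Proof. by rewrite -map_comp (eq_map (g := id)) ?map_id// => x /=; exact: fK. Qed.

Lemma locally_coboundary_push_pull m z :
  locally_coboundary nbsT O m (fun s => z (map g s)) ->
  locally_coboundary nbsS setT m z.
Proof.
move/locally_coboundary_pull; apply: locally_coboundary_ext => s.
exact: push_pull.
Qed.

End Transfer.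

Section HarmonicArchipelagoModel.
Variable R : realType.
Notation P := (R * R)%type.
Notation H := (@half_plane R).
Notation o := ((0, 0) : P).
Notation X := (@model_space R).
Notation nbs := (model_nbs (@profile R)).
Implicit Types (x y : HA R) (p q : P).

Definition base x : P := (val x).1.
Definition plane_coord x : P := inversion (base x).

Lemma base_disk x : sqnorm (base x) <= 2 * (base x).2.
Proof.
have [+ _] := set_mem (valP x).
rewrite /big_disk /= euclidean_dist_le// expr1n /sqnorm /base /=; nra.
Qed.

Lemma heightE x : (val x).2 = profile (plane_coord x).
Proof. by have [_] := set_mem (valP x); rewrite /profile /plane_coord inversionK. Qed.

Lemma coord_inj : injective plane_coord.
Proof.
move=> x y xy; apply: val_inj.
have bxy : base x = base y by rewrite -(inversionK (base x)) -/(plane_coord x) xy inversionK.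
by rewrite (surjective_pairing (val x)) (surjective_pairing (val y)) !heightE xy -/(base x) bxy.
Qed.

Lemma coord_model x : X (plane_coord x).
Proof.
have := base_disk x; rewrite /plane_coord; move: (base x) => p.
have [->|p0] := eqVneq p o; first by rewrite inversion0; left.
move=> pD; right; rewrite /half_plane /inversion /=.
by rewrite ler_pdivlMr ?mul1r// sqnorm_gt0.
Qed.

Lemma coord_surj q : X q -> exists x, plane_coord x = q.
Proof.
move=> Xq.
have qHA : harmonic_archipelago (inversion q, height (inversion q)).
  split=> //; rewrite /big_disk /= euclidean_dist_le// expr1n.
  suff : sqnorm (inversion q) <= 2 * (inversion q).2 by rewrite /sqnorm /=; nra.
  case: Xq => [->|Hq]; first by rewrite inversion0 /sqnorm /=; lra.
  have q0 := sqnorm_gt0 (half_plane_neq0 Hq).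
  rewrite sqnorm_inversion /inversion /= mulrA ler_pM2r ?invr_gt0//.
  by move: Hq; rewrite /half_plane /=; lra.
exists (SigSub (mem_set qHA) : HA R); rewrite /plane_coord /base /=; exact: inversionK.
Qed.

Definition origin : HA R := sval (cid (coord_surj (or_introl erefl : X o))).

Definition point q : HA R := xget origin [set x | plane_coord x = q].

Lemma pointK q : X q -> plane_coord (point q) = q.
Proof.
by move=> /coord_surj[x xq]; rewrite /point; case: xgetP => // /(_ x).
Qed.

Lemma coordK : cancel plane_coord point.
Proof. by move=> x; apply: coord_inj; rewrite pointK//; exact: coord_model. Qed.

Definition HA_dist x y : R := dist (base x) (base y) + `|(val x).2 - (val y).2|.

Lemma HA_nbhsP x (B : set (HA R)) : nbhs x B <->
  exists2 e, 0 < e & forall y, HA_dist x y < e -> B y.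
Proof.
split=> [|[e e0 eB]].
  rewrite nbhsE => -[U [[V Vo VU] Ux] UB].
  have Vx : nbhs (val x) V.
    by apply: open_nbhs_nbhs; split=> //; move: Ux; rewrite -VU.
  have [e /= e0 eV] := (nbhs_ballP (val x) _).1 Vx.
  exists e => // y xy; apply: UB; rewrite -VU; apply: eV; move: xy.
  rewrite /HA_dist /dist /base.
  have := normr_ge0 ((val x).1.1 - (val y).1.1).
  have := normr_ge0 ((val x).1.2 - (val y).1.2).
  have := normr_ge0 ((val x).2 - (val y).2).
  by split; [split|]; rewrite /= -ball_normE /=; lra.
have e3 : 0 < e / 3 by rewrite divr_gt0.
have xB : nbhs (val x) (ball (val x) (e / 3)) by exact: nbhsx_ballx.
have xB' : nbhs x [set y | ball (val x) (e / 3) (val y)].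
  exact: (@initial_continuous _ _ (@set_val _ (@harmonic_archipelago R)) x _ xB).
apply: filterS xB' => y /= [[+ +] +]; rewrite -!ball_normE /= => y1 y2 y3.
by apply: eB; rewrite /HA_dist /dist /base; lra.
Qed.

Lemma coord_nbs x C : nbs (plane_coord x) C -> nbhs x [set y | C (plane_coord y)].
Proof.
move=> xC; apply/HA_nbhsP; have [x0|Hx] := coord_model x; last first.
  rewrite model_nbsH// in xC; have [e e0 eC] := xC.
  have p0 : base x != o.
    apply/eqP => p0; have /eqP := half_plane_neq0 Hx; apply.
    by rewrite /plane_coord p0 inversion0.
  have [d d0 dP] := inversion_continuous p0 e0.
  have p1 : 0 < dist (base x) o.
    rewrite lt0r dist_ge0 andbT; apply: contra_neq p0.
    rewrite /dist /= => /eqP; rewrite paddr_eq0// !normr_eq0 !subr0 => /andP[/eqP a /eqP b].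
    by rewrite (surjective_pairing (base x)) a b.
  exists (Num.min d (dist (base x) o)); first by rewrite lt_min d0.
  move=> y; rewrite lt_min /HA_dist => /andP[yd y0].
  have h0 := normr_ge0 ((val x).2 - (val y).2).
  apply: eC; last by apply: dP; lra.
  case: (coord_model y) => // yo; exfalso.
  have : base y = o by rewrite -(inversionK (base y)) -/(plane_coord y) yo inversion0.
  by move=> by0; move: y0; rewrite by0; lra.
rewrite x0 in xC *; have /model_nbso[k kC] := xC.
have bx : base x = o by rewrite -(inversionK (base x)) -/(plane_coord x) x0 inversion0.
have l0 : 0 < level R k by exact: level_gt0.
exists (level R k) => // y; rewrite /HA_dist bx !heightE x0.
have -> : profile o = 0.
  apply: profile_zero => -[n]; rewrite inversion0 => /bump_disk_bounds[_ _].
  by rewrite /sqnorm /= normr0; lra.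
rewrite sub0r normrN => xy; apply: kC.
have [yo|Hy] := coord_model y; [by left|right].
have y1 : `|(base y).1| < level R k.
  move: xy; rewrite /dist /= sub0r normrN; have := normr_ge0 (0 - (base y).2).
  by have := normr_ge0 (profile (plane_coord y)); lra.
have y2 : `|(base y).2| < level R k.
  move: xy; rewrite /dist /= !sub0r !normrN; have := normr_ge0 (base y).1.
  by have := normr_ge0 (profile (plane_coord y)); lra.
have y3 : profile (plane_coord y) < level R k.
  apply: le_lt_trans (ler_norm _) _; move: xy; have := dist_ge0 o (base y); lra.
split=> //.
have q0 := sqnorm_gt0 (half_plane_neq0 Hy).
have SS : sqnorm (plane_coord y) * sqnorm (base y) = 4.
  have := sqnorm_inversion (plane_coord y); rewrite /plane_coord inversionK => ->.
  by field; move: q0; rewrite /plane_coord; lra.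
have S1 : sqnorm (base y) < 2 * level R k ^+ 2.
  rewrite /sqnorm -[(base y).1 ^+ 2]real_normK ?num_real// -[(base y).2 ^+ 2]real_normK ?num_real//.
  have : `|(base y).1| ^+ 2 < level R k ^+ 2 by rewrite ltr_pXn2r ?nnegrE// ltW.
  have : `|(base y).2| ^+ 2 < level R k ^+ 2 by rewrite ltr_pXn2r ?nnegrE// ltW.
  lra.
(* If both coordinates were at most [k], their [sqnorm] would be at most 2 k^2; with [S1] this
   contradicts [SS], by which the two squared norms have product 4. *)
have [|k2] := ltP k%:R (plane_coord y).2; [by left|right].
rewrite ltNge; apply/negP => k1.
have kk : sqnorm (plane_coord y) <= 2 * k%:R ^+ 2.
  rewrite /sqnorm -[(plane_coord y).1 ^+ 2]real_normK ?num_real//.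
  have : `|(plane_coord y).1| ^+ 2 <= k%:R ^+ 2 by rewrite ler_pXn2r ?nnegrE.
  have : (plane_coord y).2 ^+ 2 <= k%:R ^+ 2.
    by rewrite ler_pXn2r ?nnegrE//; move: Hy; rewrite /half_plane /=; lra.
  lra.
have k0 : 0 <= k%:R :> R by [].
have lk : level R k * k%:R <= 1.
  by rewrite /level mulrC ler_pdivrMr// mul1r ler_nat.
have : (level R k * k%:R) ^+ 2 <= 1 by rewrite expr_le1// mulr_ge0// ltW.
rewrite exprMn; move: (sqnorm_ge0 (base y)) S1 SS kk q0.
move: (sqnorm (base y)) (sqnorm (plane_coord y)) (level R k ^+ 2) (k%:R ^+ 2 : R).
move=> a b c d a0 ac ba bd b0 cd.
have : b * a < b * (2 * c) by rewrite ltr_pM2l.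
have : b * (2 * c) <= 2 * d * (2 * c) by apply: ler_wpM2r => //; lra.
lra.
Qed.

Lemma nbs_coord x (B : set (HA R)) : nbhs x B ->
  exists2 C, nbs (plane_coord x) C & forall y, C (plane_coord y) -> B y.
Proof.
move=> /HA_nbhsP[e e0 eB]; have e2 : 0 < e / 2 by rewrite divr_gt0.
have [x0|Hx] := coord_model x; last first.
  have [d d0 dP] := inversion_continuous (half_plane_neq0 Hx) e2.
  exists [set q | dist (plane_coord x) q < d /\ `|profile q - profile (plane_coord x)| < e / 2].
    rewrite model_nbsH//; apply: half_plane_nbsI; last exact: profile_cont.
    by exists d.
  move=> y [/dP]; rewrite /plane_coord !inversionK -/(plane_coord x) -/(plane_coord y) => xy h.
  by apply: eB; rewrite /HA_dist !heightE distrC; lra.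
have bx : base x = o by rewrite -(inversionK (base x)) -/(plane_coord x) x0 inversion0.
have po : profile o = 0.
  apply: profile_zero => -[n]; rewrite inversion0 => /bump_disk_bounds[_ _].
  by rewrite /sqnorm /= normr0; lra.
(* A point q of norm above k > 8 / e has a base point of norm 2 / |q| < e / 4, and the level bounds
   its height by e / 8. *)
pose k := Num.bound (8 / e).
have ke : 8 < k%:R * e by rewrite -ltr_pdivrMr// archi_boundP// divr_ge0// ltW.
have k0 : 0 < k%:R :> R by rewrite -(pmulr_lgt0 _ e0); lra.
exists (end_nbhd (@profile R) k); first by rewrite x0; apply/model_nbso; exists k.
move=> y [yo|[Hy y_far y_low]].
  by apply: eB; rewrite /HA_dist (coord_inj (etrans x0 (esym yo))) subrr normr0 distpp addr0.
apply: eB; rewrite /HA_dist bx !heightE x0 po sub0r normrN.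
have q0 := sqnorm_gt0 (half_plane_neq0 Hy).
have y3 : `|profile (plane_coord y)| < e / 8.
  rewrite ger0_norm; last exact: height_ge0.
  apply: (lt_le_trans y_low); rewrite /level invf_ple ?posrE ?divr_gt0//.
  by rewrite invf_div -natr1 ler_pdivrMr//; lra.
have kk : k%:R ^+ 2 < sqnorm (plane_coord y).
  rewrite /sqnorm -[(plane_coord y).1 ^+ 2]real_normK ?num_real//.
  have [h|h] := y_far.
    have : k%:R ^+ 2 < (plane_coord y).2 ^+ 2.
      by rewrite ltr_pXn2r ?nnegrE//; move: Hy; rewrite /half_plane /=; lra.
    by have := sqr_ge0 `|(plane_coord y).1|; lra.
  have : k%:R ^+ 2 < `|(plane_coord y).1| ^+ 2 by rewrite ltr_pXn2r ?nnegrE// ltW.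
  by have := sqr_ge0 (plane_coord y).2; lra.
have SE : sqnorm (base y) = 4 / sqnorm (plane_coord y).
  by rewrite -sqnorm_inversion /plane_coord inversionK.
have S_lt : sqnorm (base y) < (e / 4) ^+ 2.
  rewrite SE ltr_pdivrMr//.
  apply: (@lt_trans _ _ ((e / 4) ^+ 2 * k%:R ^+ 2)); last first.
    by rewrite ltr_pM2l// exprn_gt0// divr_gt0.
  rewrite -exprMn (_ : 4 = 2 ^+ 2); last by ring.
  by rewrite ltr_pXn2r ?nnegrE//; lra.
have y1 : `|(base y).1| < e / 4.
  rewrite -(@ltr_pXn2r _ 2) ?nnegrE// ?real_normK ?num_real//; last by lra.
  by apply: le_lt_trans S_lt; rewrite /sqnorm lerDl sqr_ge0.
have y2 : `|(base y).2| < e / 4.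
  rewrite -(@ltr_pXn2r _ 2) ?nnegrE// ?real_normK ?num_real//; last by lra.
  by apply: le_lt_trans S_lt; rewrite /sqnorm lerDr sqr_ge0.
by rewrite /dist /= !sub0r !normrN; lra.
Qed.

Lemma model_nbs_model q : X q -> nbs q X.
Proof.
case=> [->|Hq]; last by rewrite model_nbsH//; exists 1 => // y Hy _; right.
apply/model_nbso; exists 0%N => y [->|[Hy _ _]]; [by left|by right].
Qed.

Let nbsF := @model_nbs_filter R (@profile R).
Let pull := @locally_coboundary_pull _ _ _ _ _ _ coord_model coord_nbs.
Let push_pull := @locally_coboundary_push_pull _ _ _ _ _ _ _ coord_model coordK coord_nbs.
Let push_zero := @locally_zero_push _ _ _ _ _ _ _ nbsF pointK nbs_coord model_nbs_model.

Notation locz := (locally_zero (@nbhs (HA R) (HA R))).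
Notation loccob := (locally_coboundary (@nbhs (HA R) (HA R))).

Lemma push_cocycle m z : locz setT m (delta z) ->
  locally_zero nbs X m (delta (fun s => z (map point s))).
Proof. by move=> /push_zero; apply: locally_zero_ext => s; rewrite delta_map. Qed.

Lemma HA_degree1 z : locz setT 3 (delta z) -> loccob setT 2 z.
Proof. by move=> /push_cocycle /(model_degree1 (profileP R)); exact: push_pull. Qed.

Lemma HA_high_degree z m : locz setT m.+4.+1 (delta z) -> loccob setT m.+4 z.
Proof. by move=> /push_cocycle /(model_high_degree (profileP R)); exact: push_pull. Qed.

Definition HA_cocycle (s : nat -> int) (l : seq (HA R)) : int :=
  bump_cocycle (@profile R) (@profile_center R) s (map plane_coord l).

Lemma HA_cocycleP x : exists2 B : set (HA R), nbhs x B &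
  forall s l, size l = 4 -> inside B l -> delta (HA_cocycle s) l = 0.
Proof.
have [C xC CP] := bump_cocycleP (profileP R) (coord_model x).
exists [set y | C (plane_coord y)]; first exact: coord_nbs.
move=> s l l4 lC; rewrite delta_map; apply: CP; rewrite ?size_map//.
exact: inside_map.
Qed.

Lemma HA_degree2 z : locz setT 4 (delta z) ->
  exists s, loccob setT 3 (fun l => z l - HA_cocycle s l).
Proof.
move=> /push_cocycle /(model_degree2 (profileP R))[s /pull zs]; exists s.
apply: locally_coboundary_ext zs => l; congr (_ - _).
by rewrite -map_comp (eq_map (g := id)) ?map_id// => x /=; exact: coordK.
Qed.

Lemma HA_cocycle_trivial s k c : (forall n, (k <= n)%N -> s n = c) ->
  loccob setT 3 (HA_cocycle s).
Proof. by move=> /(bump_cocycle_trivial (profileP R)); exact: pull. Qed.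

Lemma HA_cocycle_nontrivial s : loccob setT 3 (HA_cocycle s) ->
  exists k c, forall n, (k < n)%N -> s n = c.
Proof.
move=> [b gb]; apply: (bump_cocycle_nontrivial (profileP R)).
exists (fun l => b (map point l)) => q Xq; have [C qC CP] := push_zero gb Xq.
exists (C `&` X); first by apply: filterI => //; exact: model_nbs_model.
move=> l l3 lC; rewrite -[RHS](CP l)// => [|y /lC[]//].
rewrite delta_map /HA_cocycle -map_comp; congr (bump_cocycle _ _ _ _ - _).
elim: l lC {l3} => //= y l IHl lC; rewrite pointK -?IHl//.
  by move=> w wl; apply: lC; right.
by have [] := lC y (or_introl erefl).
Qed.

End HarmonicArchipelagoModel.

(** * Simplicial cochains as cochains on lists *)

Definition vertex_list (V : Type) n (v : 'I_n -> V) : seq V :=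
  [seq v i | i <- enum 'I_n].

Lemma size_vertex_list (V : Type) n (v : 'I_n -> V) : size (vertex_list v) = n.
Proof. by rewrite size_map size_enum_ord. Qed.

Lemma vertex_list0 (V : Type) (v : 'I_0 -> V) : vertex_list v = [::].
Proof. exact/size0nil/size_vertex_list. Qed.

Lemma vertex_listS (V : Type) n (v : 'I_n.+1 -> V) :
  vertex_list v = v ord0 :: vertex_list (v \o lift ord0).
Proof. by rewrite /vertex_list enum_ordSl /= -map_comp. Qed.

Lemma nth_vertex_list (V : Type) x0 n (v : 'I_n -> V) (i : 'I_n) : nth x0 (vertex_list v) i = v i.
Proof.
rewrite (nth_map i) ?size_enum_ord//; congr v; exact: nth_ord_enum.
Qed.

Lemma map_vertex_list (V W : Type) (f : V -> W) n (v : 'I_n -> V) :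
  map f (vertex_list v) = vertex_list (f \o v).
Proof. by rewrite /vertex_list -map_comp. Qed.

Lemma vertex_list_nth (V : Type) x0 n (s : seq V) : size s = n ->
  vertex_list (fun i : 'I_n => nth x0 s i) = s.
Proof.
move=> sn; apply: (@eq_from_nth _ x0); rewrite size_vertex_list// => i i_n.
by rewrite (nth_vertex_list x0 _ (Ordinal i_n)).
Qed.

Lemma In_vertex_list (V : Type) n (v : 'I_n -> V) x :
  List.In x (vertex_list v) <-> exists i, v i = x.
Proof.
elim: n v x => [|n IHn] v x; first by rewrite vertex_list0; split=> // -[[]].
rewrite vertex_listS /=; split=> [[<-|/IHn[i <-]]|[i <-]].
- by exists ord0.
- by exists (lift ord0 i).
- by case: (unliftP ord0 i) => [j ->|->]; [right; apply/IHn; exists j|left].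
Qed.

Lemma delta_vertex_list (V : Type) (f : seq V -> int) n (v : 'I_n.+1 -> V) :
  delta f (vertex_list v) =
  \sum_(i < n.+1) f (vertex_list (v \o lift i)) *~ ((-1) ^+ i).
Proof.
elim: n v f => [|n IHn] v f; rewrite vertex_listS big_ord_recl expr0 mulr1z /=.
  rewrite !vertex_list0 big_ord0 /=; lia.
rewrite IHn; congr (_ + _); rewrite -sumrN; apply: eq_bigr => i _.
rewrite [in RHS]vertex_listS /= exprS mulN1r mulrNz; congr (- (f (_ :: _) *~ _)).
  by congr v; apply: val_inj; rewrite /= /bump.
congr vertex_list; apply/funext => j /=; congr v; apply: val_inj => /=.
by rewrite /bump !leq_add2l addnCA.
Qed.

Section ExtendedCochains.
Variables (V : Type) (v0 : V) (K : simplicial_complex V).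

Definition list_cochain n (c : cochain K int n) (s : seq V) : int :=
  if pselect (simplex K (range (fun i : 'I_n.+1 => nth v0 s i))) is left Ks
  then c (OrderedSimplex Ks) else 0.

Lemma list_cochainE n (c : cochain K int n) (v : ordered_simplex K n) :
  list_cochain c (vertex_list v) = c v.
Proof.
have vE : (fun i : 'I_n.+1 => nth v0 (vertex_list v) i) = v.
  by apply/funext => i; exact: nth_vertex_list.
rewrite /list_cochain; case: pselect => [Kv|[]].
  by congr c; exact: ordered_simplex_eq.
by rewrite vE; exact: range_vertices.
Qed.

Lemma list_cochainB n (b c : cochain K int n) s :
  list_cochain (b - c) s = list_cochain b s - list_cochain c s.
Proof. by rewrite /list_cochain; case: pselect => // _; rewrite subrr. Qed.

Lemma list_cochain_delta n (c : cochain K int n) (v : ordered_simplex K n.+1) :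
  delta (list_cochain c) (vertex_list v) = coboundary c v.
Proof.
rewrite delta_vertex_list; apply: eq_bigr => i _.
by rewrite -(list_cochainE c (reindex_simplex (lift i) v)).
Qed.

Lemma list_simplex n s : size s = n.+1 -> simplex K [set x | List.In x s] ->
  exists v : ordered_simplex K n, s = vertex_list v.
Proof.
move=> sn Ks.
have sE := vertex_list_nth v0 sn.
have Kv : simplex K (range (fun i : 'I_n.+1 => nth v0 s i)).
  suff -> : range (fun i : 'I_n.+1 => nth v0 s i) = [set x | List.In x s] by [].
  have sP x := In_vertex_list (fun i : 'I_n.+1 => nth v0 s i) x.
  rewrite sE in sP; apply/seteqP; split=> [x [i _ xi]|x /sP[i xi]]; last by exists i.
  by apply/sP; exists i.
by exists (OrderedSimplex Kv); rewrite -[LHS]sE.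
Qed.

Lemma list_cochain_cocycle n (c : cochain K int n) s : coboundary c = 0 ->
  size s = n.+2 -> simplex K [set x | List.In x s] -> delta (list_cochain c) s = 0.
Proof.
by move=> dc sn Ks; have [v ->] := list_simplex sn Ks; rewrite list_cochain_delta dc.
Qed.

End ExtendedCochains.

Lemma list_cochain_pullback (V W : Type) (v0 : V) (w0 : W) (K : simplicial_complex V)
    (L : simplicial_complex W) (r : W -> V)
    (rP : simplicial_map L K r) n (c : cochain K int n) (s : seq W) :
  size s = n.+1 -> simplex L [set x | List.In x s] ->
  list_cochain w0 (pullback rP c) s = list_cochain v0 c (map r s).
Proof.
move=> sn Ls; have [v ->] := list_simplex w0 sn Ls.
rewrite list_cochainE map_vertex_list.
exact/esym/(list_cochainE v0 c (pushforward rP v)).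
Qed.

Section AlternatingPairs.
Variables (V : Type) (K : simplicial_complex V) (g : V -> V -> int).
Hypothesis gN : forall x y, g y x = - g x y.

Lemma alternating_pairs :
  alternating (fun v : ordered_simplex K 1 => g (v ord0) (v ord_max)).
Proof.
have gxx x : g x x = 0 by have := gN x x; lia.
split=> [s v|v v_deg].
  have [s0|s1] : (s ord0 = ord0 /\ s ord_max = ord_max /\ s = 1%g) \/
      (s ord0 = ord_max /\ s ord_max = ord0 /\ s = tperm ord0 ord_max).
    have ordP (i : 'I_2) : i = ord0 \/ i = ord_max.
      by case: i => [[|[|//]] i2]; [left|right]; apply: val_inj.
    have s01 : s ord0 != s ord_max by rewrite (inj_eq perm_inj).
    have [e0|e0] := ordP (s ord0); have [e1|e1] := ordP (s ord_max).
    - by rewrite e0 e1 in s01.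
    - left; do 2!split=> //; apply/permP => i; rewrite perm1.
      by have [->|->] := ordP i.
    - right; do 2!split=> //; apply/permP => i.
      by have [->|->] := ordP i; rewrite ?tpermL ?tpermR.
    - by rewrite e0 e1 in s01.
  - have [e0 [e1 ->]] := s0; rewrite odd_perm1 expr0 mulr1z /=.
    by rewrite !perm1.
  - have [e0 [e1 ->]] := s1; rewrite odd_tperm /= expr1 mulrN1z.
    by rewrite tpermL tpermR gN.
suff -> : v ord0 = v ord_max by exact: gxx.
apply: contrapT => v01; apply: v_deg => i j.
case: i => [[|[|//]] i2]; case: j => [[|[|//]] j2] vij; apply: val_inj => //=;
  exfalso; apply: v01.
- by move: vij; congr (_ = _); congr (v _); apply: val_inj.
- by symmetry; move: vij; congr (_ = _); congr (v _); apply: val_inj.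
Qed.

End AlternatingPairs.

(** * Quotients and direct limits *)

Section ZmodQuotients.
Variables (A : zmodType) (I : zmodClosed A).
Implicit Types x y : A.

Definition quot_class x : Quotient.quot I := (\pi_(Quotient.quot I) x)%qT.

Lemma quot_classB x y : quot_class (x - y) = quot_class x - quot_class y.
Proof. by rewrite /quot_class Quotient.pi_add Quotient.pi_opp. Qed.

Lemma quot_class_eq x y : quot_class x = quot_class y <-> x - y \in I.
Proof. by rewrite Quotient.idealrBE; split=> [/eqP|/eqP]. Qed.

Lemma quot_class0 : quot_class 0 = 0.
Proof. by rewrite -[X in quot_class X](subrr 0) quot_classB subrr. Qed.

Lemma quot_class_eq0 x : quot_class x = 0 <-> x \in I.
Proof. by rewrite -quot_class0 quot_class_eq subr0. Qed.

Lemma quot_classK (q : Quotient.quot I) : quot_class (repr q) = q.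
Proof. exact: reprK. Qed.

Lemma repr_quot_class x : repr (quot_class x) - x \in I.
Proof. by apply/quot_class_eq; rewrite quot_classK. Qed.

End ZmodQuotients.

Section DirectLimitClasses.
Variables (I : eqType) (G : I -> zmodType) (T : forall i j, set (G i -> G j)).
Implicit Types (i j : I) (x y : direct_sum G).

Lemma direct_sum_valB x y i : direct_sum_val (x - y) i = direct_sum_val x i - direct_sum_val y i.
Proof. by []. Qed.

Lemma direct_sum_inj_same i (x : G i) : direct_sum_val (direct_sum_inj x) i = x.
Proof. by rewrite /direct_sum_inj /= dfwithin. Qed.

Lemma direct_sum_inj_other i j (x : G i) : i != j -> direct_sum_val (direct_sum_inj x) j = 0.
Proof. by move=> ij; rewrite /direct_sum_inj /= dfwithout. Qed.

Lemma direct_sum_ext x y : (forall i, direct_sum_val x i = direct_sum_val y i) -> x = y.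
Proof. by move=> xy; apply: val_inj; apply: functional_extensionality_dep. Qed.

Lemma direct_sum_injB i (x y : G i) :
  direct_sum_inj (x - y) = direct_sum_inj x - direct_sum_inj y.
Proof.
apply: direct_sum_ext => j; rewrite direct_sum_valB.
have [<-|ij] := eqVneq i j; first by rewrite !direct_sum_inj_same.
by rewrite !direct_sum_inj_other// subrr.
Qed.

Lemma direct_sum_ind (Q : direct_sum G -> Prop) :
  (forall x y, Q x -> Q y -> Q (x - y)) ->
  (forall i (x : G i), Q (direct_sum_inj x)) -> Q 0 -> forall x, Q x.
Proof.
move=> QB Qinj Q0 x.
have /asboolP/finite_seqP[l xl] : (x : direct_product G) \in @finitely_supported I G.
  by case: x.
have {}xl i : direct_sum_val x i != 0 -> i \in l by move=> xi; have : [set` l] i by rewrite -xl.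
elim: l x xl => [|i l IHl] x xl.
  suff -> : x = 0 by [].
  by apply: direct_sum_ext => i; apply/eqP; apply: contraT => /xl.
have -> : x = (x - direct_sum_inj (direct_sum_val x i)) - (0 - direct_sum_inj (direct_sum_val x i)).
  by rewrite sub0r opprK subrK.
apply: (QB); last by apply: (QB).
apply: IHl => j; rewrite direct_sum_valB.
have [<-|ij] := eqVneq i j; first by rewrite direct_sum_inj_same subrr eqxx.
rewrite direct_sum_inj_other// subr0 => /xl; rewrite inE => /predU1P[ji|//].
by rewrite ji eqxx in ij.
Qed.

Definition limit_class i (x : G i) : direct_limit T :=
  quot_class (@limit_relations I G T) (direct_sum_inj x).

Lemma limit_classB i (x y : G i) : limit_class (x - y) = limit_class x - limit_class y.
Proof. by rewrite /limit_class direct_sum_injB quot_classB. Qed.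

Lemma limit_class0 i : limit_class (0 : G i) = 0.
Proof. by rewrite -[X in limit_class X](subrr 0) limit_classB subrr. Qed.

Lemma limit_class_transition i j (t : G i -> G j) (x : G i) : T t ->
  limit_class (t x) = limit_class x.
Proof.
move=> Tt; apply/esym/quot_class_eq/asboolP => S [_]; apply.
by exists i, j, t, x.
Qed.

Lemma limit_class_ind (Q : direct_limit T -> Prop) :
  (forall a b, Q a -> Q b -> Q (a - b)) ->
  (forall i (x : G i), Q (limit_class x)) -> Q 0 -> forall a, Q a.
Proof.
move=> QB Qcl Q0 a; rewrite -(quot_classK a); move: (repr a).
apply: direct_sum_ind => //; last by rewrite quot_class0.
by move=> x y; rewrite quot_classB; exact: QB.
Qed.

End DirectLimitClasses.

Section CohomologyClasses.
Variables (V : Type) (K : simplicial_complex V) (n : nat).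

Lemma cohomology_classB (y z : cocycle K int n) :
  cohomology_class (y - z) = cohomology_class y - cohomology_class z.
Proof. exact: quot_classB. Qed.

Lemma cohomology_class_eq0 (z : cocycle K int n) :
  cohomology_class z = 0 <-> z \in @is_coboundary _ K int n.
Proof. exact: quot_class_eq0. Qed.

Lemma cohomology_classK (x : cohomology K int n) : cohomology_class (repr x) = x.
Proof. exact: quot_classK. Qed.

Lemma repr_cohomology_class (z : cocycle K int n) :
  repr (cohomology_class z) - z \in @is_coboundary _ K int n.
Proof. exact: repr_quot_class. Qed.

End CohomologyClasses.

Lemma is_coboundaryS (V : Type) (K : simplicial_complex V) n (z : cocycle K int n.+1) :
  z \in @is_coboundary _ K int n.+1 -> exists b : cochain K int n, coboundary b = z.
Proof. by move=> /asboolP[b _ bz]; exists b. Qed.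

(** * Cech cohomology of metric spaces by germs of cochains *)

Lemma open_coverP (T : topologicalType) (U : open_cover T) :
  (forall B, val U B -> open B) /\ (forall x, exists2 B, val U B & B x).
Proof.
have [Uo UT] := set_mem (valP U); split=> // x.
by have : [set: T] x by []; rewrite -UT => -[B UB Bx]; exists B.
Qed.

Lemma exists_open_cover (T : topologicalType) (W : set (set T)) :
  (forall B, W B -> open B) -> (forall x, exists2 B, W B & B x) ->
  exists U : open_cover T, val U = W.
Proof.
move=> Wo WT; have Wc : open_cover T W.
  by split=> //; apply/seteqP; split=> // x _; have [B WB Bx] := WT x; exists B.
by exists (SigSub (mem_set Wc)).
Qed.

Lemma nerve_list (T : Type) (U : set (set T)) (x : T) (s : seq (set T)) : s <> [::] ->
  (forall B, List.In B s -> U B /\ B x) -> simplex (nerve U) [set B | List.In B s].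
Proof.
move=> s0 sx; split.
- by move=> B /sx[].
- elim: s {s0 sx} => [|A s IHs]; first by apply: sub_finite_set (finite_set0 _).
  apply: (@sub_finite_set _ _ ([set A] `|` [set B | List.In B s])).
    by move=> B /= [->|]; [left|right].
  by rewrite finite_setU; split; [exact: finite_set1|].
- by case: s s0 {sx} => // A s _; exists A; left.
- by exists x => B /sx[].
Qed.

Section MetricCovers.
Variables (R : realType) (T : topologicalType) (d : T -> T -> R).
Hypotheses (dxx : forall x, d x x = 0) (dC : forall x y, d x y = d y x)
  (d_triangle : forall y x z, d x z <= d x y + d y z)
  (nbhs_d : forall x (B : set T), nbhs x B <->
     exists2 e, 0 < e & forall y, d x y < e -> B y).
Implicit Types (x y : T) (U W : open_cover T).

(** Metric spaces are fully normal: every open cover has an open barycentric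
    refinement, here presented by a choice of a member of the cover at each point. *)
Lemma barycentric_choice U : exists c : T -> set T, (forall x, val U (c x)) /\
  forall y, exists2 O, nbhs y O & forall x, O x -> O `<=` c x.
Proof.
have [Uo UT] := open_coverP U.
pose radii x := [set r | 0 < r <= 1 /\ exists2 B, val U B & forall y, d x y < r -> B y].
have radii0 x : radii x !=set0.
  have [B UB Bx] := UT x.
  have /nbhs_d[e e0 eB] : nbhs x B by apply: open_nbhs_nbhs; split=> //; exact: Uo.
  exists (Num.min e 1); split; first by rewrite lt_min e0 ltr01 ge_min lexx orbT.
  by exists B => // y; rewrite lt_min => /andP[/eB].
have radii_sup x : has_sup (radii x) by split=> //; exists 1 => r [/andP[]].
pose rho x := sup (radii x).
have rho_gt0 x : 0 < rho x.
  have [r rx] := radii0 x; have [/andP[r0 _] _] := rx.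
  by apply: lt_le_trans r0 _; apply: ub_le_sup => //; have [] := radii_sup x.
have rho_lip x y : rho x - d x y <= rho y.
  rewrite lerBlDr; apply: ge_sup => // r [/andP[r0 r1] [B UB rB]].
  rewrite -lerBlDr; have [|rd] := leP (r - d x y) 0.
    by move/le_trans; apply; exact/ltW.
  apply: ub_le_sup; first by have [] := radii_sup y.
  have d0 : 0 <= d x y by have := d_triangle y x x; rewrite dxx (dC y x); lra.
  split; first by lra.
  by exists B => // z yz; apply: rB; have := d_triangle y x z; lra.
have /choice[c cP] x : exists B, val U B /\ forall y, d x y < rho x / 2 -> B y.
  have rx : rho x / 2 < sup (radii x) by have := rho_gt0 x; rewrite /rho; lra.
  have [r [_ [B UB rB]] xr] := sup_gt (radii0 x) rx.
  by exists B; split=> // y xy; apply: rB; exact: lt_trans xr.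
exists c; split=> [x|y]; first by have [] := cP x.
(* For [x] this close to [y], [rho x / 2] is at least 7/16 of [rho y], more than the distance rho y
   / 4 that [z] can have from [x]. *)
exists [set x | d y x < rho y / 8].
  by apply/nbhs_d; exists (rho y / 8) => //; have := rho_gt0 y; lra.
move=> x /= yx z /= yz; apply: (cP x).2.
have := rho_lip y x; have := d_triangle y x z; have := rho_gt0 y.
by rewrite (dC x y); lra.
Qed.

Variable x0 : T.

(** This passes from germs to nerves: replacing members of [W] that share a point by their chosen
    points [p B] gives a list inside a single [G]-small set. *)
Lemma fine_cover (G : set (set T)) :
  (forall A B, A `<=` B -> G B -> G A) ->
  (forall x, exists2 B, nbhs x B & G B) ->
  exists W (p : set T -> T), (forall B x, val W B -> B x -> B (p B)) /\
    forall x, exists2 V, G V & forall B, val W B -> B x -> B `<=` V.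
Proof.
move=> G_sub G_loc.
have [U UG] : exists U, val U = [set B | open B /\ G B].
  apply: exists_open_cover => [B []//|x].
  have [B] := G_loc x; rewrite nbhsE => -[O [Oo Ox] OB] GB.
  by exists O => //; split=> //; exact: G_sub GB.
have [c [cU cP]] := barycentric_choice U.
have [W WE] : exists W, val W = [set B | open B /\ forall x, B x -> B `<=` c x].
  apply: exists_open_cover => [B []//|x].
  have [O] := cP x; rewrite nbhsE => -[O' [O'o O'x] O'O] Oc.
  exists O' => //; split=> // y /O'O Oy z /O'O Oz; exact: Oc Oz.
exists W, (fun B => xget x0 B); split=> [B x _ Bx|x].
  exact: (xgetPex x0 (ex_intro _ x Bx)).
exists (c x); first by have := cU x; rewrite UG => -[].
by move=> B; rewrite WE => -[_ Bc] Bx; exact: Bc.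
Qed.

Definition star_choice U : T -> set T := sval (cid (barycentric_choice U)).

Lemma star_choiceU U x : val U (star_choice U x).
Proof. exact: (svalP (cid (barycentric_choice U))).1. Qed.

Lemma star_choiceP U y : exists2 O, nbhs y O &
  forall x, O x -> O `<=` star_choice U x.
Proof. exact: (svalP (cid (barycentric_choice U))).2. Qed.

Notation locz := (locally_zero (@nbhs T T)).
Notation loccob := (locally_coboundary (@nbhs T T)).
Let nbhsF (x : T) : Filter (nbhs x) := nbhs_filter x.

(** The Alexander-Spanier cochain of a cochain on the nerve. *)
Definition spanier U n (c : cochain (nerve (val U)) int n) (s : seq T) : int :=
  list_cochain set0 c (map (star_choice U) s).

Lemma spanierB U n (b c : cochain (nerve (val U)) int n) s :
  spanier (b - c) s = spanier b s - spanier c s.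
Proof. exact: list_cochainB. Qed.

Lemma star_simplex U y O s : nbhs y O -> (forall x, O x -> O `<=` star_choice U x) ->
  s <> [::] -> inside O s ->
  simplex (nerve (val U)) [set B | List.In B (map (star_choice U) s)].
Proof.
move=> yO OU s0 sO; apply: (@nerve_list _ _ y); first by case: s s0 {sO}.
apply: inside_map => x /sO Ox; split; first exact: star_choiceU.
by apply: OU Ox _ (nbhs_singleton yO).
Qed.

Lemma spanier_cocycle U n (c : cochain (nerve (val U)) int n) :
  coboundary c = 0 -> locz setT n.+2 (delta (spanier c)).
Proof.
move=> dc y _; have [O yO OU] := star_choiceP U y; exists O => // s sn sO.
rewrite delta_map; apply: list_cochain_cocycle => //; first by rewrite size_map.
by apply: (star_simplex yO OU) => //; case: s sn {sO}.
Qed.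

Lemma spanier_coboundary U n (b : cochain (nerve (val U)) int n) :
  loccob setT n.+2 (spanier (coboundary b)).
Proof.
exists (spanier b) => y _; have [O yO OU] := star_choiceP U y; exists O => // s sn sO.
have sK : simplex (nerve (val U)) [set B | List.In B (map (star_choice U) s)].
  by apply: (star_simplex yO OU) => //; case: s sn {sO}.
rewrite delta_map /spanier.
have sz : size (map (star_choice U) s) = n.+2 by rewrite size_map.
have [v ->] := list_simplex set0 sz sK.
by rewrite list_cochainE list_cochain_delta subrr.
Qed.

(** Near [y] the members chosen from [U] and the refined members chosen from [W] all contain [y], so
    they span a simplex and the prism between both choices is a homotopy. *)
Lemma spanier_pullback U W r (rP : refinement_map (val U) (val W) r) n
    (c : cochain (nerve (val U)) int n) : coboundary c = 0 ->
  loccob setT n.+1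
    (fun s => spanier (pullback (refinement_map_simplicial rP) c) s - spanier c s).
Proof.
move=> dc; exists (prism (star_choice U) (r \o star_choice W) (list_cochain set0 c)).
move=> y _; have [O yO OU] := star_choiceP U y; have [O' yO' OW] := star_choiceP W y.
exists (O `&` O'); first exact: filterI.
move=> s sn sO; have s0 : s <> [::] by case: s sn {sO}.
have sO1 : inside O s by move=> x /sO[].
have sO2 : inside O' s by move=> x /sO[].
have sK := star_simplex yO' OW s0 sO2.
rewrite {1}/spanier (list_cochain_pullback set0 set0); last by []; last by rewrite size_map.
have := prism_delta (star_choice U) (r \o star_choice W) (list_cochain set0 c) s.
rewrite [X in _ + X]prism_eq0 => [|t tn tP].
  by rewrite addr0 => ->; rewrite map_comp /spanier subrr.
apply: list_cochain_cocycle => //; first by rewrite tn sn.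
apply: (@nerve_list _ _ y); first by case: t tn {tP}.
move=> B /tP[x xs [->|->]].
  split; first exact: star_choiceU.
  by apply: OU (sO1 x xs) _ (nbhs_singleton yO).
have [Ur Wr] := rP _ (star_choiceU W x); split=> //.
by apply: Wr; apply: OW (sO2 x xs) _ (nbhs_singleton yO').
Qed.

(** Evaluating the primitive [b] at chosen points of a fine cover [W] gives a primitive on its
    nerve, for the refinement map [star_choice U \o p]; it need not alternate and is corrected by
    [alternating_primitive]. *)
Lemma spanier_dies U n (z : cocycle (nerve (val U)) int n.+1) :
  loccob setT n.+2 (spanier z) ->
  exists W r (rP : refinement_map (val U) (val W) r),
    pullback_cocycle (refinement_map_simplicial rP) z \in @is_coboundary _ _ int n.+1.
Proof.
move=> [b zb].
have [||W [p [pW WP]]] := @fine_cover [set B |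
    (forall s, size s = n.+2 -> inside B s -> spanier z s = delta b s) /\
    (forall x, B x -> B `<=` star_choice U x)].
- move=> A B AB [Bz BU]; split=> [s sn sA|x /AB Bx]; last exact: subset_trans AB (BU x Bx).
  by apply: Bz => //; exact: sub_inside sA.
- move=> x; have [B xB Bz] := zb x I; have [O xO OU] := star_choiceP U x.
  exists (B `&` O); first exact: filterI.
  split=> [s sn sB|y [_ Oy] w [_ Ow]]; last exact: OU Ow.
  by apply/eqP; rewrite -subr_eq0; apply/eqP/Bz => // y /sB[].
have rP : refinement_map (val U) (val W) (star_choice U \o p).
  move=> B WB; split; first exact: star_choiceU.
  move=> x Bx; have [V [_ VU] BV] := WP x; have BV' := BV B WB Bx.
  by apply: VU (BV' _ (pW _ _ WB Bx)) _ (BV' _ Bx).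
exists W, (star_choice U \o p), rP.
have /asboolP[z_alt _] := cocycleP (pullback_cocycle (refinement_map_simplicial rP) z).
have [b' b'_alt db'] : exists2 b' : cochain (nerve (val W)) int n, alternating b' &
    coboundary b' = pullback (refinement_map_simplicial rP) z.
  apply: (alternating_primitive (b := fun v => b (map p (vertex_list v)))) => //.
  apply/funext => v.
  have [_ _ _ [x vx]] := range_vertices v.
  have vW i : val W (v i) by have [+ _ _ _] := range_vertices v; apply; exists i.
  have [V [Vz _] BV] := WP x.
  transitivity (delta b (map p (vertex_list v))).
    rewrite -delta_map delta_vertex_list; by apply: eq_bigr.
  have sz : size (map p (vertex_list v)) = n.+2 by rewrite size_map size_vertex_list.
  rewrite -Vz//; last first.
    apply: inside_map => B /In_vertex_list[i <-].
    have vix : v i x by apply: vx; exists i.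
    by apply: (BV _ (vW i) vix); exact: (pW _ x).
  rewrite /spanier -map_comp map_vertex_list.
  exact: (list_cochainE set0 _ (pushforward (refinement_map_simplicial rP) v)).
by apply/asboolP; exists b'.
Qed.

Definition cech_class U n (z : cocycle (nerve (val U)) int n) : cech_cohomology n T int :=
  @limit_class _ _ (@cech_transition T int n) U (cohomology_class z).

Lemma cech_classB U n (y z : cocycle (nerve (val U)) int n) :
  cech_class (y - z) = cech_class y - cech_class z.
Proof. by rewrite /cech_class cohomology_classB limit_classB. Qed.

Lemma cech_class_refine U W r (rP : refinement_map (val U) (val W) r) n
    (z : cocycle (nerve (val U)) int n) :
  cech_class (pullback_cocycle (refinement_map_simplicial rP) z) = cech_class z.
Proof.
rewrite /cech_class -cohomology_mapE; apply: limit_class_transition.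
by exists r, rP.
Qed.

Lemma cech_class_ind n (Q : cech_cohomology n T int -> Prop) :
  (forall a b, Q a -> Q b -> Q (a - b)) ->
  (forall U (z : cocycle (nerve (val U)) int n), Q (cech_class z)) -> Q 0 ->
  forall a, Q a.
Proof.
move=> QB Qcl Q0; apply: limit_class_ind => // U x.
by rewrite -(cohomology_classK x); exact: Qcl.
Qed.

Lemma cech_class_eq0 U n (z : cocycle (nerve (val U)) int n.+1) :
  loccob setT n.+2 (spanier z) -> cech_class z = 0.
Proof.
move=> /spanier_dies[W [r [rP /cohomology_class_eq0 z0]]].
by rewrite -(cech_class_refine rP) /cech_class z0 limit_class0.
Qed.

Lemma cocycle_delta0 (V : Type) (K : simplicial_complex V) n (z : cocycle K int n) :
  coboundary z = 0.
Proof. by have /asboolP[] := cocycleP z. Qed.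

(** Both cocycles are pulled back to the cover by pairwise intersections, where their difference is
    a cocycle of one nerve. *)
Lemma cech_class_eq U W n (y : cocycle (nerve (val U)) int n.+1)
    (z : cocycle (nerve (val W)) int n.+1) :
  loccob setT n.+2 (fun s => spanier y s - spanier z s) -> cech_class y = cech_class z.
Proof.
move=> yz; have [Uo UT] := open_coverP U; have [Wo WT] := open_coverP W.
have [C CE] : exists C : open_cover T,
    val C = [set B | exists A A', [/\ val U A, val W A' & B = A `&` A']].
  apply: exists_open_cover => [_ [A [A' [UA WA' ->]]]|x].
    by apply: openI; [exact: Uo|exact: Wo].
  have [A UA Ax] := UT x; have [A' WA' A'x] := WT x.
  by exists (A `&` A') => //; exists A, A'.
have /choice[r rP] B : exists A, val C B -> val U A /\ B `<=` A.
  have [|nCB] := pselect (val C B); last by exists set0.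
  rewrite CE => -[A [A' [UA WA' ->]]]; by exists A => _; split=> // x [].
have /choice[r' r'P] B : exists A, val C B -> val W A /\ B `<=` A.
  have [|nCB] := pselect (val C B); last by exists set0.
  rewrite CE => -[A [A' [UA WA' ->]]]; by exists A' => _; split=> // x [].
have rP' : refinement_map (val U) (val C) r by [].
have r'P' : refinement_map (val W) (val C) r' by [].
rewrite -(cech_class_refine rP') -(cech_class_refine r'P').
apply/eqP; rewrite -subr_eq0 -cech_classB; apply/eqP/cech_class_eq0.
have h1 := spanier_pullback rP' (cocycle_delta0 y).
have h2 := spanier_pullback r'P' (cocycle_delta0 z).
have := locally_coboundaryD nbhsF (locally_coboundaryB nbhsF h1 h2) yz.
apply: locally_coboundary_ext => s; rewrite -[RHS]/(spanier (_ - _) s) spanierB /=.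
ring.
Qed.

Lemma spanier_repr U n (z : cocycle (nerve (val U)) int n.+1) :
  loccob setT n.+2 (fun s => spanier (repr (cohomology_class z)) s - spanier z s).
Proof.
have [b bz] := is_coboundaryS (repr_cohomology_class z).
apply: locally_coboundary_ext (spanier_coboundary b) => s.
by rewrite bz -spanierB.
Qed.

Lemma spanier_reprB U n (x y : cohomology (nerve (val U)) int n.+1) :
  loccob setT n.+2 (fun s => spanier (repr (x - y)) s -
    (spanier (repr x) s - spanier (repr y) s)).
Proof.
have := @spanier_repr U n (repr x - repr y).
rewrite cohomology_classB !cohomology_classK.
apply: locally_coboundary_ext => s; congr (_ - _).
by rewrite -spanierB.
Qed.

Lemma spanier_repr0 U n :
  loccob setT n.+2 (spanier (repr (0 : cohomology (nerve (val U)) int n.+1))).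
Proof.
have := @spanier_repr U n 0.
have -> : cohomology_class (0 : cocycle (nerve (val U)) int n.+1) = 0.
  by rewrite -[X in cohomology_class X](subrr 0) cohomology_classB subrr.
apply: locally_coboundary_ext => s.
rewrite -[RHS]subr0; congr (_ - _).
by rewrite -[LHS]/(spanier (0 : cochain (nerve (val U)) int n.+1) s)
  -(subrr (0 : cochain _ _ _)) spanierB subrr.
Qed.

Lemma locally_coboundary_sum (J : Type) (l : seq J) m (z : J -> seq T -> int) :
  (forall j, loccob setT m (z j)) -> loccob setT m (fun s => \sum_(j <- l) z j s).
Proof.
move=> zl; elim: l => [|j l IHl].
  by apply: locally_coboundary_ext (locally_coboundary0 nbhsF _ _) => s; rewrite big_nil.
by apply: locally_coboundary_ext (locally_coboundaryD nbhsF (zl j) IHl) => s; rewrite big_cons.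
Qed.

Section Kernel.
Variable n : nat.
Notation G := (fun U : open_cover T => cohomology (nerve (val U)) int n.+1).

Let spanier_sum (x : direct_sum G) (l : seq (open_cover T)) (s : seq T) : int :=
  \sum_(U <- l) spanier (repr (direct_sum_val x U)) s.

(* Asking for all large enough sets of covers makes [null] a subgroup without
   comparing the supports of its elements. *)
Let null : set (direct_sum G) := [set x |
  exists l0 : seq (open_cover T), forall l : seq (open_cover T), uniq l ->
  {subset l0 <= l} -> loccob setT n.+2 (spanier_sum x l)].

Lemma spanier_sum_inj U (x : G U) (l : seq (open_cover T)) : uniq l -> U \in l ->
  loccob setT n.+2 (fun s => spanier_sum (direct_sum_inj x) l s - spanier (repr x) s).
Proof.
move=> l_uniq Ul.
have := @locally_coboundary_sum _ [seq W <- l | W != U] n.+2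
  (fun W s => if W == U then 0 else spanier (repr (direct_sum_val (direct_sum_inj x) W)) s).
have z0 W : loccob setT n.+2 (fun s => if W == U then 0 else
    spanier (repr (direct_sum_val (direct_sum_inj x) W)) s).
  have [_|WU] := eqVneq W U.
    exact: locally_coboundary0.
  by rewrite direct_sum_inj_other 1?eq_sym//; exact: spanier_repr0.
move=> /(_ z0); apply: locally_coboundary_ext => s.
rewrite big_filter /spanier_sum (bigD1_seq U)// direct_sum_inj_same.
rewrite addrAC subrr add0r.
by apply: eq_bigr => W /negPf ->.
Qed.

Lemma null_zmod_closed : zmod_closed (fun v : direct_sum G => v \in null).
Proof.
split=> [|x y /set_mem[lx xP] /set_mem[ly yP]]; apply/mem_set.
  exists [::] => l _ _; apply: locally_coboundary_sum => U; exact: spanier_repr0.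
exists (lx ++ ly) => l l_uniq l_sub.
have xl : loccob setT n.+2 (spanier_sum x l).
  by apply: xP => // U Ux; apply: l_sub; rewrite mem_cat Ux.
have yl : loccob setT n.+2 (spanier_sum y l).
  by apply: yP => // U Uy; apply: l_sub; rewrite mem_cat Uy orbT.
have xyl := locally_coboundary_sum l
  (fun U => spanier_reprB (direct_sum_val x U) (direct_sum_val y U)).
have := locally_coboundaryD nbhsF xyl (locally_coboundaryB nbhsF xl yl).
apply: locally_coboundary_ext => s; rewrite /spanier_sum !sumrB; ring.
Qed.

Lemma null_relators : @limit_relators _ G (@cech_transition T int n.+1) `<=` null.
Proof.
move=> _ [U [W [t [x [[r [rP ->]] ->]]]]].
exists [:: U; W] => l l_uniq l_sub.
have Ul : U \in l by apply: l_sub; rewrite inE eqxx.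
have Wl : W \in l by apply: l_sub; rewrite !inE eqxx orbT.
set y := cohomology_map _ x.
have xl := spanier_sum_inj x l_uniq Ul; have yl := spanier_sum_inj y l_uniq Wl.
have xyl := locally_coboundary_sum l (fun V => spanier_reprB
  (direct_sum_val (@direct_sum_inj _ G U x) V)
  (direct_sum_val (@direct_sum_inj _ G W y) V)).
have yP : loccob setT n.+2 (fun s => spanier (repr y) s -
    spanier (pullback_cocycle (refinement_map_simplicial rP) (repr x)) s).
  exact: spanier_repr.
have rx := spanier_pullback rP (cocycle_delta0 (repr x)).
have := locally_coboundaryB nbhsF (locally_coboundaryB nbhsF (locally_coboundaryB nbhsF
  (locally_coboundaryD nbhsF xyl xl) yl) yP) rx.
by apply: locally_coboundary_ext => s; rewrite /spanier_sum !sumrB; ring.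
Qed.

(** The relations are the smallest subgroup that contains the relators, so it suffices that [null]
    is a subgroup containing them. This is what detects nonzero classes in the limit. *)
Lemma cech_class_eq0_spanier U (z : cocycle (nerve (val U)) int n.+1) :
  cech_class z = 0 -> loccob setT n.+2 (spanier z).
Proof.
move=> /quot_class_eq0/asboolP zR.
have [l0 zl] : null (@direct_sum_inj _ G U (cohomology_class z)).
  by apply: zR; split; [exact: null_zmod_closed|exact: null_relators].
pose l := undup (U :: l0).
have l_uniq : uniq l by exact: undup_uniq.
have l_sub : {subset l0 <= l} by move=> W Wl; rewrite mem_undup inE Wl orbT.
have Ul : U \in l by rewrite mem_undup inE eqxx.
have := locally_coboundaryB nbhsF (locally_coboundaryB nbhsF (zl l l_uniq l_sub)
  (spanier_sum_inj (cohomology_class z) l_uniq Ul)) (spanier_repr z).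
by apply: locally_coboundary_ext => s; ring.
Qed.

End Kernel.

End MetricCovers.

(** * Cech cohomology of the harmonic archipelago *)

Lemma zmod_isomorphic_quotient (A B : zmodType) (I : zmodClosed A) (f : A -> B) :
  {morph f : x y / x - y} -> (forall b, exists a, f a = b) ->
  (forall a, f a = 0 <-> a \in I) -> zmod_isomorphic B (Quotient.quot I).
Proof.
move=> fB /choice[g fg] fI.
have f_eq a a' : quot_class I a = quot_class I a' <-> f a = f a'.
  rewrite quot_class_eq -fI fB; split=> [/eqP|->]; last exact: subrr.
  by rewrite subr_eq0 => /eqP.
have hB : zmod_morphism (fun b => quot_class I (g b)).
  by move=> b b'; rewrite -quot_classB; apply/f_eq; rewrite fB !fg.
pose h : {additive B -> Quotient.quot I} :=
  HB.pack (fun b => quot_class I (g b)) (GRing.isZmodMorphism.Build _ _ _ hB).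
exists h.
exists (fun q => f (repr q)) => [b|q] /=.
  by rewrite -[RHS]fg; apply/f_eq; rewrite quot_classK.
by rewrite -[RHS]quot_classK; apply/f_eq; rewrite fg.
Qed.

Section Alternation.
Variables (R : realType) (F : R * R -> R) (gamma : nat -> R).
Variables (V : Type) (K : simplicial_complex V) (q : V -> R * R).

(** Whether all vertices are low does not depend on their order, and the cut cochain is
    antisymmetric. *)
Lemma bump_cocycle_alternating (s : nat -> int) : alternating
  (fun v : ordered_simplex K 2 => bump_cocycle F gamma s (map q (vertex_list v))).
Proof.
pose g x y := cut_cochain gamma s [:: q x; q y].
have gN x y : g y x = - g x y.
  by rewrite /g /cut_cochain andbC; case: ifP => _; rewrite ?opprB ?oppr0.
have [b_sgn b_deg] := alternating_delta (alternating_pairs K gN).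
set N := [set y | @half_plane R y -> F y < 2^-1].
have bumpE (v : ordered_simplex K 2) : bump_cocycle F gamma s (map q (vertex_list v)) =
    if `[< forall i, N (q (v i)) >] then 0
    else coboundary (fun w : ordered_simplex K 1 => g (w ord0) (w ord_max)) v.
  rewrite /bump_cocycle -/N; congr (if _ then _ else _).
    apply: asbool_equiv_eq; split=> [vN i|vN].
      by apply: vN; rewrite map_vertex_list; apply/In_vertex_list; exists i.
    by apply: inside_map => x /In_vertex_list[i <-].
  rewrite map_vertex_list delta_vertex_list; apply: eq_bigr => i _.
  rewrite vertex_listS vertex_listS vertex_list0 /g /=; congr (_ *~ _).
  congr (cut_cochain _ _ [:: _; q (v (lift i _))]); exact: val_inj.
split=> [t v|v v_deg]; rewrite !bumpE.
  rewrite b_sgn [X in if X then _ else _](_ : _ = `[< forall i, N (q (v i)) >]).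
    by case: ifP => // _; rewrite mul0rz.
  apply: asbool_equiv_eq; split=> vN i; last exact: vN.
  by have := vN (t^-1 i)%g; rewrite /= permKV.
by rewrite b_deg// if_same.
Qed.

Lemma bump_cocycleB s s' (l : seq (R * R)) :
  bump_cocycle F gamma (fun n => s n - s' n) l =
  bump_cocycle F gamma s l - bump_cocycle F gamma s' l.
Proof.
rewrite /bump_cocycle; case: ifP => _; first by rewrite subr0.
rewrite -deltaB; apply: delta_ext => -[|x [|y []]] //=; rewrite ?subr0//.
by case: ifP => _; rewrite ?subr0//; ring.
Qed.

End Alternation.

Section HarmonicArchipelagoCohomology.
Variable R : realType.
Notation T := (HA R).
Notation locz := (locally_zero (@nbhs T T)).
Notation loccob := (locally_coboundary (@nbhs T T)).
Implicit Types (x y z : T).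

Lemma HA_distxx x : HA_dist x x = 0.
Proof. by rewrite /HA_dist distpp subrr normr0 addr0. Qed.

Lemma HA_distC x y : HA_dist x y = HA_dist y x.
Proof. by rewrite /HA_dist distC [X in _ + X]distrC. Qed.

Lemma HA_dist_triangle y x z : HA_dist x z <= HA_dist x y + HA_dist y z.
Proof.
rewrite /HA_dist; have := dist_triangle (base y) (base x) (base z).
by have := ler_distD (val y).2 (val x).2 (val z).2; lra.
Qed.

Let nbhsF x : Filter (nbhs x) := nbhs_filter x.
Notation HA_spanier := (spanier HA_distxx HA_distC HA_dist_triangle (@HA_nbhsP R)).
Let spanier_delta := spanier_cocycle HA_distxx HA_distC HA_dist_triangle (@HA_nbhsP R).
Let class_eq0 :=
  @cech_class_eq0 _ _ _ HA_distxx HA_distC HA_dist_triangle (@HA_nbhsP R) (origin R).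
Let class_eq0_spanier :=
  @cech_class_eq0_spanier _ _ _ HA_distxx HA_distC HA_dist_triangle (@HA_nbhsP R).

Lemma HA_vanishing n : n <> 0%N -> n <> 2%N ->
  forall a : cech_cohomology n T int, a = 0.
Proof.
case: n => // n _ n2; apply: cech_class_ind => // [_ _ -> ->|U z]; first by rewrite subrr.
apply: class_eq0; have dz := spanier_delta (cocycle_delta0 z).
case: n n2 z dz => [|[|n]] // _ z dz; first exact: HA_degree1.
exact: HA_high_degree.
Qed.

Lemma HA_cocycleB s s' (l : seq T) :
  HA_cocycle (fun n => s n - s' n) l = HA_cocycle s l - HA_cocycle s' l.
Proof. exact: bump_cocycleB. Qed.

(** A single cover and an additive [zeta] for all sequences make the final map a homomorphism.
    Choosing points in the members of [W] returns the original cocycle up to the prism between this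
    choice and the identity. *)
Lemma nerve_cocycles : exists (W : open_cover T)
    (zeta : (nat -> int) -> cocycle (nerve (val W)) int 2),
  (forall s s', zeta (fun n => s n - s' n) = zeta s - zeta s') /\
  forall s, loccob setT 3 (fun l => HA_spanier (zeta s) l - HA_cocycle s l).
Proof.
have [||W [p [pW WP]]] := fine_cover HA_distxx HA_distC HA_dist_triangle (@HA_nbhsP R) (origin R)
    (G := [set B | forall s l, size l = 4 -> inside B l -> delta (HA_cocycle s) l = 0]).
- by move=> A B AB GB s l l4 lA; apply: GB => //; exact: sub_inside lA.
- by move=> x; have [B xB GB] := HA_cocycleP x; exists B.
pose c s : cochain (nerve (val W)) int 2 := fun v => HA_cocycle s (map p (vertex_list v)).
have cP s : c s \in @is_cocycle _ (nerve (val W)) int 2.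
  apply/asboolP; split.
    have -> : c s = fun v => bump_cocycle (@profile R) (@profile_center R) s
        (map (@plane_coord R \o p) (vertex_list v)).
      by apply/funext => v; rewrite /c /HA_cocycle [in RHS]map_comp.
    exact: bump_cocycle_alternating.
  apply/funext => v; have [_ _ _ [x vx]] := range_vertices v.
  have vW i : val W (v i) by have [+ _ _ _] := range_vertices v; apply; exists i.
  have [B GB BP] := WP x.
  transitivity (delta (HA_cocycle s) (map p (vertex_list v))).
    by rewrite -delta_map delta_vertex_list; apply: eq_bigr.
  apply: GB; first by rewrite size_map size_vertex_list.
  apply: inside_map => A /In_vertex_list[i <-].
  have vix : v i x by apply: vx; exists i.
  by apply: (BP _ (vW i) vix); exact: (pW _ x).
exists W, (fun s => Cocycle (cP s)); split=> [s s'|s].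
  by apply: val_inj; apply/funext => v; exact: HA_cocycleB.
pose cW := star_choice HA_distxx HA_distC HA_dist_triangle (@HA_nbhsP R) W.
exists (fun l => - prism (p \o cW) id (HA_cocycle s) l) => y _.
have [O yO OW] := star_choiceP HA_distxx HA_distC HA_dist_triangle (@HA_nbhsP R) W y.
exists O => // l l3 lO; rewrite deltaN opprK.
have Oy := nbhs_singleton yO.
have WcW x : val W (cW x) by exact: star_choiceU.
have [B GB BP] := WP y.
have cWB x : O x -> cW x `<=` B by move=> Ox; apply: BP => //; exact: OW Ox _ Oy.
have -> : HA_spanier (Cocycle (cP s)) l = HA_cocycle s (map (p \o cW) l).
  have l_simplex : simplex (nerve (val W)) [set A | List.In A (map cW l)].
    by apply: (star_simplex yO OW) => //; case: l l3 {lO}.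
  have lsz : size (map cW l) = 3 by rewrite size_map.
  have [v vE] := list_simplex set0 lsz l_simplex.
  by rewrite /spanier -/cW vE list_cochainE /= /c -vE -map_comp.
have := prism_delta (p \o cW) id (HA_cocycle s) l.
rewrite map_id [X in _ + X]prism_eq0 => [|t t4 tP]; first by rewrite addr0 => ->; ring.
apply: GB; first by rewrite t4 l3.
move=> w /tP[x /lO Ox [->|->]] /=; last by apply: cWB Ox _ (OW _ Ox _ Ox).
by apply: cWB Ox _ (pW _ y (WcW x) (OW _ Ox _ Oy)).
Qed.

(** The inverse of taking consecutive differences, normalised to start at 0: finitely supported
    sequences correspond to eventually constant ones, which give trivial classes. *)
Definition partial_sums (a : direct_product (fun _ : nat => int)) (n : nat) : int :=
  \sum_(i < n) a i.

Lemma partial_sumsB (a b : direct_product (fun _ : nat => int)) :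
  partial_sums (a - b) = fun n => partial_sums a n - partial_sums b n.
Proof. by apply/funext => n; rewrite /partial_sums -sumrB. Qed.

Lemma partial_sums_stable (a : direct_product (fun _ : nat => int)) :
  a \in @finitely_supported nat (fun=> int) <->
  exists k c, forall n, (k < n)%N -> partial_sums a n = c.
Proof.
split=> [/asboolP/finite_seqP[l al]|[k [c ac]]].
  have a0 n : (\max_(i <- l) i < n)%N -> a n = 0.
    move=> ln; apply/eqP; apply: contraT => an.
    have : n \in l by have : [set` l] n by rewrite -al.
    by move=> nl; move: ln; rewrite ltnNge leq_bigmax_seq.
  exists (\max_(i <- l) i), (partial_sums a (\max_(i <- l) i).+1) => n.
  elim: n => // n IHn; rewrite ltnS leq_eqVlt => /predU1P[->//|ln].
  by rewrite -IHn// /partial_sums big_ord_recr /= a0 ?addr0.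
apply/asboolP; apply: (@sub_finite_set _ _ `I_k.+1); last exact: finite_II.
move=> n /=; apply: contraNltn => kn; apply/eqP.
have := ac n.+1 (leqW kn); rewrite /partial_sums big_ord_recr /= -/(partial_sums a n).
by rewrite (ac n kn) => /(congr1 (fun m => m - c)); rewrite addrAC subrr add0r.
Qed.

Lemma HA_cohomology2 : zmod_isomorphic (cech_cohomology 2 T int) int_sequences_mod_finite.
Proof.
have [W [zeta [zetaB zetaP]]] := nerve_cocycles.
pose psi a : cech_cohomology 2 T int := cech_class (zeta (partial_sums a)).
have psiB : {morph psi : a b / a - b}.
  by move=> a b; rewrite /psi partial_sumsB zetaB cech_classB.
apply: (zmod_isomorphic_quotient (f := psi)) => // [x|a].
  move: x; apply: cech_class_ind => [_ _ [a <-] [b <-]|U z|].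
  - by exists (a - b); rewrite psiB.
  - have [s zs] := HA_degree2 (spanier_delta (cocycle_delta0 z)).
    pose a : direct_product (fun _ : nat => int) := fun n => s n.+1 - s n.
    exists a.
    apply: (@cech_class_eq _ _ _ HA_distxx HA_distC HA_dist_triangle (@HA_nbhsP R) (origin R)).
    (* [s] and the partial sums of its differences differ by the constant [s 0], whose cocycle is a
       coboundary. *)
    have aE n : s n - partial_sums a n = s 0%N.
      elim: n => [|n <-]; first by rewrite /partial_sums big_ord0 subr0.
      by rewrite /partial_sums big_ord_recr /= /a; ring.
    have s0 : loccob setT 3 (HA_cocycle (fun n => s n - partial_sums a n)).
      by apply: (@HA_cocycle_trivial _ _ 0%N (s 0%N)) => n _.
    have := locally_coboundaryB nbhsF (locally_coboundaryB nbhsF (zetaP (partial_sums a)) s0) zs.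
    by apply: locally_coboundary_ext => l; rewrite HA_cocycleB; ring.
  - exists 0; have := psiB 0 0; rewrite !subrr; exact.
rewrite partial_sums_stable; split=> [/class_eq0_spanier|[k [c ac]]].
  move=> /(locally_coboundaryB nbhsF) /(_ (zetaP (partial_sums a))) za.
  apply: HA_cocycle_nontrivial.
  by apply: locally_coboundary_ext za => l; ring.
apply: class_eq0; have ga := @HA_cocycle_trivial R _ k.+1 c ac.
have := locally_coboundaryD nbhsF (zetaP (partial_sums a)) ga.
by apply: locally_coboundary_ext => l; ring.
Qed.

End HarmonicArchipelagoCohomology.

Theorem theorem1p3 (R : realType) :
  zmod_isomorphic (cech_cohomology 2 (HA R) int) int_sequences_mod_finite /\
  (forall n : nat, n <> 0%N -> n <> 2%N ->
     forall x : cech_cohomology n (HA R) int, x = 0%R).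
Proof. by split; [exact: HA_cohomology2|exact: HA_vanishing]. Qed.
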